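(* Let $d\ge2$, $-4\le\gamma\le0$, $\varepsilon>0$, and let $f$ be a dissipative $\varepsilon$-solution of the regularized homogeneous Landau equation (as defined in the context). Then $f$ is a stationary state if and only if $f$ is a Maxwellian $\mathcal{M}_{\rho,u,T}$ whose parameters are given by \[ \rho=\left(\frac{2\pi}{|\lambda^{(2)}|}\right)^{d/2}\exp\left\{\lambda^{(0)}+\frac{\varepsilon|\lambda^{(2)}|d}{2}-\frac{\varepsilon|\lambda^{(1)}|^2}{2(1-\varepsilon|\lambda^{(2)}|)}+\frac{|\lambda^{(1)}|^2}{2|\lambda^{(2)}|(1-\varepsilon|\lambda^{(2)}|)}\right\},\quad u=\frac{\lambda^{(1)}}{|\lambda^{(2)}|},\quad T=\frac{1}{|\lambda^{(2)}|}-\varepsilon, \] where $\lambda^{(0)}\in\mathbb{R},\lambda^{(1)}\in\mathbb{R}^d,\lambda^{(2)}\in\mathbb{R}$ are the coefficients of the quadratic polynomial $\frac{\delta E_\varepsilon}{\delta f}(v)=\lambda^{(0)}+\lambda^{(1)}\cdot v+\frac{\lambda^{(2)}}{2}|v|^2$.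
   Context: Collision kernel $A(z)=|z|^{\gamma}(|z|^2I_d-z\otimes z)$. Mollifier $\psi_\varepsilon(v)=(2\pi\varepsilon)^{-d/2}e^{-|v|^2/(2\varepsilon)}$. $E_\varepsilon(f)=\int(f*\psi_\varepsilon)\log(f*\psi_\varepsilon)\,\mathrm{d}v$, $\frac{\delta E_\varepsilon}{\delta f}=\psi_\varepsilon*\log(f*\psi_\varepsilon)$, $\nabla_v\frac{\delta E_\varepsilon}{\delta f}=(\nabla\psi_\varepsilon)*\log(f*\psi_\varepsilon)$, $B^\varepsilon_{v,v_*}=\nabla_v\frac{\delta E_\varepsilon}{\delta f}(v)-\nabla_{v_*}\frac{\delta E_\varepsilon}{\delta f}(v_* )$, $f=f(v)$, $f_*=f(v_* )$, $\phi_*=\phi(v_* )$. Maxwellian: $\mathcal{M}_{\rho,u,T}(v)=\rho(2\pi T)^{-d/2}\exp(-|v-u|^2/(2T))$. $L^1_p$: $\int(1+|v|^p)|g|<\infty$; $\kappa(\gamma)=4+\gamma$ for $-2\le\gamma\le0$, $6+\gamma/2$ for $-4\le\gamma<-2$. A weak $\varepsilon$-solution on $[0,T]$ is a nonnegative $f\in C([0,T];L^1_{\kappa(\gamma)})$ with $\int_0^T\!\int\partial_t\phi f-\frac12\int_0^T\!\iint(\nabla_v\phi-\nabla_{v_*}\phi_* )\cdot A(v-v_* )B^\varepsilon_{v,v_*}ff_*=0$ for all $\phi\in C_0^\infty((0,T)\times\mathbb{R}^d)$. A dissipative $\varepsilon$-solution is a weak $\varepsilon$-solution with: (1) $\frac{d}{dt}\int\phi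 f=-\frac12\iint(\nabla_v\phi-\nabla_{v_*}\phi_* )\cdot A(v-v_* )B^\varepsilon_{v,v_*}ff_*$ for all $\phi\in C_0^\infty(\mathbb{R}^d)$; (2) $E_\varepsilon(f(0,\cdot))<\infty$; (3) $\frac12\iint B^\varepsilon\cdot AB^\varepsilon ff_*\in L^1(0,T)$. A stationary state is a dissipative $\varepsilon$-solution with $\iint(\nabla_v\phi-\nabla_{v_*}\phi_* )\cdot A(v-v_* )B^\varepsilon_{v,v_*}ff_*\,\mathrm{d}v\,\mathrm{d}v_*=0$ for all $\phi\in C_0^\infty(\mathbb{R}^d)$ and all $t\in[0,T]$. *)

(* Defs.v *)
From HB Require Import structures.
From mathcomp Require Import all_boot all_order all_algebra.
From mathcomp Require Import all_classical all_reals all_analysis.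
Import Order.TTheory GRing.Theory Num.Theory.
Import numFieldNormedType.Exports.

Unset Implicit Arguments.
Unset Strict Implicit.
Unset Printing Implicit Defensive.

Local Open Scope classical_set_scope.
Local Open Scope ring_scope.

Section LandauDefs.
Context {R : realType}.

Definition dotv {d} (a b : 'rV[R]_d) : R := \sum_(i < d) a ord0 i * b ord0 i.
Definition sqn {d} (a : 'rV[R]_d) : R := dotv a a.
Definition normv {d} (a : 'rV[R]_d) : R := Num.sqrt (sqn a).
Definition unitv {d} (i : 'I_d) : 'rV[R]_d := \row_(j < d) (i == j)%:R.

(** Lebesgue integral over R^d, as iterated one-dimensional Lebesgue
    integrals (Tonelli/Fubini). *)
Definition vcons {n} (x : R) (w : 'rV[R]_n) : 'rV[R]_n.+1 :=
  \row_(i < n.+1) (if unlift ord0 i is Some j then w ord0 j else x).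

Fixpoint iint (n : nat) : ('rV[R]_n -> \bar R) -> \bar R :=
  match n return ('rV[R]_n -> \bar R) -> \bar R with
  | 0 => fun F => F 0
  | n'.+1 => fun F =>
      (\int[@lebesgue_measure R]_x @iint n' (fun w => F (vcons x w)))%E
  end.
Arguments iint : clear implicits.

Definition rint {n} (F : 'rV[R]_n -> R) : R := fine (iint n (fun v => (F v)%:E)).

(** Borel measurability on R^d (sigma-algebra generated by coordinates) *)
Definition coord_sets n : set (set 'rV[R]_n) :=
  [set A | exists (i : 'I_n) (B : set R), measurable B /\
           A = (fun v : 'rV[R]_n => v ord0 i) @^-1` B].
Definition rv_measurable {n} (F : 'rV[R]_n -> R) : Prop :=
  forall B : set R, measurable B -> <<s coord_sets n >> (F @^-1` B).

Fixpoint Dn {V : normedModType R} (es : seq V) (F : V -> R) : V -> R :=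
  match es with
  | [::] => F
  | e :: es' => fun x => 'D_e (Dn es' F) x
  end.
Definition smooth {V : normedModType R} (F : V -> R) : Prop :=
  forall es : seq V, continuous (Dn es F) /\
    forall e x : V, derivable (Dn es F) x e.

Definition grad {d} (F : 'rV[R]_d -> R) (v : 'rV[R]_d) : 'rV[R]_d :=
  \row_(i < d) 'D_(unitv i) F v.

Definition test_fun {d} (phi : 'rV[R]_d -> R) : Prop :=
  smooth phi /\ exists M : R, forall v, M < normv v -> phi v = 0.

Definition test_fun_time {d} (Tf : R) (Phi : R * 'rV[R]_d -> R) : Prop :=
  smooth Phi /\ exists a b M : R, 0 < a /\ b < Tf /\
    forall t v, (t < a \/ b < t \/ M < normv v) -> Phi (t, v) = 0.

Definition psi {d} (eps : R) (v : 'rV[R]_d) : R :=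
  (2 * pi * eps) `^ (- (d%:R / 2)) * expR (- sqn v / (2 * eps)).

Definition molli {d} (eps : R) (g : 'rV[R]_d -> R) (v : 'rV[R]_d) : R :=
  rint (fun w => g w * psi eps (v - w)).

Definition Eeps {d} (eps : R) (g : 'rV[R]_d -> R) : \bar R :=
  iint d (fun v => (molli eps g v * ln (molli eps g v))%:E).

(** delta E_eps / delta f = psi_eps * log(f * psi_eps) *)
Definition dE {d} (eps : R) (g : 'rV[R]_d -> R) (v : 'rV[R]_d) : R :=
  rint (fun w => psi eps (v - w) * ln (molli eps g w)).

(** grad_v delta E_eps / delta f = (grad psi_eps) * log(f * psi_eps) *)
Definition graddE {d} (eps : R) (g : 'rV[R]_d -> R) (v : 'rV[R]_d) : 'rV[R]_d :=
  \row_(i < d) rint (fun w => (grad (psi eps) (v - w)) ord0 i * ln (molli eps g w)).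

Definition Beps {d} (eps : R) (g : 'rV[R]_d -> R) (v w : 'rV[R]_d) : 'rV[R]_d :=
  graddE eps g v - graddE eps g w.

Definition Akern {d} (gamma : R) (z : 'rV[R]_d) : 'M[R]_d :=
  (normv z `^ gamma) *: (sqn z *: 1%:M - z^T *m z).

Definition Aform {d} (gamma : R) (a : 'rV[R]_d) (z : 'rV[R]_d) (b : 'rV[R]_d) : R :=
  (a *m Akern gamma z *m b^T) ord0 ord0.

Definition coll {d} (gamma eps : R) (g : 'rV[R]_d -> R) (phi : 'rV[R]_d -> R) : \bar R :=
  iint d (fun v => iint d (fun w =>
    (Aform gamma (grad phi v - grad phi w) (v - w) (Beps eps g v w)
       * g v * g w)%:E)).

Definition dissip {d} (gamma eps : R) (g : 'rV[R]_d -> R) : \bar R :=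
  iint d (fun v => iint d (fun w =>
    (2^-1 * Aform gamma (Beps eps g v w) (v - w) (Beps eps g v w)
       * g v * g w)%:E)).

Definition kappa (gamma : R) : R :=
  if -2 <= gamma then 4 + gamma else 6 + gamma / 2.

Definition CL1 {d} (k Tf : R) (f : R -> 'rV[R]_d -> R) : Prop :=
  (forall t, 0 <= t <= Tf ->
     rv_measurable (f t) /\
     (iint d (fun v => ((1 + normv v `^ k) * `|f t v|)%:E) < +oo)%E) /\
  (forall t, 0 <= t <= Tf -> forall e : R, 0 < e -> exists2 del : R, 0 < del &
     forall s, 0 <= s <= Tf -> `|s - t| < del ->
     (iint d (fun v => ((1 + normv v `^ k) * `|f s v - f t v|)%:E) < e%:E)%E).

Definition weak_sol {d} (gamma eps Tf : R) (f : R -> 'rV[R]_d -> R) : Prop :=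
  (forall t v, 0 <= t <= Tf -> 0 <= f t v) /\
  CL1 (kappa gamma) Tf f /\
  forall Phi : R * 'rV[R]_d -> R, test_fun_time Tf Phi ->
    ((\int[@lebesgue_measure R]_(t in `[0%R, Tf])
        iint d (fun v => ('D_(1, 0) Phi (t, v) * f t v)%:E))
     - (2^-1)%:E * (\int[@lebesgue_measure R]_(t in `[0%R, Tf])
        coll gamma eps (f t) (fun v => Phi (t, v))) = 0)%E.

Definition dissipative_sol {d} (gamma eps Tf : R) (f : R -> 'rV[R]_d -> R) : Prop :=
  weak_sol gamma eps Tf f /\
  (forall phi : 'rV[R]_d -> R, test_fun phi ->
     forall t, 0 < t < Tf -> exists D : R,
       is_derive t 1 (fun s => rint (fun v => phi v * f s v)) D /\
       (D%:E = (- 2^-1)%:E * coll gamma eps (f t) phi)%E) /\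
  (Eeps eps (f 0%R) < +oo)%E /\
  (@lebesgue_measure R).-integrable `[0%R, Tf] (fun t => dissip gamma eps (f t)).

Definition stationary_state {d} (gamma eps Tf : R) (f : R -> 'rV[R]_d -> R) : Prop :=
  dissipative_sol gamma eps Tf f /\
  forall phi : 'rV[R]_d -> R, test_fun phi ->
    forall t, 0 <= t <= Tf -> coll gamma eps (f t) phi = 0%E.

Definition maxwellian {d} (rho : R) (u : 'rV[R]_d) (T : R) (v : 'rV[R]_d) : R :=
  rho * (2 * pi * T) `^ (- (d%:R / 2)) * expR (- sqn (v - u) / (2 * T)).

Definition rho_of (d : nat) (eps l0 : R) {n} (l1 : 'rV[R]_n) (l2 : R) : R :=
  (2 * pi / `|l2|) `^ (d%:R / 2) *
  expR (l0 + eps * `|l2| * d%:R / 2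
        - eps * sqn l1 / (2 * (1 - eps * `|l2|))
        + sqn l1 / (2 * `|l2| * (1 - eps * `|l2|))).
Definition u_of {n} (l1 : 'rV[R]_n) (l2 : R) : 'rV[R]_n := `|l2|^-1 *: l1.
Definition T_of (eps l2 : R) : R := `|l2|^-1 - eps.

End LandauDefs.

(* Main.v *)
(* Test a stationary state with chi dE, where chi is a smooth cutoff and dE the
   first variation of the entropy. Removing the cutoff gives a vanishing
   dissipation, so that g(v) - g(w) is parallel to v - w for almost all v, w with
   f(v) f(w) > 0, where g is the gradient of dE. On each line, g times
   exp(|v|^2 / (2 eps)) is a Laplace transform of a function with Gaussian decay,
   hence entire, so the parallelism extends from a set of positive measure to all
   v, w. In dimension at least 2 it forces g(v) = l1 + l2 v, that is, dE is
   quadratic. Gaussian convolution is injective on functions of moderate growth;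
   hence log(f * psi) is quadratic, f * psi is a Gaussian, and f is a Maxwellian:
   l2 < 0 because f * psi vanishes at infinity, and eps |l2| < 1 because the
   Gaussian f * psi must be wider than psi. Stationarity makes the mass constant
   in time, so these arguments apply at every time. Conversely, if dE is
   quadratic then B = l2 (v - w) lies in the kernel of A(v - w). *)
Require Import Defs.
From HB Require Import structures.
From mathcomp Require Import all_boot all_order all_algebra.
From mathcomp Require Import all_classical all_reals all_analysis.
From mathcomp Require Import measurable_realfun ring lra.
Import Order.TTheory GRing.Theory Num.Theory.
Import numFieldNormedType.Exports.
Local Open Scope classical_set_scope.
Local Open Scope ring_scope.

(* ['rV[R]_n] carrying the Borel sigma-algebra of [rv_measurable]. *)
Notation rvm R n := (g_sigma_algebraType (@coord_sets R n)).

(** * Lebesgue measure on R^n *)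

Section LebesgueRn.
Context {R : realType}.

(** The decisive obstacle is domination when the cutoff is removed. The moment [kappa gamma] leaves
    room for linear growth of the gradient of [dE] only, while the logarithm of the mollified
    density grows quadratically, and a growth bound alone would give a quadratic gradient. The
    missing power comes from a Lipschitz bound on that logarithm, which Jensen's inequality yields
    from the mass and the second moment. The truncated gradient needs the same bounds uniformly in
    the cutoff parameter [c]; the cutoff depends on [c * sqn v], so that each of its derivatives
    pays for a power of [normv v]. Neither complex nor Fourier analysis enters. Entire functions are
    real functions with factorial bounds on their derivatives. Injectivity of Gaussian convolution
    rests on a class of functions with vanishing integrals against damped exponentials, which is
    stable under multiplication by indicators of Borel sets. *)

Lemma measurable_coord n (i : 'I_n) :
  measurable_fun setT (fun v : rvm R n => (v : 'rV[R]_n) ord0 i).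
Proof.
move=> _ B mB; rewrite setTI; apply: sub_sigma_algebra.
by exists i, B.
Qed.

Lemma measurable_rvP {d} {T : measurableType d} n (h : T -> rvm R n) :
  (forall i : 'I_n, measurable_fun setT (fun x => (h x : 'rV[R]_n) ord0 i)) ->
  measurable_fun setT h.
Proof.
move=> mh; apply: (@measurability _ _ _ _ setT h (@coord_sets R n)) => //.
move=> _ [A [i [B [mB ->]]] <-]; rewrite setTI.
by have := mh i measurableT B mB; rewrite setTI.
Qed.

Definition vtail {n} (v : 'rV[R]_n.+1) : 'rV[R]_n :=
  \row_(j < n) v ord0 (lift ord0 j).

Lemma vconsK_head n (x : R) (w : 'rV[R]_n) : vcons x w ord0 ord0 = x.
Proof. by rewrite mxE unlift_none. Qed.

Lemma vcons_lift n (x : R) (w : 'rV[R]_n) j : vcons x w ord0 (lift ord0 j) = w ord0 j.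
Proof. by rewrite mxE liftK. Qed.

Lemma vconsK_tail n (x : R) (w : 'rV[R]_n) : vtail (vcons x w) = w.
Proof. by apply/rowP => j; rewrite mxE vcons_lift. Qed.

Lemma vconsE n (v : 'rV[R]_n.+1) : v = vcons (v ord0 ord0) (vtail v).
Proof.
apply/rowP => i; case: (unliftP ord0 i) => [j ->|->].
  by rewrite vcons_lift mxE.
by rewrite vconsK_head.
Qed.

Lemma measurable_vcons n :
  measurable_fun setT (fun p : measurableTypeR R * rvm R n => vcons p.1 p.2 : rvm R n.+1).
Proof.
apply: measurable_rvP => i; rewrite /vcons.
case: (unliftP ord0 i) => [j ->|->].
  under eq_fun do rewrite mxE liftK.
  by apply: (measurableT_comp (measurable_coord n j)).
under eq_fun do rewrite mxE unlift_none.
exact: measurable_fst.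
Qed.

Lemma measurable_vcons_comp {d} {T : measurableType d} n
    (f : T -> measurableTypeR R) (g : T -> rvm R n) :
  measurable_fun setT f -> measurable_fun setT g ->
  measurable_fun setT (fun x => vcons (f x) (g x) : rvm R n.+1).
Proof.
move=> mf mg; have := measurable_fun_pair mf mg.
exact: (measurableT_comp (measurable_vcons n)).
Qed.

Section succ.
Variable n : nat.
Variable m : {sigma_finite_measure set (rvm R n) -> \bar R}.

(** The image of the product measure under [vcons], so that integration against [lebn] unwinds along
    the same recursion as [iint]. *)
Definition leb_succ : set (rvm R n.+1) -> \bar R :=
  pushforward (@lebesgue_measure R \x m)%E (fun p => vcons p.1 p.2 : rvm R n.+1).

Let lebp : {measure set (rvm R n.+1) -> \bar R} :=
  measure_function_pushforward__canonical__measure_function_Measure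
    (@lebesgue_measure R \x m)%E (measurable_vcons n).

HB.instance Definition _ := isMeasure.Build _ _ _ leb_succ
  (measure0 lebp) (measure_ge0 lebp) (@measure_semi_sigma_additive _ _ _ lebp).

Let leb_succ_sigma_finite : sigma_finite setT leb_succ.
Proof.
have /sigma_finiteP[F [TF ndF mF]] := sigma_finiteT (@lebesgue_measure R).
have /sigma_finiteP[G [TG ndG mG]] := sigma_finiteT m.
(* [u] inverts [vcons]; the exhausting rectangles are pulled back along it. *)
pose u (v : rvm R n.+1) : (measurableTypeR R * rvm R n) := ((v : 'rV[R]_n.+1) ord0 ord0, vtail v).
have mu_ : measurable_fun setT u.
  apply/measurable_fun_pairP; split; first exact: measurable_coord.
  apply: measurable_rvP => i; rewrite /vtail /=.
  under eq_fun do rewrite mxE.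
  exact: measurable_coord.
have mFG k : measurable (F k `*` G k).
  by apply: measurableX; [have [] := mF k|have [] := mG k].
exists (fun k => u @^-1` (F k `*` G k)).
  rewrite -preimage_bigcup (_ : \bigcup_i _ = setT) ?preimage_setT//.
  apply/seteqP; split => // -[x w] _.
  have [i _ Fi] : (\bigcup_i F i) x by rewrite -TF.
  have [j _ Gj] : (\bigcup_i G i) w by rewrite -TG.
  exists (maxn i j) => //; split => /=.
    by move: Fi; apply/subsetPset/ndF/leq_maxl.
  by move: Gj; apply/subsetPset/ndG/leq_maxr.
move=> k; split.
  by have := mu_ measurableT _ (mFG k); rewrite setTI.
rewrite /leb_succ /pushforward -comp_preimage.
rewrite (_ : u \o _ = id) ?preimage_id; last first.
  by apply/funext => -[x w]; rewrite /u /= vconsK_tail vconsK_head.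
have [mFk Fk] := mF k; have [mGk Gk] := mG k.
by rewrite product_measure1E// lte_mul_pinfty// ge0_fin_numE.
Qed.

HB.instance Definition _ := Measure_isSigmaFinite.Build _ _ _ leb_succ
  leb_succ_sigma_finite.

Definition lebS : {sigma_finite_measure set (rvm R n.+1) -> \bar R} := leb_succ.
End succ.

Definition leb0 : {sigma_finite_measure set (rvm R 0) -> \bar R} :=
  @dirac _ (rvm R 0) (0 : 'rV[R]_0) R.

Fixpoint lebn n : {sigma_finite_measure set (rvm R n) -> \bar R} :=
  match n with
  | 0 => leb0
  | n.+1 => lebS n (lebn n)
  end.

Definition lebprod n : {measure set (measurableTypeR R * rvm R n)%type -> \bar R} :=
  (@lebesgue_measure R \x lebn n)%E.

Lemma integral_leb0 (F : rvm R 0 -> \bar R) : measurable_fun setT F ->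
  (\int[lebn 0]_v F v = F (0%R : 'rV[R]_0))%E.
Proof. by move=> mF; rewrite /= integral_dirac// diracT mul1e. Qed.

Lemma ge0_integral_lebS n (F : rvm R n.+1 -> \bar R) :
  measurable_fun setT F -> (forall v, 0 <= F v)%E ->
  (\int[lebn n.+1]_v F v =
   \int[@lebesgue_measure R]_x \int[lebn n]_w F (vcons x w))%E.
Proof.
move=> mF F0.
rewrite [LHS](@ge0_integral_pushforward _ _ _ _ _ _ (measurable_vcons n)
  (lebprod n) setT F)//=.
rewrite preimage_setT fubini_tonelli1//.
exact: (measurableT_comp mF (measurable_vcons n)).
Qed.

Lemma integrable_lebS n (F : rvm R n.+1 -> \bar R) :
  (lebn n.+1).-integrable setT F ->
  (lebprod n).-integrable setT (fun p => F (vcons p.1 p.2)).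
Proof.
move=> /integrableP[mF iF]; apply/integrableP; split.
  exact: (measurableT_comp mF (measurable_vcons n)).
move: iF; rewrite [X in (X < _)%E -> _](@ge0_integral_pushforward _ _ _ _ _ _
  (measurable_vcons n) (lebprod n) setT (fun v => `|F v|%E))//=.
by apply: measurableT_comp.
Qed.

Lemma integral_lebS n (F : rvm R n.+1 -> \bar R) :
  (lebn n.+1).-integrable setT F ->
  (\int[lebn n.+1]_v F v =
   \int[@lebesgue_measure R]_x \int[lebn n]_w F (vcons x w))%E.
Proof.
move=> iF; have iF' := integrable_lebS n F iF.
rewrite [LHS](@integral_pushforward _ _ _ _ _ _ (measurable_vcons n)
  (lebprod n) setT F)//=.
  by rewrite preimage_setT (integral12_prod_meas1 iF').
exact: measurable_int iF.
Qed.

(** The parameter [y] is there for the induction, which turns the outermost variable of integration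
    into a further parameter. Positive and negative parts are separated because Tonelli's
    measurability statement concerns nonnegative functions. *)
Lemma measurable_iint {d} {T : measurableType d} n (F : T * rvm R n -> \bar R) :
  measurable_fun setT F -> measurable_fun setT (fun y => iint n (fun w => F (y, w))).
Proof.
elim: n d T F => [d T F mF|n IH d T F mF] /=.
  have m0 : measurable_fun setT (fun y : T => (y, 0 : 'rV[R]_0) : T * rvm R 0).
    apply/measurable_fun_pairP; split; first exact: measurable_id.
    exact: measurable_cst.
  exact: (measurableT_comp mF m0).
have mH := IH _ (T * measurableTypeR R)%type (fun p => F (p.1.1, vcons p.1.2 p.2)).
rewrite (_ : (fun y => _) =
  (fun y => \int[@lebesgue_measure R]_x
     (fun q : T * measurableTypeR R => iint n (fun w => F (q.1, vcons q.2 w))) (y, x)))%E//.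
set H := (fun q : T * measurableTypeR R => _) in mH *.
have {}mH : measurable_fun setT H.
  apply: mH.
  have m1 : measurable_fun setT (fun p : T * measurableTypeR R * rvm R n =>
      (p.1.1, vcons p.1.2 p.2) : T * rvm R n.+1).
    apply: measurable_fun_pair.
      exact: (measurableT_comp measurable_fst measurable_fst).
    apply: measurable_vcons_comp; last exact: measurable_snd.
    exact: (measurableT_comp measurable_snd measurable_fst).
  exact: (measurableT_comp mF m1).
under eq_fun do rewrite integralE.
apply: emeasurable_funB.
  apply: eq_measurable_fun (@measurable_fun_fubini_tonelli_F _ _ T (measurableTypeR R) R
    (@lebesgue_measure R) H^\+%E (measurable_funepos mH) (funepos_ge0 H)).
  by move=> x _; apply: eq_integral => y _; rewrite !funeposE.
apply: eq_measurable_fun (@measurable_fun_fubini_tonelli_F _ _ T (measurableTypeR R) R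
  (@lebesgue_measure R) H^\-%E (measurable_funeneg mH) (funeneg_ge0 H)).
by move=> x _; apply: eq_integral => y _; rewrite !funenegE.
Qed.

Lemma ge0_iintE n (F : rvm R n -> \bar R) :
  measurable_fun setT F -> (forall v, 0 <= F v)%E ->
  iint n F = (\int[lebn n]_v F v)%E.
Proof.
elim: n F => [F mF F0|n IH F mF F0]; first by rewrite integral_leb0.
rewrite ge0_integral_lebS//=; apply: eq_integral => x _; rewrite IH//.
apply: (measurableT_comp mF); apply: measurable_vcons_comp.
  exact: measurable_cst.
exact: measurable_id.
Qed.

(** Fubini gives integrable slices for almost every first coordinate only, so the inner [iint] is
    identified with the inner integral almost everywhere; [measurable_iint] makes this
    sufficient. *)
Lemma integrable_iintE n (F : rvm R n -> \bar R) :
  (lebn n).-integrable setT F -> iint n F = (\int[lebn n]_v F v)%E.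
Proof.
elim: n F => [F iF|n IH F iF].
  by rewrite integral_leb0//; exact: measurable_int iF.
have mF : measurable_fun setT F by exact: measurable_int iF.
rewrite integral_lebS//=.
have iF' := integrable_lebS n F iF.
apply: ae_eq_integral => //.
- apply: (measurable_iint n (fun p : measurableTypeR R * rvm R n => F (vcons p.1 p.2))).
  exact: (measurableT_comp mF (measurable_vcons n)).
- exact: measurable_fubini_F iF'.
- have := ae_integrable1 iF'; apply: filterS => x /= iFx _.
  by rewrite IH.
Qed.

End LebesgueRn.

Notation integ mu f := (mu.-integrable setT (EFin \o f)).

(** * Integration and Euclidean geometry *)

Section Integration.
Context {R : realType} {d} {T : measurableType d}.
Variable mu : {measure set T -> \bar R}.
Implicit Types f g : T -> R.

Lemma integ_meas f : integ mu f -> measurable_fun setT f.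
Proof. by move=> /measurable_int /measurable_EFinP. Qed.

Lemma integ_le f g : measurable_fun setT f -> (forall x, `|f x| <= g x) ->
  integ mu g -> integ mu f.
Proof.
move=> mf fg ig; apply: (le_integrable measurableT _ _ ig).
  exact/measurable_EFinP.
by move=> x _ /=; rewrite lee_fin (le_trans (fg x))// ler_norm.
Qed.

Lemma integD f g : integ mu f -> integ mu g -> integ mu (fun x => f x + g x).
Proof. by move=> i1 i2; have := integrableD measurableT i1 i2. Qed.

Lemma integB f g : integ mu f -> integ mu g -> integ mu (fun x => f x - g x).
Proof. by move=> i1 i2; have := integrableB measurableT i1 i2. Qed.

Lemma integZ c f : integ mu f -> integ mu (fun x => c * f x).
Proof. by move=> i1; have := integrableZl measurableT c i1. Qed.

Lemma integ_norm f : integ mu f -> integ mu (fun x => `|f x|).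
Proof. by move=> i1; have := integrable_norm i1. Qed.

Lemma integ_sum (I : Type) (s : seq I) (h : I -> T -> R) :
  (forall i, integ mu (h i)) -> integ mu (fun x => \sum_(i <- s) h i x).
Proof.
move=> ih; elim: s => [|a s IHs].
  under eq_fun do rewrite big_nil.
  exact: integrable0.
under eq_fun do rewrite big_cons.
exact: integD.
Qed.

Lemma Rintegral_sum (I : Type) (s : seq I) (h : I -> T -> R) :
  (forall i, integ mu (h i)) ->
  \int[mu]_x (\sum_(i <- s) h i x) = \sum_(i <- s) \int[mu]_x h i x.
Proof.
move=> ih; elim: s => [|a s IHs].
  under eq_Rintegral do rewrite big_nil.
  by rewrite big_nil /Rintegral integral0.
under eq_Rintegral do rewrite big_cons.
by rewrite RintegralD// ?IHs ?big_cons//; exact: integ_sum.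
Qed.

Lemma EFin_Rintegral f : integ mu f ->
  ((\int[mu]_x f x)%:E = \int[mu]_x (f x)%:E)%E.
Proof. by move=> i1; rewrite /Rintegral fineK//; exact: integrable_fin_num. Qed.

Lemma norm_Rintegral_le f g : measurable_fun setT f -> integ mu g ->
  (forall x, `|f x| <= g x) -> `|\int[mu]_x f x| <= \int[mu]_x g x.
Proof.
move=> mf ig fg; have i1 := integ_le f g mf fg ig.
apply: le_trans (le_normr_Rintegral measurableT i1) _.
by apply: le_Rintegral => //; exact: integ_norm.
Qed.

Lemma dct (F : nat -> T -> R) f g : (forall n, measurable_fun setT (F n)) ->
  integ mu g -> (forall n x, `|F n x| <= g x) ->
  (forall x, F n x @[n --> \oo] --> f x) ->
  integ mu f /\ (\int[mu]_x F n x) @[n --> \oo] --> \int[mu]_x f x.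
Proof.
move=> mF ig Fg Ff.
have mf : measurable_fun setT f.
  by apply: (measurable_fun_cvg mF) => x _; exact: Ff.
have [] := @dominated_convergence _ _ _ mu setT measurableT
  (fun n x => (F n x)%:E) (EFin \o f) (EFin \o g).
- by move=> n; exact/measurable_EFinP.
- exact/measurable_EFinP.
- by apply: aeW => x _; apply: cvg_EFin; [exact: nearW|exact: Ff].
- exact: ig.
- by apply: aeW => x n _; rewrite /= lee_fin.
move=> i1 _ c1; split => //.
rewrite /Rintegral; apply: fine_cvg.
by rewrite fineK//; exact: integrable_fin_num.
Qed.

Lemma derive_under (f df : R -> T -> R) (a r : R) (g : T -> R) : 0 < r ->
  (forall x, `|x - a| < r -> integ mu (f x)) ->
  (forall x y, `|x - a| < r -> is_derive x 1 (f^~ y) (df x y)) ->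
  integ mu g -> (forall x y, `|x - a| < r -> `|df x y| <= g y) ->
  is_derive a (1 : R) (fun x => \int[mu]_y f x y) (\int[mu]_y df a y).
Proof.
move=> r0 fi fd gi fg.
have aI : `]a - r, a + r[%classic a.
  by rewrite /= in_itv /=; apply/andP; split; lra.
have I x : `]a - r, a + r[%classic x -> `|x - a| < r.
  by rewrite /= in_itv /= ltr_norml => /andP[? ?]; apply/andP; split; lra.
have fi' x : `]a - r, a + r[%classic x -> integ mu (f x) by move=> /I; exact: fi.
have fd' x y : `]a - r, a + r[%classic x -> setT y -> derivable (f^~ y) x 1.
  by move=> /I xa _; have [] := fd x y xa.
have E x y : `]a - r, a + r[%classic x -> partial1of2 f x y = df x y.
  by move=> /I xa; rewrite partial1of2E; have [_ ->] := fd x y xa.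
have g0 y : 0 <= g y.
  by apply: le_trans (fg a y _) => //; rewrite subrr normr0.
have fg' x y : `]a - r, a + r[%classic x -> setT y -> `|partial1of2 f x y| <= g y.
  by move=> Ix _; rewrite E//; apply/fg/I.
apply: DeriveDef.
  exact: (derivable_under_integral measurableT aI fi' fd' g0 gi fg').
rewrite -derive1E (differentiation_under_integral measurableT aI fi' fd' g0 gi fg').
by apply: eq_Rintegral => y _; rewrite -E.
Qed.

Lemma Rintegral_eq0 f : integ mu f -> (forall x, 0 <= f x) ->
  \int[mu]_x f x = 0 -> {ae mu, forall x, f x = 0}.
Proof.
move=> i1 f0 e0.
have /(ae_eq_integral_abs mu measurableT) : measurable_fun setT (EFin \o f).
  exact/measurable_EFinP/integ_meas.
move=> [+ _]; have -> : (\int[mu]_(x in setT) `|(EFin \o f) x| = 0)%E.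
  rewrite -[RHS]/(0%:E)%E -e0 EFin_Rintegral//; apply: eq_integral => x _ /=.
  by rewrite ger0_norm.
by move=> /(_ erefl); apply: filterS => x /(_ I) /= [].
Qed.

Lemma ae_eq_Rintegral f g : measurable_fun setT f -> measurable_fun setT g ->
  {ae mu, forall x, f x = g x} -> \int[mu]_x f x = \int[mu]_x g x.
Proof.
move=> mf mg fg; congr fine; apply: ae_eq_integral => //.
- exact/measurable_EFinP.
- exact/measurable_EFinP.
- by apply: filterS fg => x + _ => ->.
Qed.

End Integration.

(** * Euclidean geometry of row vectors *)

Section Vectors.
Context {R : realType} {n : nat}.
Implicit Types a b c v w : 'rV[R]_n.

Lemma dotvC a b : dotv a b = dotv b a.
Proof. by apply: eq_bigr => i _; rewrite mulrC. Qed.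

Lemma dotvDl a b c : dotv (a + b) c = dotv a c + dotv b c.
Proof. by rewrite -big_split; apply: eq_bigr => i _; rewrite mxE mulrDl. Qed.

Lemma dotvZl k a b : dotv (k *: a) b = k * dotv a b.
Proof. by rewrite /dotv mulr_sumr; apply: eq_bigr => i _; rewrite mxE mulrA. Qed.

Lemma dotvNl a b : dotv (- a) b = - dotv a b.
Proof. by rewrite -scaleN1r dotvZl mulN1r. Qed.

Lemma dotvBl a b c : dotv (a - b) c = dotv a c - dotv b c.
Proof. by rewrite dotvDl dotvNl. Qed.

Lemma dotvDr a b c : dotv a (b + c) = dotv a b + dotv a c.
Proof. by rewrite dotvC dotvDl !(dotvC a). Qed.

Lemma dotvZr k a b : dotv a (k *: b) = k * dotv a b.
Proof. by rewrite dotvC dotvZl dotvC. Qed.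

Lemma dotvNr a b : dotv a (- b) = - dotv a b.
Proof. by rewrite dotvC dotvNl dotvC. Qed.

Lemma dotvBr a b c : dotv a (b - c) = dotv a b - dotv a c.
Proof. by rewrite dotvDr dotvNr. Qed.

Lemma dotv0l a : dotv 0 a = 0.
Proof. by rewrite -(scale0r a) dotvZl mul0r. Qed.

Lemma dotv0r a : dotv a 0 = 0. Proof. by rewrite dotvC dotv0l. Qed.

Lemma dotv_unitr a i : dotv a (unitv i) = a ord0 i.
Proof.
rewrite /dotv (bigD1 i)//= mxE eqxx mulr1 big1 ?addr0// => j ji.
by rewrite mxE eq_sym (negbTE ji) mulr0.
Qed.

Lemma dotv_unitl a i : dotv (unitv i) a = a ord0 i.
Proof. by rewrite dotvC dotv_unitr. Qed.

Lemma sqn_ge0 a : 0 <= sqn a.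
Proof. by apply: sumr_ge0 => i _; rewrite -expr2 sqr_ge0. Qed.

Lemma sqnD a b : sqn (a + b) = sqn a + 2 * dotv a b + sqn b.
Proof. by rewrite /sqn dotvDl !dotvDr (dotvC b a); ring. Qed.

Lemma sqnN a : sqn (- a) = sqn a.
Proof. by rewrite /sqn dotvNl dotvNr opprK. Qed.

Lemma sqnB a b : sqn (a - b) = sqn a - 2 * dotv a b + sqn b.
Proof. by rewrite sqnD sqnN dotvNr; ring. Qed.

Lemma sqnZ k a : sqn (k *: a) = k ^+ 2 * sqn a.
Proof. by rewrite /sqn dotvZl dotvZr; ring. Qed.

Lemma sqn0 : sqn (0 : 'rV[R]_n) = 0. Proof. exact: dotv0l. Qed.

Lemma sqn_unitv i : sqn (unitv i : 'rV[R]_n) = 1.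
Proof. by rewrite /sqn dotv_unitr mxE eqxx. Qed.

Lemma sqn_eq0 a : (sqn a == 0) = (a == 0).
Proof.
apply/eqP/eqP => [|->]; last exact: sqn0.
move=> /eqP; rewrite psumr_eq0; last by move=> i _; rewrite -expr2 sqr_ge0.
move=> /allP h; apply/rowP => i; rewrite mxE.
have := h i (mem_index_enum i) => /=.
by rewrite mulf_eq0 orbb => /eqP.
Qed.

Lemma normv_ge0 a : 0 <= normv a. Proof. exact: sqrtr_ge0. Qed.

Lemma normv_sqr a : normv a ^+ 2 = sqn a.
Proof. by rewrite sqr_sqrtr// sqn_ge0. Qed.

Lemma cauchy_schwarz a b : `|dotv a b| <= normv a * normv b.
Proof.
rewrite -ler_sqr ?nnegrE ?mulr_ge0 ?normv_ge0// exprMn !normv_sqr real_normK ?num_real//.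
have [->|b0] := eqVneq b 0; first by rewrite dotv0r sqn0 mulr0 expr0n.
have sb : 0 < sqn b by rewrite lt_def sqn_eq0 b0 sqn_ge0.
have := sqn_ge0 (sqn b *: a - dotv a b *: b).
rewrite sqnB !sqnZ dotvZl dotvZr => h.
rewrite -(ler_pM2l sb); nra.
Qed.

Lemma ler_normvD a b : normv (a + b) <= normv a + normv b.
Proof.
rewrite -ler_sqr ?nnegrE ?addr_ge0 ?normv_ge0// normv_sqr sqnD sqrrD !normv_sqr.
have := ler_norm (dotv a b); have := cauchy_schwarz a b; lra.
Qed.

Lemma normvN a : normv (- a) = normv a. Proof. by rewrite /normv sqnN. Qed.

Lemma normvZ k a : normv (k *: a) = `|k| * normv a.
Proof. by rewrite /normv sqnZ sqrtrM ?sqr_ge0// sqrtr_sqr. Qed.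

Lemma normv0 : normv (0 : 'rV[R]_n) = 0. Proof. by rewrite /normv sqn0 sqrtr0. Qed.

Lemma normv_unitv i : normv (unitv i : 'rV[R]_n) = 1.
Proof. by rewrite /normv sqn_unitv sqrtr1. Qed.

Lemma ler_normvB a b : normv (a - b) <= normv a + normv b.
Proof. by rewrite (le_trans (ler_normvD _ _))// normvN. Qed.

Lemma coord_le_normv a i : `|a ord0 i| <= normv a.
Proof. by rewrite -dotv_unitr (le_trans (cauchy_schwarz _ _))// normv_unitv mulr1. Qed.

Lemma normv_le_sum a : normv a <= \sum_i `|a ord0 i|.
Proof.
rewrite [a in X in X <= _](_ : a = \sum_i a ord0 i *: unitv i); last first.
  apply/rowP => j; rewrite summxE (bigD1 j)//= !mxE eqxx mulr1 big1 ?addr0//.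
  by move=> i ij; rewrite !mxE (negbTE ij) mulr0.
elim/big_ind2 : _ => [|x1 x2 y1 y2 h1 h2|i _]; first by rewrite normv0.
  by rewrite (le_trans (ler_normvD _ _))// lerD.
by rewrite normvZ normv_unitv mulr1.
Qed.

Lemma normvB_sym a b : normv (a - b) = normv (b - a).
Proof. by rewrite -normvN opprB. Qed.

Lemma sqnD_le a b : sqn (a + b) <= 2 * (sqn a + sqn b).
Proof. have := sqn_ge0 (a - b); rewrite sqnB sqnD; lra. Qed.

Lemma normv_le1 a : normv a <= 1 + sqn a.
Proof. rewrite -normv_sqr; have := sqr_ge0 (normv a - 1); nra. Qed.

End Vectors.

Section MeasurableVectors.
Context {R : realType} {d} {T : measurableType d} {n : nat}.
Implicit Types f g : T -> rvm R n.

Lemma mrv_coord f i : measurable_fun setT f ->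
  measurable_fun setT (fun x => (f x : 'rV[R]_n) ord0 i).
Proof. by move=> mf; exact: (measurableT_comp (measurable_coord n i) mf). Qed.

Lemma mrvD f g : measurable_fun setT f -> measurable_fun setT g ->
  measurable_fun setT (fun x => (f x : 'rV[R]_n) + g x : rvm R n).
Proof.
move=> mf mg; apply: measurable_rvP => i; under eq_fun do rewrite mxE.
by apply: measurable_funD; exact: mrv_coord.
Qed.

Lemma mrvZ (k : T -> R) f : measurable_fun setT k -> measurable_fun setT f ->
  measurable_fun setT (fun x => k x *: (f x : 'rV[R]_n) : rvm R n).
Proof.
move=> mk mf; apply: measurable_rvP => i; under eq_fun do rewrite mxE.
by apply: measurable_funM => //; exact: mrv_coord.
Qed.

Lemma mrvB f g : measurable_fun setT f -> measurable_fun setT g ->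
  measurable_fun setT (fun x => (f x : 'rV[R]_n) - g x : rvm R n).
Proof.
move=> mf mg; apply: measurable_rvP => i; under eq_fun do rewrite !mxE.
by apply: measurable_funB; exact: mrv_coord.
Qed.

Lemma mdotv f g : measurable_fun setT f -> measurable_fun setT g ->
  measurable_fun setT (fun x => dotv (f x) (g x)).
Proof.
move=> mf mg; apply: measurable_sum => i.
by apply: measurable_funM; exact: mrv_coord.
Qed.

Lemma msqn f : measurable_fun setT f -> measurable_fun setT (fun x => sqn (f x)).
Proof. by move=> mf; exact: mdotv. Qed.

Lemma mnormv f : measurable_fun setT f -> measurable_fun setT (fun x => normv (f x)).
Proof.
move=> mf; under eq_fun do rewrite /normv -powR12_sqrt ?sqn_ge0//.
by apply: (measurableT_comp (measurable_powR _)); exact: msqn.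
Qed.

Lemma mexpR (f : T -> R) : measurable_fun setT f ->
  measurable_fun setT (fun x => expR (f x)).
Proof. by move=> mf; apply: (measurableT_comp _ mf); exact: measurable_expR. Qed.

Lemma mnorm (f : T -> R) : measurable_fun setT f ->
  measurable_fun setT (fun x => `|f x|).
Proof. by move=> mf; apply: (measurableT_comp _ mf); exact: normr_measurable. Qed.

End MeasurableVectors.

(** * Gaussians of variance [s], without normalization *)

Definition gk {R : realType} {n} (s : R) (x : 'rV[R]_n) : R :=
  expR (- sqn x / (2 * s)).

Section Gaussian.
Context {R : realType}.

Lemma gk_gt0 n (s : R) (x : 'rV[R]_n) : 0 < gk s x. Proof. exact: expR_gt0. Qed.

Lemma gk_ge0 n (s : R) (x : 'rV[R]_n) : 0 <= gk s x. Proof. exact/ltW/gk_gt0. Qed.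

Lemma gk_le1 n (s : R) (x : 'rV[R]_n) : 0 < s -> gk s x <= 1.
Proof.
by move=> s0; rewrite /gk -expR0 ler_expR mulNr oppr_le0 divr_ge0 ?sqn_ge0// mulr_ge0// ltW.
Qed.

Lemma measurable_gk {d} {T : measurableType d} n (s : R) (f : T -> rvm R n) :
  measurable_fun setT f -> measurable_fun setT (fun x => gk s (f x)).
Proof.
move=> mf; apply: mexpR; apply: measurable_funM; last exact: measurable_cst.
by apply: measurableT_comp => //; exact: msqn.
Qed.

Lemma gauss_integral1 (s x : R) : 0 < s ->
  (\int[@lebesgue_measure R]_y (expR (- (x - y) ^+ 2 / (2 * s)))%:E =
   ((2 * pi * s) `^ 2^-1)%:E)%E.
Proof.
move=> s0; pose sg := Num.sqrt s.
have sg0 : sg != 0 by rewrite gt_eqF// sqrtr_gt0.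
have sg2 : sg ^+ 2 = s by rewrite sqr_sqrtr// ltW.
transitivity (\int[@lebesgue_measure R]_y (normal_fun x sg y)%:E)%E.
  apply: eq_integral => y _; congr (expR _)%:E.
  by rewrite sg2 -(mulr_natl s) -(opprB x y) sqrrN.
have p0 := normal_peak_gt0 sg0.
have : (\int[@lebesgue_measure R]_y (normal_peak sg * normal_fun x sg y)%:E = 1)%E.
  rewrite -(integral_normal_pdf x sg); apply: eq_integral => y _.
  by rewrite normal_pdfE.
under eq_integral do rewrite EFinM.
rewrite ge0_integralZl//=; last 3 first.
- by apply/measurable_EFinP; exact: measurable_normal_fun.
- by move=> y _; rewrite lee_fin normal_fun_ge0.
- by rewrite lee_fin ltW.
move=> /(congr1 (fun z => ((normal_peak sg)^-1%:E * z)%E)).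
rewrite muleA -EFinM mulVf ?gt_eqF// mul1e mule1 => ->.
rewrite /normal_peak invrK sg2; congr (_%:E).
by rewrite powR12_sqrt ?mulr_ge0 ?pi_ge0 ?ltW//; congr Num.sqrt; ring.
Qed.

Lemma sqn_vcons n x (w : 'rV[R]_n) : sqn (vcons x w) = x ^+ 2 + sqn w.
Proof.
rewrite /sqn /dotv big_ord_recl vconsK_head expr2; congr (_ + _).
by apply: eq_bigr => i _; rewrite vcons_lift.
Qed.

Lemma vconsB n (v : 'rV[R]_n.+1) x w :
  v - vcons x w = vcons (v ord0 ord0 - x) (vtail v - w).
Proof.
apply/rowP => i; case: (unliftP ord0 i) => [j ->|->].
  by rewrite !mxE liftK !mxE.
by rewrite !mxE unlift_none.
Qed.

Lemma gk_vcons n (s : R) x (w : 'rV[R]_n) :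
  gk s (vcons x w) = expR (- x ^+ 2 / (2 * s)) * gk s w.
Proof. by rewrite /gk sqn_vcons -expRD -mulrDl opprD. Qed.

Lemma gauss_integral n (s : R) (v : rvm R n) : 0 < s ->
  (\int[lebn n]_w (gk s ((v : 'rV[R]_n) - w))%:E = ((2 * pi * s) `^ (n%:R / 2))%:E)%E.
Proof.
move=> s0; have mg k (u : 'rV[R]_k) : measurable_fun setT
    (fun w : rvm R k => (gk s (u - w))%:E).
  apply/measurable_EFinP/measurable_gk; apply: mrvB => //; exact: measurable_id.
elim: n v => [|n IH] v.
  rewrite (integral_leb0 _ (mg 0 v)).
  rewrite mul0r powRr0 /gk (_ : _ - _ = 0); last by apply/rowP => -[].
  by rewrite sqn0 oppr0 mul0r expR0.
rewrite (ge0_integral_lebS _ _ (mg _ v)); last by move=> w; rewrite lee_fin gk_ge0.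
transitivity (\int[@lebesgue_measure R]_x
    ((expR (- (v ord0 ord0 - x) ^+ 2 / (2 * s)))%:E * ((2 * pi * s) `^ (n%:R / 2))%:E))%E.
  apply: eq_integral => x _; rewrite -(IH (vtail v)) -ge0_integralZl//.
  - by apply: eq_integral => w _; rewrite vconsB gk_vcons EFinM.
  - by move=> w _; rewrite lee_fin gk_ge0.
rewrite ge0_integralZr//=; [|apply/measurable_EFinP/mexpR/measurable_funM|].
- rewrite gauss_integral1// -EFinM -powRD; last first.
    by apply/implyP => _; rewrite gt_eqF// !mulr_gt0// pi_gt0.
  by congr ((_ `^ _)%:E); rewrite -(@natr1 R n) mulrDl mul1r addrC.
- apply: measurable_funN; apply: measurable_funX; exact: measurable_funB.
- exact: measurable_cst.
- by rewrite lee_fin powR_ge0.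
Qed.

Lemma gauss_integ n (s : R) (v : rvm R n) : 0 < s ->
  integ (lebn n) (fun w => gk s ((v : 'rV[R]_n) - w)).
Proof.
move=> s0; apply/integrableP; split.
  apply/measurable_EFinP/measurable_gk; apply: mrvB => //; exact: measurable_id.
under eq_integral => w _ do rewrite /= ger0_norm ?gk_ge0//.
by rewrite gauss_integral// ltry.
Qed.

Lemma gauss_Rintegral n (s : R) (v : rvm R n) : 0 < s ->
  \int[lebn n]_w gk s ((v : 'rV[R]_n) - w) = (2 * pi * s) `^ (n%:R / 2).
Proof. by move=> s0; rewrite /Rintegral gauss_integral. Qed.

End Gaussian.

(** * Convolution with Gaussian kernels *)

Section Gradients.
Context {R : realType} {n : nat}.
Implicit Types (F : 'rV[R]_n -> R) (G : 'rV[R]_n -> 'rV[R]_n).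

(** Differentiability along whole lines: [smooth] and [grad] are made of directional derivatives,
    and on a line the one-variable chain rule and mean value theorem apply directly. *)
Definition hasgrad F G := forall x e (h : R),
  is_derive h (1 : R) (fun h => F (x + h *: e)) (dotv e (G (x + h *: e))).

Lemma is_derive_line (F : 'rV[R]_n -> R) x e (df : R) :
  is_derive (0 : R) (1 : R) (fun h => F (x + h *: e)) df -> is_derive x e F df.
Proof.
move=> [d1 d2].
have E : (fun h : R => h^-1 *: (((fun h => F (x + h *: e)) \o shift 0) (h *: 1) -
    (fun h => F (x + h *: e)) 0)) = (fun h : R => h^-1 *: ((F \o shift x) (h *: e) - F x)).
  by apply/funext => h /=; rewrite scale0r !addr0 [X in F (x + X *: e)]mulr1 (addrC x).
by split; [move: d1; rewrite /derivable E|move: d2; rewrite /derive E].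
Qed.

Lemma hasgrad_line F G :
  (forall x e, is_derive (0 : R) (1 : R) (fun h => F (x + h *: e)) (dotv e (G x))) ->
  hasgrad F G.
Proof.
move=> H x e h; have := H (x + h *: e) e.
move=> [d1 d2].
have EE : (fun k : R => k^-1 *: (((fun h0 => F (x + h *: e + h0 *: e)) \o shift 0) (k *: 1) -
    (fun h0 => F (x + h *: e + h0 *: e)) 0)) =
   (fun k : R => k^-1 *: (((fun h0 => F (x + h0 *: e)) \o shift h) (k *: 1) -
    (fun h0 => F (x + h0 *: e)) h)).
  apply/funext => k /=; rewrite scale0r !addr0 -addrA -scalerDl.
  by rewrite (addrC h).
by split; [move: d1; rewrite /derivable EE|move: d2; rewrite /derive EE].
Qed.

Lemma hasgrad_derive F G : hasgrad F G -> forall x e, is_derive x e F (dotv e (G x)).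
Proof.
move=> H x e; apply: is_derive_line; have := H x e 0.
by rewrite scale0r addr0.
Qed.

Lemma hasgradE F G : hasgrad F G -> forall x, grad F x = G x.
Proof.
move=> H x; apply/rowP => i; rewrite mxE.
by have [_ ->] := hasgrad_derive F G H x (unitv i); rewrite dotv_unitl.
Qed.

Lemma hasgrad_cst c : hasgrad (fun=> c) (fun=> 0).
Proof. by move=> x e h; rewrite dotv0r; exact: is_derive_cst. Qed.

Lemma hasgradD F1 G1 F2 G2 : hasgrad F1 G1 -> hasgrad F2 G2 ->
  hasgrad (fun x => F1 x + F2 x) (fun x => G1 x + G2 x).
Proof. by move=> H1 H2 x e h; rewrite dotvDr; exact: is_deriveD. Qed.

Lemma hasgradM F1 G1 F2 G2 : hasgrad F1 G1 -> hasgrad F2 G2 ->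
  hasgrad (fun x => F1 x * F2 x) (fun x => F1 x *: G2 x + F2 x *: G1 x).
Proof. by move=> H1 H2 x e h; rewrite dotvDr !dotvZr; exact: is_deriveM. Qed.

Lemma hasgrad_coord i : hasgrad (fun x => x ord0 i) (fun=> unitv i).
Proof.
move=> x e h; rewrite dotv_unitr.
under eq_fun do rewrite !mxE.
apply: is_derive_eq.
by rewrite /GRing.scale /=; ring.
Qed.

Lemma hasgrad_comp (f f' : R -> R) F G : (forall y, is_derive y (1 : R) f (f' y)) ->
  hasgrad F G -> hasgrad (fun x => f (F x)) (fun x => f' (F x) *: G x).
Proof.
move=> Hf HF x e h; rewrite dotvZr.
have H := @is_derive1_comp _ f (fun h => F (x + h *: e)) h _ _ (Hf _) (HF x e h).
by apply: is_derive_eq H _; rewrite /GRing.scale /=.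
Qed.

Lemma eq_hasgrad F G G' : hasgrad F G -> G =1 G' -> hasgrad F G'.
Proof. by move=> H /funext <-. Qed.

Lemma hasgrad_sqn : hasgrad sqn (fun x => 2 *: x).
Proof.
apply: hasgrad_line => x e; rewrite dotvZr.
have -> : (fun h : R => sqn (x + h *: e)) = (fun h => sqn x + (2 * dotv x e) * h + sqn e * h ^+ 2).
  by apply/funext => h; rewrite sqnD sqnZ dotvZr; ring.
apply: is_derive_eq.
by rewrite /GRing.scale /= dotvC; ring.
Qed.

(** [smooth] quantifies over lists of directions; a class of continuous functions stable under
    directional derivatives is an invariant for the induction on the list. *)
Lemma smooth_class (S : ('rV[R]_n -> R) -> Prop) :
  (forall F, S F -> continuous F /\
     exists2 G, hasgrad F G & forall e, S (fun x => dotv e (G x))) ->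
  forall F, S F -> smooth F.
Proof.
move=> H F SF es.
have SD : S (Dn es F).
  elim: es => [//|e es IH] /=.
  have [_ [G HG SG]] := H _ IH.
  rewrite (_ : (fun x => _) = (fun x => dotv e (G x))) //.
  by apply/funext => x; have [] := hasgrad_derive _ _ HG x e.
have [cF [G HG _]] := H _ SD; split => // e x.
by have [] := hasgrad_derive _ _ HG x e.
Qed.

End Gradients.

(** * Polynomial functions and their growth *)

Section Polynomials.
Context {R : realType} {n : nat}.

Inductive polyf : ('rV[R]_n -> R) -> Prop :=
| polyf_cst c : polyf (fun=> c)
| polyf_coord i : polyf (fun x => x ord0 i)
| polyfD P Q : polyf P -> polyf Q -> polyf (fun x => P x + Q x)
| polyfM P Q : polyf P -> polyf Q -> polyf (fun x => P x * Q x).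

Lemma polyf_sum (I : Type) (s : seq I) (h : I -> 'rV[R]_n -> R) :
  (forall i, polyf (h i)) -> polyf (fun x => \sum_(i <- s) h i x).
Proof.
move=> ih; elim: s => [|a s IHs].
  under eq_fun do rewrite big_nil.
  exact: polyf_cst.
under eq_fun do rewrite big_cons.
exact: polyfD.
Qed.

Lemma polyf_grad P : polyf P ->
  exists2 G, hasgrad P G & forall i, polyf (fun x => G x ord0 i).
Proof.
elim=> [c|i|P1 P2 p1 [G1 H1 pG1] p2 [G2 H2 pG2]|P1 P2 p1 [G1 H1 pG1] p2 [G2 H2 pG2]].
- exists (fun=> 0); first exact: hasgrad_cst.
  by move=> i; exact: polyf_cst.
- exists (fun=> unitv i); first exact: hasgrad_coord.
  by move=> j; exact: polyf_cst.
- eexists; first exact: (hasgradD _ _ _ _ H1 H2).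
  by move=> i; under eq_fun do rewrite mxE; exact: polyfD.
- eexists; first exact: (hasgradM _ _ _ _ H1 H2).
  by move=> i; under eq_fun do rewrite !mxE; apply: polyfD; exact: polyfM.
Qed.

Lemma polyf_dotv (e : 'rV[R]_n) (G : 'rV[R]_n -> 'rV[R]_n) :
  (forall i, polyf (fun x => G x ord0 i)) -> polyf (fun x => dotv e (G x)).
Proof.
by move=> pG; apply: polyf_sum => i; apply: polyfM => //; exact: polyf_cst.
Qed.

Lemma measurable_polyf {d} {T : measurableType d} P (f : T -> rvm R n) :
  polyf P -> measurable_fun setT f -> measurable_fun setT (fun x => P (f x)).
Proof.
move=> pP mf; elim: pP => [c|i|P1 P2 _ h1 _ h2|P1 P2 _ h1 _ h2].
- exact: measurable_cst.
- exact: mrv_coord.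
- exact: measurable_funD.
- exact: measurable_funM.
Qed.

Lemma polyf_continuous P : polyf P -> continuous P.
Proof.
elim=> [c|i|P1 P2 _ h1 _ h2|P1 P2 _ h1 _ h2] x.
- exact: cst_continuous.
- exact: coord_continuous.
- exact: (continuousD (h1 x) (h2 x)).
- exact: (continuousM (h1 x) (h2 x)).
Qed.

Lemma ler_1Dexp (c y : R) : 0 < c -> 0 <= y -> 1 + y <= (1 + c^-1) * expR (c * y).
Proof.
move=> c0 y0; have h := expR_ge1Dx (c * y).
have ci : 0 < c^-1 by rewrite invr_gt0.
apply: le_trans (_ : (1 + c^-1) * (1 + c * y) <= _); last first.
  by rewrite ler_pM2l//; lra.
rewrite mulrDl mul1r mulrDr mulr1 mulKf ?gt_eqF//.
have : 0 <= c * y by rewrite mulr_ge0// ltW.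
lra.
Qed.

(** Every [c > 0] is allowed so that a product can spend [c / 2] on each factor. *)
Lemma polyf_growth P : polyf P -> forall c, 0 < c ->
  exists2 C, 0 <= C & forall x, `|P x| <= C * expR (c * sqn x).
Proof.
have e1 (c : R) (x : 'rV[R]_n) : 0 < c -> 1 <= expR (c * sqn x).
  by move=> c0; rewrite -expR0 ler_expR mulr_ge0 ?sqn_ge0// ltW.
elim=> [k|i|P1 P2 _ h1 _ h2|P1 P2 _ h1 _ h2] c c0.
- exists `|k| => // x; rewrite ler_peMr//; exact: e1.
- exists (1 + c^-1) => [|x]; first by rewrite addr_ge0// invr_ge0 ltW.
  rewrite (le_trans (coord_le_normv _ _))// (le_trans (normv_le1 _))//.
  exact/ler_1Dexp/sqn_ge0.
- have [C1 C10 H1] := h1 c c0; have [C2 C20 H2] := h2 c c0.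
  exists (C1 + C2) => [|x]; first exact: addr_ge0.
  by rewrite (le_trans (ler_normD _ _))// mulrDl lerD.
- have c20 : 0 < c / 2 by rewrite divr_gt0.
  have [C1 C10 H1] := h1 _ c20; have [C2 C20 H2] := h2 _ c20.
  exists (C1 * C2) => [|x]; first exact: mulr_ge0.
  rewrite normrM (le_trans (ler_pM _ _ (H1 x) (H2 x)))// mulrACA -expRD.
  by rewrite -mulrDl -splitr.
Qed.

End Polynomials.

(** * Polynomials times a Gaussian *)

Section Kernels.
Context {R : realType} {n : nat}.
Variable s : R.
Hypothesis s0 : 0 < s.

Lemma hasgrad_gk : hasgrad (@gk R n s) (fun x => (- s^-1 * gk s x) *: x).
Proof.
have H y : is_derive y (1 : R) (fun y => expR (- y / (2 * s))) (- (2 * s)^-1 * expR (- y / (2 * s))).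
  have H := @is_derive1_comp _ expR (fun y => - y / (2 * s)) y _ _ (is_derive_expR _) _.
  have H2 : is_derive y (1 : R) (fun y => - y / (2 * s)) (- (2 * s)^-1).
    by apply: is_derive_eq; rewrite /GRing.scale /=; ring.
  by apply: is_derive_eq (H _ H2) _; rewrite /GRing.scale /= mulrC.
apply: eq_hasgrad (hasgrad_comp _ _ _ _ H hasgrad_sqn) _ => x.
rewrite scalerA; congr (_ *: _); rewrite /gk; field.
by rewrite gt_eqF.
Qed.

(** The Gaussian and all its derivatives lie in this class, and it is closed under gradients. *)
Definition gker (K : 'rV[R]_n -> R) :=
  exists2 P, polyf P & forall x, K x = P x * gk s x.

Lemma gker_gk : gker (gk s).
Proof. by exists (fun=> 1) => [|x]; [exact: polyf_cst|rewrite mul1r]. Qed.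

Lemma measurable_gker {d} {T : measurableType d} K (f : T -> rvm R n) :
  gker K -> measurable_fun setT f -> measurable_fun setT (fun x => K (f x)).
Proof.
move=> [P pP KP] mf; under eq_fun do rewrite KP.
by apply: measurable_funM; [exact: measurable_polyf|exact: measurable_gk].
Qed.

(** Half of the Gaussian exponent pays for the polynomial: what remains of [1 / (2 s)] is
    [1 / (4 s)], the exponent of [gk (2 * s)]. *)
Lemma gker_bound K : gker K -> exists2 C, 0 <= C & forall x, `|K x| <= C * gk (2 * s) x.
Proof.
move=> [P pP KP]; have c0 : 0 < (4 * s)^-1 by rewrite invr_gt0 mulr_gt0.
have [C C0 H] := polyf_growth P pP _ c0; exists C => // x.
rewrite KP normrM (ger0_norm (gk_ge0 _ _ _)).
rewrite (le_trans (ler_wpM2r (gk_ge0 _ _ _) (H x)))// -mulrA ler_wpM2l// -expRD.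
rewrite ler_expR le_eqVlt; apply/orP; left; apply/eqP; field.
by rewrite gt_eqF.
Qed.

Lemma gkerD K1 K2 : gker K1 -> gker K2 -> gker (fun x => K1 x + K2 x).
Proof.
move=> [P1 p1 H1] [P2 p2 H2]; exists (fun x => P1 x + P2 x); first exact: polyfD.
by move=> x; rewrite H1 H2 mulrDl.
Qed.

Lemma gkerM P K : polyf P -> gker K -> gker (fun x => P x * K x).
Proof.
move=> pP [P1 p1 H1]; exists (fun x => P x * P1 x); first exact: polyfM.
by move=> x; rewrite H1 mulrA.
Qed.

Lemma gkerZ c K : gker K -> gker (fun x => c * K x).
Proof. by apply: gkerM; exact: polyf_cst. Qed.

Lemma gker_sum (I : Type) (r : seq I) (h : I -> 'rV[R]_n -> R) :
  (forall i, gker (h i)) -> gker (fun x => \sum_(i <- r) h i x).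
Proof.
move=> ih; elim: r => [|a r IHr].
  under eq_fun do rewrite big_nil.
  by exists (fun=> 0) => [|x]; [exact: polyf_cst|rewrite mul0r].
under eq_fun do rewrite big_cons.
exact: gkerD.
Qed.

Lemma gker_dotv (e : 'rV[R]_n) (G : 'rV[R]_n -> 'rV[R]_n) :
  (forall i, gker (fun x => G x ord0 i)) -> gker (fun x => dotv e (G x)).
Proof. by move=> pG; apply: gker_sum => i; exact: gkerZ. Qed.

Lemma gker_grad K : gker K ->
  exists2 G, hasgrad K G & forall i, gker (fun x => G x ord0 i).
Proof.
move=> [P pP KP]; have [G HG pG] := polyf_grad P pP.
have -> : K = (fun x => P x * gk s x) by apply/funext.
eexists; first exact: (hasgradM _ _ _ _ HG hasgrad_gk).
move=> i; under eq_fun do rewrite !mxE.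
apply: gkerD; last first.
  by under eq_fun do rewrite mulrC; apply: gkerM => //; exact: gker_gk.
exists (fun x => - s^-1 * (P x * x ord0 i)); last by move=> x; ring.
apply: polyfM; first exact: polyf_cst.
by apply: polyfM => //; exact: polyf_coord.
Qed.

End Kernels.

Definition convol {R : realType} {n} (K L : 'rV[R]_n -> R) (v : 'rV[R]_n) : R :=
  \int[lebn n]_w (K (v - w) * L w).

Section GaussianBounds.
Context {R : realType} {n : nat}.
Implicit Types v w x y : 'rV[R]_n.

(** By [|x|^2 <= 2 |x + y|^2 + 2 |y|^2], a translation costs half of the exponent and a factor that
    depends on the shift alone. *)
Lemma gk_shift (s : R) x y : 0 < s ->
  gk s (x + y) <= expR (sqn y / (2 * s)) * gk (2 * s) x.
Proof.
move=> s0; rewrite /gk -expRD ler_expR.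
have -> : - sqn x / (2 * (2 * s)) = (- (sqn x / 2)) / (2 * s) by field; rewrite gt_eqF.
rewrite -mulrDl ler_pM2r ?invr_gt0 ?mulr_gt0//.
have := sqnD_le (x + y) (- y); rewrite addrK sqnN; lra.
Qed.

Lemma gk_growth (a : R) x : 0 < a ->
  (1 + sqn x) * gk a x <= (1 + 4 * a) * gk (2 * a) x.
Proof.
move=> a0; have c0 : 0 < (4 * a)^-1 by rewrite invr_gt0 mulr_gt0.
rewrite (le_trans (ler_wpM2r (gk_ge0 _ _ _) (ler_1Dexp _ _ c0 (sqn_ge0 x))))//.
rewrite invrK -mulrA ler_wpM2l ?addr_ge0 ?mulr_ge0 ?(ltW a0)// -expRD.
rewrite ler_expR le_eqVlt; apply/orP; left; apply/eqP; field.
by rewrite gt_eqF.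
Qed.

Lemma quad_shift v w : 1 + sqn w <= 2 * ((1 + sqn v) * (1 + sqn (v - w))).
Proof.
have := sqnD_le v (w - v); rewrite addrC subrK -(opprB v w) sqnN.
have := sqn_ge0 v; have := sqn_ge0 (v - w); nra.
Qed.

(** The quadratic growth of [L] at [w] is split into a factor in [v], constant for the integration,
    and a factor in [v - w], which the Gaussian absorbs by doubling its variance. *)
Lemma lgauss_dom (a C D : R) (K L : 'rV[R]_n -> R) : 0 < a -> 0 <= C ->
  (forall x, `|K x| <= C * gk a x) -> (forall w, `|L w| <= D * (1 + sqn w)) ->
  forall v w, `|K (v - w) * L w| <=
    C * D * (2 * (1 + 4 * a)) * (1 + sqn v) * gk (2 * a) (v - w).
Proof.
move=> a0 C0 HK HL v w; rewrite normrM.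
have D0 : 0 <= D.
  have := HL w; have := normr_ge0 (L w); have := sqn_ge0 w; nra.
rewrite (le_trans (ler_pM _ _ (HK _) (HL w)))//.
rewrite (le_trans (ler_wpM2l _ (ler_wpM2l D0 (quad_shift v w))))//.
  by rewrite mulr_ge0// gk_ge0.
have -> : C * gk a (v - w) * (D * (2 * ((1 + sqn v) * (1 + sqn (v - w))))) =
  (C * D * 2 * (1 + sqn v)) * ((1 + sqn (v - w)) * gk a (v - w)) by ring.
rewrite (le_trans (ler_wpM2l _ (gk_growth a _ a0)))//.
  by rewrite !mulr_ge0// addr_ge0// sqn_ge0.
by rewrite le_eqVlt; apply/orP; left; apply/eqP; ring.
Qed.

End GaussianBounds.

Section Convolution.
Context {R : realType} {n : nat}.
Variables (s D : R) (L : rvm R n -> R).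
Hypothesis s0 : 0 < s.
Hypothesis mL : measurable_fun setT L.
Hypothesis LD : forall w, `|L w| <= D * (1 + sqn w).
Implicit Types K : 'rV[R]_n -> R.

Lemma measurable_conv_integrand K v : gker s K ->
  measurable_fun setT (fun w : rvm R n => K (v - (w : 'rV[R]_n)) * L w).
Proof.
move=> gK; apply: measurable_funM => //; apply: (measurable_gker s) => //.
by apply: mrvB => //; exact: measurable_id.
Qed.

Lemma conv_dom K : gker s K -> exists2 C, 0 <= C & forall v w,
  `|K (v - w) * L w| <= C * (1 + sqn v) * gk (4 * s) (v - w).
Proof.
move=> gK; have [C C0 HC] := gker_bound s s0 K gK.
have D0 : 0 <= D.
  have := LD 0; have := normr_ge0 (L 0); rewrite sqn0; lra.
have s2 : 0 < 2 * s by rewrite mulr_gt0.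
exists (C * D * (2 * (1 + 4 * (2 * s)))) => [|v w].
  by rewrite !mulr_ge0// addr_ge0// !mulr_ge0// ltW.
rewrite (_ : 4 * s = 2 * (2 * s)); last by ring.
exact: lgauss_dom.
Qed.

Lemma conv_integ K v : gker s K ->
  integ (lebn n) (fun w => K (v - (w : 'rV[R]_n)) * L w).
Proof.
move=> gK; have [C C0 HC] := conv_dom K gK.
apply: (integ_le _ _ _ (measurable_conv_integrand K v gK) (HC v)).
by apply: integZ; apply: gauss_integ; rewrite mulr_gt0.
Qed.

Lemma conv_growth K : gker s K -> exists2 C, 0 <= C & forall v,
  `|convol K L v| <= C * (1 + sqn v).
Proof.
move=> gK; have [C C0 HC] := conv_dom K gK; have s4 : 0 < 4 * s by rewrite mulr_gt0.
exists (C * (2 * pi * (4 * s)) `^ (n%:R / 2)) => [|v].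
  by rewrite mulr_ge0// powR_ge0.
have ig : integ (lebn n) (fun w => C * (1 + sqn v) * gk (4 * s) (v - (w : 'rV[R]_n))).
  by apply: integZ; exact: gauss_integ.
apply: le_trans (norm_Rintegral_le _ _ _ (measurable_conv_integrand K v gK) ig (HC v)) _.
rewrite RintegralZl//; last exact: gauss_integ.
by rewrite gauss_Rintegral// mulrAC.
Qed.

Lemma conv_lin (I : Type) (r : seq I) (c : I -> R) (K : I -> 'rV[R]_n -> R) v :
  (forall i, gker s (K i)) ->
  convol (fun x => \sum_(i <- r) c i * K i x) L v = \sum_(i <- r) c i * convol (K i) L v.
Proof.
move=> gK; rewrite /convol.
transitivity (\int[lebn n]_w (\sum_(i <- r) (c i * (K i (v - (w : 'rV[R]_n)) * L w)))).
  apply: eq_Rintegral => w _; rewrite mulr_suml.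
  by apply: eq_bigr => i _; rewrite mulrA.
rewrite Rintegral_sum; last by move=> i; apply: integZ; exact: conv_integ.
by apply: eq_bigr => i _; rewrite RintegralZl//; exact: conv_integ.
Qed.

Lemma hasgrad_conv K G : gker s K -> hasgrad K G ->
  (forall i, gker s (fun x => G x ord0 i)) ->
  hasgrad (convol K L) (fun v => \row_i convol (fun x => G x ord0 i) L v).
Proof.
move=> gK HG gG; apply: hasgrad_line => x e.
have -> : dotv e (\row_i convol (fun x => G x ord0 i) L x) = convol (fun y => dotv e (G y)) L x.
  by rewrite conv_lin//; apply: eq_bigr => i _; rewrite mxE.
have ge : gker s (fun y => dotv e (G y)) by exact: gker_dotv.
have [C C0 HC] := gker_bound s s0 _ ge.
have s2 : 0 < 2 * s by rewrite mulr_gt0.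
have s4 : 0 < 2 * (2 * s) by rewrite mulr_gt0.
have h1 (y : 'rV[R]_n) : `|gk (2 * (2 * s)) y| <= 1 * gk (2 * (2 * s)) y.
  by rewrite mul1r ger0_norm// gk_ge0.
have dom := lgauss_dom _ 1 D _ L s4 ler01 h1 LD.
set M := 1 * D * _ in dom.
have -> : convol (fun y => dotv e (G y)) L x =
    \int[lebn n]_w (dotv e (G (x + 0 *: e - (w : 'rV[R]_n))) * L w).
  by rewrite scale0r addr0.
rewrite /convol.
(* The variance is doubled three times: for the polynomial factor of the kernel, for the shift by
   [h *: e] with [|h| < 1], and for the growth of [L]. *)
apply: (derive_under (lebn n) (fun h w => K (x + h *: e - w) * L w)
  (fun h w => dotv e (G (x + h *: e - w)) * L w) 0 1
  (fun w => (C * expR (sqn e / (2 * (2 * s))) * (M * (1 + sqn x))) *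
            gk (2 * (2 * (2 * s))) (x - (w : 'rV[R]_n)))) => //.
- by move=> h _; exact: conv_integ.
- move=> h w _.
  have H := HG (x - w) e h.
  have {}H : is_derive h (1 : R) (fun k => K (x + k *: e - w)) (dotv e (G (x + h *: e - w))).
    rewrite (_ : (fun k => _) = (fun k : R => K (x - w + k *: e))).
      by rewrite (_ : x + h *: e - w = x - w + h *: e)// addrAC.
    by apply/funext => k; rewrite addrAC.
  apply: is_derive_eq (is_deriveM H (is_derive_cst (L w) _ _)) _.
  by rewrite scaler0 add0r /GRing.scale /= mulrC.
- by apply: integZ; apply: gauss_integ; rewrite mulr_gt0.
- move=> h w; rewrite subr0 => h1'.
  rewrite normrM (le_trans (ler_wpM2r (normr_ge0 _) (HC _)))//.
  have sh : gk (2 * s) (x + h *: e - w) <=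
      expR (sqn e / (2 * (2 * s))) * gk (2 * (2 * s)) (x - w).
    rewrite addrAC (le_trans (gk_shift _ _ _ s2))//.
    rewrite ler_wpM2r ?gk_ge0// ler_expR ler_wpM2r ?invr_ge0 ?(ltW s4)//.
    rewrite sqnZ ler_piMl ?sqn_ge0//.
    by rewrite -real_normK ?num_real// expr_le1// ltW.
  rewrite -[leLHS]mulrA (le_trans (ler_wpM2l C0 (ler_wpM2r (normr_ge0 _) sh)))//.
  rewrite -!mulrA ler_wpM2l// ler_wpM2l ?expR_ge0//.
  have := dom x w; rewrite normrM (ger0_norm (gk_ge0 _ _ _)).
  by move/le_trans; apply; rewrite /M -!mulrA.
Qed.

Lemma conv_lipschitz K : gker s K -> exists2 C, 0 <= C & forall v w,
  `|convol K L v - convol K L w| <= C * normv (v - w) * (1 + sqn v + sqn w).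
Proof.
move=> gK; have [G HG gG] := gker_grad s s0 K gK.
have HC := hasgrad_conv K G gK HG gG.
have /choice [C /all_and2 [C0 CH]] : forall i, exists C, 0 <= C /\ forall v,
    `|convol (fun x => G x ord0 i) L v| <= C * (1 + sqn v).
  by move=> i; have [C ? ?] := conv_growth _ (gG i); exists C.
have CS : 0 <= \sum_i C i by apply: sumr_ge0.
exists (6 * \sum_i C i) => [|v w]; first by rewrite mulr_ge0.
have [xi xi01 E] := @MVT R (fun h => convol K L (w + h *: (v - w))) _ 0 1 ltr01
  (fun h _ => HC w (v - w) h)
  (@derivable_within_continuous R R (fun h => convol K L (w + h *: (v - w))) `[0, 1]
    (fun h _ => @ex_derive _ _ _ _ _ _ _ (HC w (v - w) h))).
move: E; rewrite scale1r scale0r addr0 subrKC subr0 mulr1 => ->.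
set y := w + xi *: (v - w).
have gy : normv (\row_i convol (fun x => G x ord0 i) L y) <= (\sum_i C i) * (1 + sqn y).
  apply: le_trans (normv_le_sum _) _; rewrite mulr_suml.
  by apply: ler_sum => i _; rewrite mxE.
(* On the segment, [|y|^2 <= 2 |w|^2 + 2 |v - w|^2 <= 4 |v|^2 + 6 |w|^2]; hence the 6. *)
have sy : 1 + sqn y <= 6 * (1 + sqn v + sqn w).
  have := sqnD_le w (xi *: (v - w)); rewrite -/y sqnZ.
  have := sqnD_le v (- w); rewrite sqnN.
  have : xi ^+ 2 <= 1.
    by move: xi01; rewrite in_itv /= => /andP[x0 x1]; rewrite expr_le1// ltW.
  have := sqn_ge0 (v - w); have := sqn_ge0 v; have := sqn_ge0 w; nra.
rewrite (le_trans (cauchy_schwarz _ _))// (_ : 6 * _ * _ * _ =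
  normv (v - w) * ((\sum_i C i) * (6 * (1 + sqn v + sqn w)))); last by ring.
rewrite ler_wpM2l ?normv_ge0// (le_trans gy)// ler_wpM2l//.
Qed.

Lemma continuous_conv K : gker s K -> continuous (convol K L).
Proof.
move=> gK v; have [C C0 HC] := conv_lipschitz K gK.
have pS (u : 'rV[R]_n) : polyf (fun x => sqn (x - u)).
  apply: polyf_sum => i; under eq_fun do rewrite !mxE.
  by apply: polyfM; apply: polyfD; try exact: polyf_coord; exact: polyf_cst.
have c1 : continuous (fun x : 'rV[R]_n => normv (x - v)).
  move=> x; apply: (@continuous_comp _ _ _ (fun x : 'rV[R]_n => sqn (x - v)) Num.sqrt).
    exact: polyf_continuous.
  exact: sqrt_continuous.
have c2 : continuous (fun x : 'rV[R]_n => C * (1 + sqn x + sqn v)).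
  apply: polyf_continuous; apply: polyfM; first exact: polyf_cst.
  apply: polyfD; last exact: polyf_cst.
  apply: polyfD; first exact: polyf_cst.
  by have := pS 0; under eq_fun do rewrite subr0.
have cN : continuous (fun x : 'rV[R]_n => C * (1 + sqn x + sqn v) * normv (x - v)).
  by move=> x; exact: (continuousM (c2 x) (c1 x)).
have c0 : (fun x : 'rV[R]_n => C * (1 + sqn x + sqn v) * normv (x - v)) x @[x --> v] --> (0 : R).
  by have := cN v; rewrite /continuous_at subrr normv0 mulr0.
have Fv : Filter (nbhs v) by exact: nbhs_filter.
apply/(@cvgrPdist_le _ _ _ _ Fv) => e e0.
have /cvgrPdist_le /(_ e e0) := c0.
apply: filterS => x /=; rewrite sub0r normrN => h.
by rewrite distrC (le_trans (HC x v))// mulrAC (le_trans _ h)// ler_norm.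
Qed.

End Convolution.

Lemma measurable_Rintegral_param {R : realType} {d1 d2} {T1 : measurableType d1}
    {T2 : measurableType d2} (m2 : {sigma_finite_measure set T2 -> \bar R})
    (F : T1 * T2 -> R) : measurable_fun setT F ->
  measurable_fun setT (fun x => \int[m2]_y F (x, y)).
Proof.
move=> mF; have mE : measurable_fun setT (EFin \o F) by exact/measurable_EFinP.
rewrite /Rintegral; apply: (@measurableT_comp _ _ _ _ _ _ fine); first exact: fine_measurable.
under eq_fun do rewrite integralE.
apply: emeasurable_funB.
  apply: eq_measurable_fun (@measurable_fun_fubini_tonelli_F _ _ T1 T2 R
    m2 (EFin \o F)^\+%E (measurable_funepos mE) (funepos_ge0 _)).
  by move=> x _; apply: eq_integral => y _; rewrite !funeposE.
apply: eq_measurable_fun (@measurable_fun_fubini_tonelli_F _ _ T1 T2 R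
  m2 (EFin \o F)^\-%E (measurable_funeneg mE) (funeneg_ge0 _)).
by move=> x _; apply: eq_integral => y _; rewrite !funenegE.
Qed.

(* Integrate [e^X >= e^m (1 + X - m)], where [m] is the mean of [X]. *)
Lemma jensen_expR {R : realType} {d} {T : measurableType d}
    (mu : {measure set T -> \bar R}) (rho X : T -> R) :
  (forall x, 0 <= rho x) -> integ mu rho -> integ mu (fun x => rho x * X x) ->
  integ mu (fun x => rho x * expR (X x)) -> 0 < \int[mu]_x rho x ->
  \int[mu]_x rho x * expR ((\int[mu]_x (rho x * X x)) / \int[mu]_x rho x) <=
  \int[mu]_x (rho x * expR (X x)).
Proof.
move=> r0 ir irX ire M0; set M := \int[mu]_x rho x in M0 *.
set S := \int[mu]_x (rho x * X x); set m := S / M.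
have i1 : integ mu (fun x => expR m * (1 - m) * rho x) by exact: integZ.
have i2 : integ mu (fun x => expR m * (rho x * X x)) by exact: integZ.
have <- : \int[mu]_x (expR m * (1 - m) * rho x + expR m * (rho x * X x)) = M * expR m.
  rewrite RintegralD// !RintegralZl// -/M -/S.
  have -> : S = m * M by rewrite /m mulfVK// gt_eqF.
  by ring.
apply: le_Rintegral => //; first exact: integD.
move=> x _.
have -> : expR m * (1 - m) * rho x + expR m * (rho x * X x) =
  rho x * (expR m * (1 + (X x - m))) by ring.
rewrite ler_wpM2l// (_ : expR (X x) = expR m * expR (X x - m)); last first.
  by rewrite -expRD; congr expR; ring.
by rewrite ler_wpM2l ?expR_ge0 ?expR_ge1Dx.
Qed.

Lemma lnD_le {R : realType} (x y a : R) : 0 < x -> 0 < y -> x * expR a <= y ->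
  ln x + a <= ln y.
Proof.
move=> x0 y0 h; rewrite -[leLHS]expRK ler_ln ?posrE ?expR_gt0//.
by rewrite expRD lnK.
Qed.

(** [z] stands for [|v - w|], [a] and [b] for the two norms; the triangle inequality trades the
    square of [z] for [z * (a + b)]. *)
Lemma lnm_lipschitz_bound {R : realFieldType} (C z a b : R) :
  0 <= C -> 0 <= z -> 0 <= a -> 0 <= b -> z <= a + b ->
  z * (C * (1 + a)) + z ^+ 2 / 2 <= (2 * C + 1) * z * (1 + a + b).
Proof.
move=> C0 z0 a0 b0 zab.
have zz : z ^+ 2 <= z * (a + b) by rewrite expr2 ler_wpM2l.
have za : 0 <= z * a by rewrite mulr_ge0.
have zb : 0 <= z * b by rewrite mulr_ge0.
have : 0 <= C * z * a by rewrite !mulr_ge0.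
have : 0 <= C * z * b by rewrite !mulr_ge0.
have : 0 <= C * z by rewrite !mulr_ge0.
lra.
Qed.

Lemma ler_dist_two_sided {R : realFieldType} (x y A B Q K : R) :
  A + Q <= K -> B + Q <= K -> x - A - Q <= y -> y - B - Q <= x -> `|x - y| <= K.
Proof. by move=> ? ? ? ?; rewrite ler_norml; apply/andP; split; lra. Qed.

(** * The logarithm of the mollified density *)

Section LogMollified.
Context {R : realType} {n : nat}.
Variables (eps : R) (f : rvm R n -> R).
Hypothesis eps0 : 0 < eps.
Hypothesis f0 : forall v, 0 <= f v.
Hypothesis fi : integ (lebn n) f.
Hypothesis fi2 : integ (lebn n) (fun v => f v * sqn v).

Let mf : measurable_fun setT f := integ_meas _ _ fi.

Definition gconv (v : 'rV[R]_n) : R := \int[lebn n]_w (f w * gk eps (v - w)).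

Lemma measurable_gconv_integrand v :
  measurable_fun setT (fun w : rvm R n => f w * gk eps (v - (w : 'rV[R]_n))).
Proof.
apply: measurable_funM => //; apply: measurable_gk.
by apply: mrvB => //; exact: measurable_id.
Qed.

Lemma gconv_integ v : integ (lebn n) (fun w => f w * gk eps (v - (w : 'rV[R]_n))).
Proof.
apply: (integ_le _ _ _ (measurable_gconv_integrand v) _ fi) => w.
by rewrite normrM !ger0_norm ?gk_ge0// ler_piMr// gk_le1.
Qed.

Lemma rintE (F : rvm R n -> R) : integ (lebn n) F -> rint F = \int[lebn n]_w F w.
Proof. by move=> iF; rewrite /rint integrable_iintE. Qed.

Definition cpsi : R := (2 * pi * eps) `^ (- (n%:R / 2)).

Lemma cpsi_gt0 : 0 < cpsi.
Proof. by rewrite powR_gt0// !mulr_gt0// pi_gt0. Qed.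

Lemma psiE (v : 'rV[R]_n) : psi eps v = cpsi * gk eps v. Proof. by []. Qed.

Lemma molliE v : molli eps f v = cpsi * gconv v.
Proof.
rewrite /molli /gconv.
have E : (fun w => f w * psi eps (v - w)) = (fun w => cpsi * (f w * gk eps (v - w))).
  by apply/funext => w; rewrite psiE; ring.
by rewrite E rintE ?RintegralZl//; [exact: gconv_integ|apply: integZ; exact: gconv_integ].
Qed.

Lemma measurable_gconv : measurable_fun setT (gconv : rvm R n -> R).
Proof.
apply: (measurable_Rintegral_param (lebn n)
  (fun p : rvm R n * rvm R n => f p.2 * gk eps ((p.1 : 'rV[R]_n) - p.2))).
apply: measurable_funM; first exact: (measurableT_comp mf measurable_snd).
by apply: measurable_gk; apply: mrvB; [exact: measurable_fst|exact: measurable_snd].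
Qed.

Definition lnm (v : rvm R n) : R := ln (molli eps f v).

Lemma measurable_lnm : measurable_fun setT lnm.
Proof.
rewrite /lnm; under eq_fun do rewrite molliE.
apply: (measurableT_comp (@measurable_ln R)).
by apply: measurable_funM; [exact: measurable_cst|exact: measurable_gconv].
Qed.

Hypothesis mass : 0 < \int[lebn n]_w f w.

Let m := \int[lebn n]_w f w.
Let S2 := \int[lebn n]_w (f w * sqn w).

Lemma gconv_le v : gconv v <= m.
Proof.
apply: le_Rintegral => //; first exact: gconv_integ.
by move=> w _; rewrite ler_piMr// gk_le1.
Qed.

(** Jensen's inequality for the probability density [f / m], after [|v - w|^2 <= 2 (|v|^2 + |w|^2)];
    [S2 / m] is the mean of [|w|^2]. This keeps the logarithm from falling faster than
    quadratically. *)
Lemma gconv_ge v : m * expR (- (sqn v + S2 / m) / eps) <= gconv v.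
Proof.
pose X (w : rvm R n) := - (sqn v + sqn w) / eps.
have mX : measurable_fun setT X.
  apply: measurable_funM => //; apply: measurable_funN; apply: measurable_funD => //.
  by apply: msqn; exact: measurable_id.
have ifX : integ (lebn n) (fun w => f w * X w).
  rewrite (_ : (fun w => _) = (fun w => - (sqn v / eps) * f w + (- eps^-1) * (f w * sqn w))).
    by apply: integD; apply: integZ.
  by apply/funext => w; rewrite /X; ring.
have mfe : measurable_fun setT (fun w => f w * expR (X w)).
  by apply: measurable_funM => //; exact: mexpR.
have ife : integ (lebn n) (fun w => f w * expR (X w)).
  apply: (integ_le _ _ _ mfe _ fi) => w.
  rewrite normrM !ger0_norm ?expR_ge0// ler_piMr// -expR0 ler_expR.
  by rewrite /X mulNr oppr_le0 divr_ge0 ?addr_ge0 ?sqn_ge0// ltW.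
have := jensen_expR _ _ _ f0 fi ifX ife mass; rewrite -/m.
have -> : \int[lebn n]_w (f w * X w) = - (sqn v / eps) * m - eps^-1 * S2.
  rewrite -!RintegralZl// -RintegralB; [|by []|exact: integZ|exact: integZ].
  by apply: eq_Rintegral => w _; rewrite /X; ring.
rewrite (_ : (- (sqn v / eps) * m - eps^-1 * S2) / m = - (sqn v + S2 / m) / eps); last first.
  by field; rewrite !gt_eqF.
move/le_trans; apply; apply: le_Rintegral => //; first exact: gconv_integ.
move=> w _; rewrite ler_wpM2l// ler_expR /X.
have -> : - (sqn v + sqn w) / eps = - (2 * (sqn v + sqn w)) / (2 * eps).
  by field; rewrite gt_eqF.
rewrite ler_wpM2r ?invr_ge0 ?mulr_ge0 ?(ltW eps0)// lerN2.
by have := sqnD_le v (- w); rewrite sqnN.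
Qed.

Lemma gconv_gt0 v : 0 < gconv v.
Proof. by apply: lt_le_trans (gconv_ge v); rewrite mulr_gt0// expR_gt0. Qed.

Lemma lnmE v : lnm v = ln cpsi + ln (gconv v).
Proof. by rewrite /lnm molliE lnM// posrE ?cpsi_gt0// gconv_gt0. Qed.

Lemma ln_gconv_ge v : ln m - (sqn v + S2 / m) / eps <= ln (gconv v).
Proof.
rewrite -mulNr; apply: lnD_le => //; [exact: gconv_gt0|exact: gconv_ge].
Qed.

Lemma ln_gconv_le v : ln (gconv v) <= ln m.
Proof. by rewrite ler_ln ?posrE ?gconv_gt0// gconv_le. Qed.

Let S20 : 0 <= S2 / m.
Proof.
rewrite divr_ge0 ?(ltW mass)//.
by apply: Rintegral_ge0 => w _; rewrite mulr_ge0// sqn_ge0.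
Qed.

Lemma lnm_growth : exists2 C, 0 <= C & forall v, `|lnm v| <= C * (1 + sqn v).
Proof.
exists (`|ln cpsi| + `|ln m| + (1 + S2 / m) / eps).
  by rewrite !addr_ge0 ?divr_ge0 ?addr_ge0 ?(ltW eps0).
move=> v; rewrite lnmE.
have h1 := ln_gconv_ge v; have h2 := ln_gconv_le v.
have h3 : `|ln (gconv v)| <= `|ln m| + (sqn v + S2 / m) / eps.
  have q0 : 0 <= (sqn v + S2 / m) / eps by rewrite divr_ge0 ?addr_ge0 ?sqn_ge0 ?(ltW eps0).
  have n1 := ler_norm (ln m); have n2 := ler_norm (- ln m); rewrite normrN in n2.
  by rewrite ler_norml; apply/andP; split; lra.
have h4 := ler_normD (ln cpsi) (ln (gconv v)).
have h5 : (sqn v + S2 / m) / eps <= (1 + S2 / m) / eps * (1 + sqn v).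
  rewrite mulrAC ler_wpM2r ?invr_ge0 ?(ltW eps0)//.
  by have := mulr_ge0 S20 (sqn_ge0 v); have := sqn_ge0 v; move: (S2 / m) => q; nra.
have := mulr_ge0 (normr_ge0 (ln cpsi)) (sqn_ge0 v).
have := mulr_ge0 (normr_ge0 (ln m)) (sqn_ge0 v).
set A := (1 + S2 / m) / eps in h5 *; lra.
Qed.

Let rho v (w : rvm R n) := f w * gk eps (v - (w : 'rV[R]_n)).

Let rho_ge0 v w : 0 <= rho v w. Proof. by rewrite mulr_ge0// gk_ge0. Qed.

Let rho_sqn_integ v : integ (lebn n) (fun w => rho v w * sqn (v - (w : 'rV[R]_n))).
Proof.
have i1 : integ (lebn n) (fun w => 2 * sqn v * f w + 2 * (f w * sqn w)).
  by apply: integD; apply: integZ.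
apply: (integ_le _ _ _ _ _ i1) => [|w].
  apply: measurable_funM; first exact: measurable_gconv_integrand.
  by apply: msqn; apply: mrvB => //; exact: measurable_id.
rewrite ger0_norm ?mulr_ge0 ?gk_ge0 ?sqn_ge0//.
have -> : 2 * sqn v * f w + 2 * (f w * sqn w) = f w * (2 * (sqn v + sqn w)) by ring.
rewrite /rho -mulrA ler_wpM2l//.
have := sqnD_le v (- w); rewrite sqnN => /(le_trans _) ->//.
by rewrite ler_piMl ?sqn_ge0 ?gk_le1.
Qed.

(** Jensen's inequality with [X] equal to half of the Gaussian exponent: then
    [rho v w * expR (X w) <= f w], so the exponential moment is at most [m], and [ln_gconv_ge]
    bounds [ln m - ln (gconv v)] by a quadratic. *)
Lemma gconv_second_moment v :
  \int[lebn n]_w (rho v w * sqn (v - (w : 'rV[R]_n))) <= gconv v * (4 * (sqn v + S2 / m)).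
Proof.
set S := \int[lebn n]_w _.
pose X (w : rvm R n) := (4 * eps)^-1 * sqn (v - (w : 'rV[R]_n)).
have e4 : 0 < 4 * eps by rewrite mulr_gt0.
have ir : integ (lebn n) (rho v) by exact: gconv_integ.
have E w : rho v w * X w = (4 * eps)^-1 * (rho v w * sqn (v - w)).
  by rewrite /X; ring.
have irX : integ (lebn n) (fun w => rho v w * X w).
  by under eq_fun do rewrite E; exact: integZ.
have le1 w : rho v w * expR (X w) <= f w.
  rewrite /rho /X /gk -mulrA -expRD ler_piMr// expR_le1.
  rewrite (_ : _ + _ = - ((4 * eps)^-1 * sqn (v - w))); last by field; rewrite gt_eqF.
  by rewrite oppr_le0 mulr_ge0 ?sqn_ge0 ?invr_ge0 ?(ltW e4).
have ire : integ (lebn n) (fun w => rho v w * expR (X w)).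
  apply: (integ_le _ _ _ _ _ fi) => [|w].
    apply: measurable_funM; first exact: measurable_gconv_integrand.
    apply: mexpR; apply: measurable_funM; first exact: measurable_cst.
    by apply: msqn; apply: mrvB => //; exact: measurable_id.
  rewrite ger0_norm; first exact: le1.
  by apply: mulr_ge0; [exact: rho_ge0|exact: expR_ge0].
have G0 := gconv_gt0 v.
have := jensen_expR _ _ _ (rho_ge0 v) ir irX ire G0.
have -> : \int[lebn n]_w (rho v w * X w) = (4 * eps)^-1 * S.
  by under eq_Rintegral do rewrite E; rewrite RintegralZl.
move=> /le_trans /(_ (le_Rintegral measurableT ire fi (fun w _ => le1 w))) h.
have : ln (gconv v) + (4 * eps)^-1 * S / gconv v <= ln m.
  exact: lnD_le.
have := ln_gconv_ge v => h1 h2.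
have {h1 h2} : (4 * eps)^-1 * S / gconv v <= (sqn v + S2 / m) / eps by lra.
rewrite ler_pdivrMr// ler_pdivrMl//.
by move/le_trans; apply; rewrite le_eqVlt; apply/orP; left; apply/eqP; field; rewrite !gt_eqF.
Qed.

Lemma gconv_first_moment : exists2 C, 0 <= C & forall v,
  \int[lebn n]_w (rho v w * normv (v - (w : 'rV[R]_n))) <= gconv v * (C * (1 + normv v)).
Proof.
exists (1 + 4 * (1 + S2 / m)) => [|v]; first by rewrite addr_ge0// mulr_ge0// addr_ge0.
(* Balancing weight: [x <= a + x^2 / a] turns the quadratic bound on the second moment into a linear
   bound on the first. *)
pose a := 1 + normv v; have a1 : 1 <= a by rewrite lerDl normv_ge0.
have a0 : 0 < a by lra.
have ir : integ (lebn n) (rho v) by exact: gconv_integ.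
have i1 : integ (lebn n) (fun w => a * rho v w + a^-1 * (rho v w * sqn (v - (w : 'rV[R]_n)))).
  by apply: integD; apply: integZ.
have le1 w : rho v w * normv (v - w) <= a * rho v w + a^-1 * (rho v w * sqn (v - w)).
  have -> : a * rho v w + a^-1 * (rho v w * sqn (v - w)) =
    rho v w * (a + a^-1 * sqn (v - w)) by ring.
  rewrite ler_wpM2l// -normv_sqr.
  set x := normv _; rewrite -(ler_pM2l a0) mulrDr mulVKf ?gt_eqF//.
  have x0 : 0 <= x := normv_ge0 _.
  have := sqr_ge0 (a - x); nra.
have mrn : measurable_fun setT (fun w => rho v w * normv (v - (w : 'rV[R]_n))).
  apply: measurable_funM; first exact: measurable_gconv_integrand.
  by apply: mnormv; apply: mrvB => //; exact: measurable_id.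
have := norm_Rintegral_le _ _ _ mrn i1.
have h w : `|rho v w * normv (v - w)| <= a * rho v w + a^-1 * (rho v w * sqn (v - w)).
  by rewrite ger0_norm ?mulr_ge0 ?gk_ge0 ?normv_ge0.
move=> /(_ h) /(le_trans (ler_norm _)) /le_trans; apply.
rewrite RintegralD//; [|exact: integZ|exact: integZ].
rewrite !RintegralZl// -[X in a * X + _]/(gconv v).
have G0 := gconv_gt0 v.
rewrite (le_trans (lerD (lexx _) (ler_wpM2l _ (gconv_second_moment v))))//.
  by rewrite invr_ge0 ltW.
have -> : a * gconv v + a^-1 * (gconv v * (4 * (sqn v + S2 / m))) =
  gconv v * (a + a^-1 * (4 * (sqn v + S2 / m))) by ring.
rewrite ler_pM2l// -/a.
have : a^-1 * (4 * (sqn v + S2 / m)) <= 4 * (1 + S2 / m) * a.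
  rewrite ler_pdivrMl// -normv_sqr.
  have : 0 <= S2 / m * normv v by rewrite mulr_ge0// normv_ge0.
  have : 0 <= S2 / m * normv v ^+ 2 by rewrite mulr_ge0// sqr_ge0.
  have := normv_ge0 v; have := S20; rewrite /a; nra.
by move=> h2; rewrite (mulrDl 1 _ a) mul1r lerD2l.
Qed.

(* Jensen's inequality for the probability proportional to [f * gk eps (v - _)]
   bounds [ln (gconv w)] from below by [ln (gconv v)] plus a first moment. *)
Lemma lnm_lipschitz : exists2 C, 0 <= C & forall v w,
  `|lnm v - lnm w| <= C * normv (v - w) * (1 + normv v + normv w).
Proof.
have [C C0 HC] := gconv_first_moment.
have low v y : ln (gconv v) - normv y * (C * (1 + normv v)) / eps - sqn y / (2 * eps)
    <= ln (gconv (v + y)).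
  (* [expR (X w)] is the ratio of [gk eps (v + y - w)] to [gk eps (v - w)]: translating the Gaussian
     is an exponential tilt. *)
  pose X (w : rvm R n) := - (dotv y (v - w)) / eps - sqn y / (2 * eps).
  have G0 := gconv_gt0 v.
  have ir : integ (lebn n) (rho v) by exact: gconv_integ.
  have md : measurable_fun setT (fun w : rvm R n => dotv y (v - (w : 'rV[R]_n))).
    by apply: mdotv => //; apply: mrvB => //; exact: measurable_id.
  have mn : measurable_fun setT (fun w : rvm R n => normv (v - (w : 'rV[R]_n))).
    by apply: mnormv; apply: mrvB => //; exact: measurable_id.
  have mr : measurable_fun setT (rho v) := integ_meas _ _ ir.
  have irn : integ (lebn n) (fun w => rho v w * normv (v - (w : 'rV[R]_n))).
    apply: (integ_le _ _ _ _ _ (integD _ _ _ ir (rho_sqn_integ v))) => [|w].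
      exact: measurable_funM.
    rewrite ger0_norm ?mulr_ge0 ?gk_ge0 ?normv_ge0//.
    have -> : rho v w + rho v w * sqn (v - w) = rho v w * (1 + sqn (v - w)).
      by rewrite mulrDr mulr1.
    by rewrite ler_wpM2l ?normv_le1.
  have ird : integ (lebn n) (fun w => rho v w * dotv y (v - (w : 'rV[R]_n))).
    apply: (integ_le _ _ _ _ _ (integZ _ (normv y) _ irn)) => [|w].
      exact: measurable_funM.
    rewrite normrM (ger0_norm (rho_ge0 v w)) mulrCA ler_wpM2l//.
    exact: cauchy_schwarz.
  have E w : rho v w * X w = - eps^-1 * (rho v w * dotv y (v - w)) - sqn y / (2 * eps) * rho v w.
    by rewrite /X; ring.
  have irX : integ (lebn n) (fun w => rho v w * X w).
    by under eq_fun do rewrite E; apply: integB; apply: integZ.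
  have E2 w : rho v w * expR (X w) = rho (v + y) w.
    rewrite /rho /gk -mulrA -expRD; congr (_ * expR _).
    rewrite /X (addrAC v y) (sqnD (v - w) y) (dotvC (v - w) y); field.
    by rewrite gt_eqF.
  have ire : integ (lebn n) (fun w => rho v w * expR (X w)).
    by under eq_fun do rewrite E2; exact: gconv_integ.
  have := jensen_expR _ _ _ (rho_ge0 v) ir irX ire G0.
  rewrite -[\int[lebn n]_x rho v x]/(gconv v).
  under [X in _ <= X]eq_Rintegral do rewrite E2.
  rewrite -[\int[lebn n]_x rho (v + y) x]/(gconv (v + y)).
  under eq_Rintegral do rewrite E.
  rewrite RintegralB; [|by []|exact: integZ|exact: integZ].
  rewrite !RintegralZl// -[\int[lebn n]_x rho v x]/(gconv v).
  set I := \int[lebn n]_w (rho v w * dotv y (v - w)).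
  have II : I <= normv y * (gconv v * (C * (1 + normv v))).
    rewrite (le_trans (ler_norm _))//.
    have mrd : measurable_fun setT (fun w => rho v w * dotv y (v - (w : 'rV[R]_n))).
      exact: measurable_funM.
    rewrite (le_trans (norm_Rintegral_le _ _ _ mrd (integZ _ (normv y) _ irn) _))//.
      move=> w; rewrite normrM (ger0_norm (rho_ge0 v w)) mulrCA ler_wpM2l//.
      exact: cauchy_schwarz.
    by rewrite RintegralZl// ler_wpM2l ?normv_ge0.
  move=> h.
  have {h} : ln (gconv v) + (- eps^-1 * I - sqn y / (2 * eps) * gconv v) / gconv v
      <= ln (gconv (v + y)).
    exact: (lnD_le _ _ _ G0 (gconv_gt0 (v + y)) h).
  apply: le_trans; rewrite -!addrA lerD2l -opprD.
  rewrite (_ : (_ - _) / gconv v = - (I / gconv v / eps + sqn y / (2 * eps))).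
    rewrite lerN2 lerD2r ler_wpM2r ?invr_ge0 ?(ltW eps0)//.
    by rewrite ler_pdivrMr// mulrAC -mulrA.
  by field; rewrite !gt_eqF.
exists ((2 * C + 1) / eps) => [|v w].
  by rewrite divr_ge0 ?addr_ge0 ?mulr_ge0 ?(ltW eps0).
rewrite !lnmE opprD addrACA subrr add0r.
have h1 := low v (w - v); have h2 := low w (v - w).
rewrite !subrKC -(opprB v w) normvN sqnN in h1 h2.
have -> : (2 * C + 1) / eps * normv (v - w) * (1 + normv v + normv w) =
  ((2 * C + 1) * normv (v - w) * (1 + normv v + normv w)) / eps by ring.
have e2 : sqn (v - w) / (2 * eps) = (sqn (v - w) / 2) / eps by field; rewrite gt_eqF.
rewrite {}e2 in h1 h2.
set z := normv (v - w) in h1 h2 *.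
have z0 : 0 <= z := normv_ge0 _.
have zz : z <= normv v + normv w by exact: ler_normvB.
have v0 := normv_ge0 v; have w0 := normv_ge0 w.
rewrite -normv_sqr -/z in h1 h2.
have b1 : z * (C * (1 + normv v)) / eps + z ^+ 2 / 2 / eps <=
    (2 * C + 1) * z * (1 + normv v + normv w) / eps.
  by rewrite -mulrDl ler_wpM2r ?invr_ge0 ?(ltW eps0)// lnm_lipschitz_bound.
have b2 : z * (C * (1 + normv w)) / eps + z ^+ 2 / 2 / eps <=
    (2 * C + 1) * z * (1 + normv v + normv w) / eps.
  rewrite -mulrDl ler_wpM2r ?invr_ge0 ?(ltW eps0)// (addrAC 1 (normv v)).
  by apply: lnm_lipschitz_bound => //; rewrite addrC.
exact: (ler_dist_two_sided _ _ _ _ _ _ b1 b2 h1 h2).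
Qed.

End LogMollified.
Arguments cpsi {R} n eps.

(** * The mollifier and its moments *)

Section PsiKernel.
Context {R : realType} {n : nat}.
Variable eps : R.
Hypothesis eps0 : 0 < eps.

Lemma gker_psi : gker eps (@psi R n eps).
Proof. exact/gkerZ/gker_gk. Qed.

Definition dpsi (i : 'I_n) (x : 'rV[R]_n) : R := - eps^-1 * psi eps x * x ord0 i.

Lemma hasgrad_psi : hasgrad (@psi R n eps) (fun x => (- eps^-1 * psi eps x) *: x).
Proof.
have H := hasgradM _ _ _ _ (@hasgrad_cst R n (cpsi n eps)) (hasgrad_gk eps eps0).
apply: (eq_hasgrad _ _ _ H) => x /=.
by rewrite scaler0 addr0 scalerA psiE; congr (_ *: _); ring.
Qed.

Lemma gker_dpsi i : gker eps (dpsi i).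
Proof.
exists (fun x => - eps^-1 * cpsi n eps * x ord0 i).
  by apply: polyfM; [exact: polyf_cst|exact: polyf_coord].
by move=> x; rewrite /dpsi psiE; ring.
Qed.

Lemma grad_psi_coord x i : grad (psi eps) x ord0 i = dpsi i x.
Proof. by rewrite (hasgradE _ _ hasgrad_psi) mxE. Qed.

Lemma hasgrad_conv_psi (L : rvm R n -> R) D : measurable_fun setT L ->
  (forall w, `|L w| <= D * (1 + sqn w)) ->
  hasgrad (convol (psi eps) L) (fun v => \row_i convol (dpsi i) L v).
Proof.
move=> mL LD; have gd i : gker eps (fun x : 'rV[R]_n => ((- eps^-1 * psi eps x) *: x) ord0 i).
  by under eq_fun do rewrite mxE; exact: gker_dpsi.
apply: (eq_hasgrad _ _ _ (hasgrad_conv eps D L eps0 mL LD _ _ gker_psi hasgrad_psi gd)).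
by move=> v; apply/rowP => i; rewrite !mxE; apply: eq_Rintegral => w _; rewrite mxE.
Qed.

Let one_bound (w : rvm R n) : `|1 : R| <= 1 * (1 + sqn w).
Proof. by rewrite normr1 mul1r lerDl sqn_ge0. Qed.

Let m1 : measurable_fun setT (fun _ : rvm R n => 1 : R).
Proof. exact: measurable_cst. Qed.

Lemma conv_psi1 (v : 'rV[R]_n) : convol (psi eps) (fun=> 1) v = 1 :> R.
Proof.
rewrite /convol; under eq_Rintegral do rewrite mulr1 psiE.
rewrite RintegralZl//; last exact: gauss_integ.
rewrite gauss_Rintegral// -powRD; last first.
  by apply/implyP => _; rewrite gt_eqF// !mulr_gt0// pi_gt0.
by rewrite addNr powRr0.
Qed.

(** The convolution of [psi eps] with 1 is constant, so its gradient vanishes. The first and second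
    moments of [psi eps] come from this identity and its derivative, without computing further
    integrals. *)
Lemma conv_dpsi1 i (v : 'rV[R]_n) : convol (dpsi i) (fun=> 1) v = 0 :> R.
Proof.
have := hasgradE _ _ (hasgrad_conv_psi (fun=> 1) 1 m1 one_bound) v.
have -> : convol (psi eps) (fun=> 1) = (fun _ : 'rV[R]_n => 1).
  by apply/funext => w; exact: conv_psi1.
rewrite (hasgradE _ _ (@hasgrad_cst R n 1)) => /rowP /(_ i).
by rewrite !mxE => <-.
Qed.

Lemma psi_integ (P : 'rV[R]_n -> R) v : polyf P ->
  integ (lebn n) (fun w => psi eps (v - (w : 'rV[R]_n)) * P (v - (w : 'rV[R]_n))).
Proof.
move=> pP; have g1 : gker eps (fun x : 'rV[R]_n => P x * psi eps x).
  exact: gkerM pP gker_psi.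
have := conv_integ eps 1 (fun=> 1) eps0 m1 one_bound _ v g1.
by congr integrable; apply/funext => w /=; rewrite mulr1 mulrC.
Qed.

Lemma psi_moment0 (v : 'rV[R]_n) : \int[lebn n]_w psi eps (v - (w : 'rV[R]_n)) = 1.
Proof. by rewrite -(conv_psi1 v); apply: eq_Rintegral => w _; rewrite mulr1. Qed.

Lemma psi_moment1 i (v : 'rV[R]_n) :
  \int[lebn n]_w (psi eps (v - (w : 'rV[R]_n)) * (v - w) ord0 i) = 0.
Proof.
have := conv_dpsi1 i v; rewrite /convol.
under eq_Rintegral => w _ do rewrite mulr1 /dpsi -mulrA.
rewrite RintegralZl//; last exact: (psi_integ _ _ (polyf_coord i)).
by move/eqP; rewrite mulf_eq0 oppr_eq0 invr_eq0 (gt_eqF eps0) /= => /eqP.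
Qed.

(** Differentiating [conv_dpsi1] once more gives [- eps^-1 + eps^-2 * I = 0] for the second moment
    [I]. *)
Lemma psi_moment2 i (v : 'rV[R]_n) :
  \int[lebn n]_w (psi eps (v - (w : 'rV[R]_n)) * ((v - w) ord0 i) ^+ 2) = eps.
Proof.
pose G (x : 'rV[R]_n) := (- eps^-1 * psi eps x) *: unitv i +
   x ord0 i *: ((- eps^-1) *: ((- eps^-1 * psi eps x) *: x)).
have HG : hasgrad (dpsi i) G.
  have H1 := hasgradM _ _ _ _ (@hasgrad_cst R n (- eps^-1)) hasgrad_psi.
  apply: (eq_hasgrad _ _ _ (hasgradM _ _ _ _ H1 (hasgrad_coord i))) => x /=.
  by rewrite scaler0 addr0.
have gG j : gker eps (fun x => G x ord0 j).
  exists (fun x => - eps^-1 * cpsi n eps * (i == j)%:R +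
    x ord0 i * (eps^-1 * eps^-1 * cpsi n eps * x ord0 j)).
    apply: polyfD; first exact: polyf_cst.
    apply: polyfM; first exact: polyf_coord.
    by apply: polyfM; [exact: polyf_cst|exact: polyf_coord].
  by move=> x; rewrite /G !mxE psiE; ring.
have := hasgradE _ _ (hasgrad_conv eps 1 (fun=> 1) eps0 m1 one_bound _ _ (gker_dpsi i) HG gG) v.
have -> : convol (dpsi i) (fun=> 1) = (fun _ : 'rV[R]_n => 0).
  by apply/funext => w; exact: conv_dpsi1.
rewrite (hasgradE _ _ (@hasgrad_cst R n 0)) => /rowP /(_ i); rewrite !mxE /convol.
have p2 := psi_integ _ v (polyfM _ _ (polyf_coord i) (polyf_coord i)).
have p0 : integ (lebn n) (fun w => psi eps (v - (w : 'rV[R]_n))).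
  have := psi_integ _ v (polyf_cst 1); congr integrable.
  by apply/funext => w /=; rewrite mulr1.
rewrite (_ : \int[lebn n]_w _ = \int[lebn n]_w
    ((- eps^-1) * psi eps (v - (w : 'rV[R]_n)) +
     (eps^-1 * eps^-1) * (psi eps (v - w) * ((v - w) ord0 i * (v - w) ord0 i)))).
  rewrite RintegralD//; [|exact: integZ|exact: integZ].
  rewrite (RintegralZl _ measurableT p0) (RintegralZl _ measurableT p2) (psi_moment0 v) mulr1.
  under [in X in _ -> X]eq_Rintegral do rewrite expr2.
  set I := \int[lebn n]_w _ => /esym /eqP.
  move/eqP => h.
  have -> : I = eps * eps * (- eps^-1 + eps^-1 / eps * I) + eps.
    by field; rewrite gt_eqF.
  by rewrite h mulr0 add0r.
by apply: eq_Rintegral => w _; rewrite /G !mxE eqxx /= mulr1n; ring.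
Qed.

(** Expansion around [v]: the first moments vanish, and each coordinate contributes its variance
    [eps] to the quadratic term. *)
Lemma convol_psi_quadratic (c0 c2 : R) (c1 v : 'rV[R]_n) :
  convol (psi eps) (fun w => c0 + dotv c1 w + c2 * sqn w) v =
  c0 + dotv c1 v + c2 * (sqn v + n%:R * eps).
Proof.
have i0 := psi_integ _ v (polyf_cst 1).
have i1 i := psi_integ _ v (polyf_coord i).
have i2 i := psi_integ _ v (polyfM _ _ (polyf_coord i) (polyf_coord i)).
have E (w : 'rV[R]_n) : psi eps (v - w) * (c0 + dotv c1 w + c2 * sqn w) =
    (c0 + dotv c1 v + c2 * sqn v) * (psi eps (v - w) * 1) +
    (\sum_i (- (c1 ord0 i + 2 * c2 * v ord0 i)) * (psi eps (v - w) * (v - w) ord0 i) +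
     \sum_i c2 * (psi eps (v - w) * ((v - w) ord0 i * (v - w) ord0 i))).
  have d1 : \sum_i (- (c1 ord0 i + 2 * c2 * v ord0 i)) * (psi eps (v - w) * (v - w) ord0 i) =
      - psi eps (v - w) * (dotv c1 (v - w) + 2 * c2 * dotv v (v - w)).
    rewrite /dotv mulr_sumr -big_split mulr_sumr; apply: eq_bigr => i _ /=; ring.
  have d2 : \sum_i c2 * (psi eps (v - w) * ((v - w) ord0 i * (v - w) ord0 i)) =
      c2 * psi eps (v - w) * sqn (v - w).
    by rewrite mulr_sumr; apply: eq_bigr => i _ /=; ring.
  rewrite d1 d2 sqnB !dotvBr -[dotv v v]/(sqn v); ring.
have j1 : integ (lebn n) (fun w => \sum_i (- (c1 ord0 i + 2 * c2 * v ord0 i)) *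
    (psi eps (v - (w : 'rV[R]_n)) * (v - w) ord0 i)).
  by apply: integ_sum => i; apply: integZ; exact: i1.
have j2 : integ (lebn n) (fun w => \sum_i c2 *
    (psi eps (v - (w : 'rV[R]_n)) * ((v - w) ord0 i * (v - w) ord0 i))).
  by apply: integ_sum => i; apply: integZ; exact: i2.
have s1 : \int[lebn n]_w (\sum_i (- (c1 ord0 i + 2 * c2 * v ord0 i)) *
    (psi eps (v - (w : 'rV[R]_n)) * (v - w) ord0 i)) = 0.
  rewrite Rintegral_sum; last by move=> i; apply: integZ; exact: i1.
  by rewrite big1// => i _; rewrite (RintegralZl _ measurableT (i1 i)) psi_moment1 mulr0.
have s2 : \int[lebn n]_w (\sum_i c2 *
    (psi eps (v - (w : 'rV[R]_n)) * ((v - w) ord0 i * (v - w) ord0 i))) = c2 * (n%:R * eps).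
  rewrite Rintegral_sum; last by move=> i; apply: integZ; exact: i2.
  transitivity (\sum_(i < n) c2 * eps); last by rewrite sumr_const card_ord -mulr_natl; ring.
  apply: eq_bigr => i _; rewrite (RintegralZl _ measurableT (i2 i)); congr (_ * _).
  exact: psi_moment2.
rewrite /convol; under eq_Rintegral do rewrite E.
rewrite RintegralD//; [|exact: integZ|exact: integD].
rewrite RintegralD// s1 s2 (RintegralZl _ measurableT i0).
under eq_Rintegral do rewrite mulr1.
by rewrite (psi_moment0 v); ring.
Qed.

(** A kernel of mean zero allows [L w] to be replaced by [L w - L v], and the Lipschitz bound on [L]
    then lowers the growth from quadratic to linear. The kernels [dpsi] are of this kind, which
    gives the linear growth of the gradient of [dE]. *)
Lemma convol_affine_growth (L : rvm R n -> R) D C K : measurable_fun setT L ->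
  (forall w, `|L w| <= D * (1 + sqn w)) ->
  (forall v w, `|L v - L w| <= C * normv (v - w) * (1 + normv v + normv w)) ->
  0 <= C -> gker eps K -> (forall v, convol K (fun=> 1) v = 0) ->
  exists2 C', 0 <= C' & forall v, `|convol K L v| <= C' * (1 + normv v).
Proof.
move=> mL LD LC C0 gK K0.
have [CK CK0 HK] := gker_bound eps eps0 K gK.
have e2 : 0 < 2 * eps by rewrite mulr_gt0.
have e4 : 0 < 2 * (2 * eps) by rewrite mulr_gt0.
pose M := CK * (C * 4) * (1 + 4 * (2 * eps)).
exists (M * (2 * pi * (2 * (2 * eps))) `^ (n%:R / 2)) => [|v].
  by rewrite mulr_ge0 ?powR_ge0// !mulr_ge0// addr_ge0// !mulr_ge0// ltW.
have iK := conv_integ eps D L eps0 mL LD K v gK.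
have i1 := conv_integ eps 1 (fun=> 1) eps0 m1 one_bound K v gK.
have -> : convol K L v = \int[lebn n]_w (K (v - (w : 'rV[R]_n)) * L w - L v * (K (v - w) * 1)).
  rewrite RintegralB//; last exact: integZ.
  by rewrite (RintegralZl _ measurableT i1) -[X in _ - _ * X]/(convol K (fun=> 1) v) K0 mulr0 subr0.
have ig : integ (lebn n) (fun w => M * (1 + normv v) * gk (2 * (2 * eps)) (v - (w : 'rV[R]_n))).
  by apply: integZ; exact: gauss_integ.
have mi : measurable_fun setT (fun w : rvm R n => K (v - (w : 'rV[R]_n)) * L w - L v * (K (v - w) * 1)).
  by apply: (integ_meas (lebn n)); apply: integB => //; exact: integZ.
apply: le_trans (norm_Rintegral_le _ _ _ mi ig _) _ => [w|]; last first.
  rewrite RintegralZl//; last exact: gauss_integ.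
  by rewrite gauss_Rintegral// mulrAC.
have -> : K (v - w) * L w - L v * (K (v - w) * 1) = K (v - w) * (L w - L v) by ring.
rewrite normrM (le_trans (ler_pM _ _ (HK _) (LC _ _)))//.
rewrite normvB_sym; set x := v - w.
have nw : normv w <= normv v + normv x.
  by rewrite (_ : w = v - x) ?ler_normvB// /x subKr.
have h : C * normv x * (1 + normv w + normv v) <= C * 4 * (1 + normv v) * (1 + sqn x).
  rewrite -!mulrA ler_wpM2l// -normv_sqr.
  move: (normv x) (normv v) (normv w) (normv_ge0 x) (normv_ge0 v) nw.
  move=> a b c a0 b0 cab.
  have a1 : a <= 1 + a ^+ 2 by have := sqr_ge0 (a - 1); nra.
  have : a * b <= (1 + a ^+ 2) * b by rewrite ler_wpM2r.
  have : a * c <= a * (b + a) by rewrite ler_wpM2l.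
  have : 0 <= a ^+ 2 by exact: sqr_ge0.
  nra.
rewrite (le_trans (ler_wpM2l _ h))//; first by rewrite mulr_ge0// gk_ge0.
have -> : CK * gk (2 * eps) x * (C * 4 * (1 + normv v) * (1 + sqn x)) =
  CK * (C * 4) * (1 + normv v) * ((1 + sqn x) * gk (2 * eps) x) by ring.
rewrite (le_trans (ler_wpM2l _ (gk_growth (2 * eps) x e2)))//.
  by rewrite !mulr_ge0// addr_ge0// normv_ge0.
by rewrite /M le_eqVlt; apply/orP; left; apply/eqP; ring.
Qed.

End PsiKernel.

(** * Smooth cutoffs *)

Section FlatExp.
Context {R : realType}.
Implicit Types (x y : R) (k : nat).

(* [flat 0] is the flat function [exp (- 1 / x)]; the powers of [1 / x] make the
   family stable under derivation. *)
Definition flat k x : R := if 0 < x then x^-1 ^+ k * expR (- x^-1) else 0.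

Lemma flat_le0 k x : x <= 0 -> flat k x = 0.
Proof. by move=> x0; rewrite /flat ltNge x0. Qed.

Lemma flat_ge0 k x : 0 <= flat k x.
Proof.
rewrite /flat; case: ifP => // x0.
by rewrite mulr_ge0 ?expR_ge0// exprn_ge0// invr_ge0 ltW.
Qed.

(** The [k]-th power of [y / k <= expR (y / k)]. *)
Lemma exprn_expN_le k y : 0 <= y -> y ^+ k * expR (- y) <= k%:R ^+ k.
Proof.
move=> y0; case: k => [|k]; first by rewrite !expr0 mul1r expR_le1 oppr_le0.
rewrite expRN ler_pdivrMr ?expR_gt0//.
have {2}-> : y = k.+1%:R * (y / k.+1%:R) by rewrite mulrCA mulfV ?mulr1// pnatr_eq0.
rewrite expRM_natl -exprMn lerXn2r ?nnegrE ?mulr_ge0 ?expR_ge0//.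
rewrite mulrC -ler_pdivrMr ?ltr0n//.
by apply: le_trans (expR_ge1Dx _); rewrite lerDr.
Qed.

Lemma flat_le k x : flat k x <= k%:R ^+ k.
Proof.
rewrite /flat; case: ifP => [x0|_]; last by rewrite exprn_ge0.
by apply: exprn_expN_le; rewrite invr_ge0 ltW.
Qed.

Lemma flat_mul k x : flat k x = x * flat k.+1 x.
Proof.
rewrite /flat; case: ifP => [x0|_]; last by rewrite mulr0.
by rewrite exprS -mulrA mulVKf ?gt_eqF.
Qed.

Lemma flat_le_norm k x : flat k x <= k.+1%:R ^+ k.+1 * `|x|.
Proof.
rewrite flat_mul; have h := flat_le k.+1 x; have h0 := flat_ge0 k.+1 x.
apply: le_trans (ler_norm _) _; rewrite normrM mulrC (ger0_norm h0).
by rewrite ler_wpM2r.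
Qed.

Lemma is_derive_flat k x : is_derive x (1 : R) (flat k) (- k%:R * flat k.+1 x + flat k.+2 x).
Proof.
have [x0|x0|->] := ltgtP x 0.
- rewrite !flat_le0 ?(ltW x0)// mulr0 addr0.
  have H : is_derive x (1 : R) (fun _ : R => 0 : R) 0 by exact: is_derive_cst.
  apply: near_eq_is_derive H.
  have nx : \forall y \near x, y < 0 by exact: (@cvgr_lt _ _ (nbhs x) _ id x cvg_id 0 x0).
  by apply: filterS nx => y y0; rewrite flat_le0// ltW.
- have H : is_derive x (1 : R) (fun y => y^-1 ^+ k * expR (- y^-1))
      (- k%:R * flat k.+1 x + flat k.+2 x).
    have xn : x != 0 by rewrite gt_eqF.
    have Hi : is_derive x (1 : R) (fun y => y^-1) (- x ^- 2).
      apply: DeriveDef; first exact: derivableV.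
      by rewrite deriveV// derive_id /GRing.scale /= mulr1.
    have He : is_derive x (1 : R) (fun y => expR (- y^-1)) (x ^- 2 * expR (- x^-1)).
      have Hn : is_derive x (1 : R) (fun y => - y^-1) (x ^- 2).
        by apply: is_derive_eq (is_deriveN _) _; rewrite opprK.
      by apply: is_derive_eq (is_derive1_comp (is_derive_expR _) Hn) _; rewrite /GRing.scale /= mulrC.
    have Hk : is_derive x (1 : R) (fun y => y^-1 ^+ k) (- k%:R * x^-1 ^+ k.+1).
      elim: (k) => [|j IH].
        by under eq_fun do rewrite expr0; apply: is_derive_eq (is_derive_cst _ _ _) _; rewrite oppr0 mul0r.
      under eq_fun do rewrite exprS.
      apply: is_derive_eq (is_deriveM Hi IH) _.
      by rewrite /GRing.scale /= -exprVn -(@natr1 R j) !exprS expr0; ring.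
    apply: is_derive_eq (is_deriveM Hk He) _.
    by rewrite /flat x0 /GRing.scale /= -exprVn !exprS expr0; ring.
  apply: near_eq_is_derive H.
  have nx : \forall y \near x, 0 < y by exact: (@cvgr_gt _ _ (nbhs x) _ id x cvg_id 0 x0).
  by apply: filterS nx => y y0; rewrite /flat y0.
- rewrite !flat_le0// mulr0 addr0.
  (* At 0 the difference quotient is [flat k.+1 h], which is at most a constant times [|h|]. *)
  have lim : (fun h : R => h^-1 *: ((flat k \o shift 0) (h *: 1) - flat k 0)) @ 0^' --> (0 : R).
    apply/cvgrPdist_le => e e0.
    pose C : R := k.+2%:R ^+ k.+2; have C0 : 0 < C by rewrite exprn_gt0// ltr0n.
    have eC : 0 < e / C by rewrite divr_gt0.
    near=> h.
    rewrite /= addr0 [X in flat k X]mulr1 (flat_le0 k 0)// subr0 sub0r normrN.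
    have h0 : h != 0 by near: h; exact: nbhs_dnbhs_neq.
    rewrite flat_mul /GRing.scale /= mulKf// ger0_norm ?flat_ge0//.
    rewrite (le_trans (flat_le_norm _ _))// mulrC -ler_pdivlMr//.
    near: h; apply: dnbhs0_le => //.
  have dv : derivable (flat k) 0 1 by apply/cvg_ex; exists 0.
  by split => //; apply: cvg_lim.
Unshelve. all: by end_near. Qed.

Lemma flat_continuous k : continuous (flat k).
Proof.
move=> x; apply/differentiable_continuous/derivable1_diffP.
exact: (@ex_derive _ _ _ _ _ _ _ (is_derive_flat k x)).
Qed.

Lemma measurable_flat k : measurable_fun setT (flat k).
Proof. by apply: continuous_measurable_fun; exact: flat_continuous. Qed.

End FlatExp.

Section Cutoff.
Context {R : realType} {n : nat}.
Implicit Types (c : R) (v w x : 'rV[R]_n).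

Lemma hasgrad_mvt (F : 'rV[R]_n -> R) G v w : hasgrad F G ->
  exists xi, F v - F w = dotv (v - w) (G (w + xi *: (v - w))).
Proof.
move=> HG.
have [xi _ E] := @MVT R (fun h => F (w + h *: (v - w))) _ 0 1 ltr01
  (fun h _ => HG w (v - w) h)
  (@derivable_within_continuous R R (fun h => F (w + h *: (v - w))) `[0, 1]
    (fun h _ => @ex_derive _ _ _ _ _ _ _ (HG w (v - w) h))).
by exists xi; move: E; rewrite scale1r scale0r addr0 subrKC subr0 mulr1.
Qed.

Lemma hasgrad_lipschitz (F : 'rV[R]_n -> R) G M : hasgrad F G ->
  (forall x, normv (G x) <= M) -> forall v w, `|F v - F w| <= M * normv (v - w).
Proof.
move=> HG GM v w; have [xi ->] := hasgrad_mvt F G v w HG.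
by rewrite (le_trans (cauchy_schwarz _ _))// mulrC ler_wpM2r// normv_ge0.
Qed.

(** Zero outside the ball [c * sqn v < 1], so that letting [c] tend to 0 removes the truncation. The
    index [k] follows the derivatives of [flat]. *)
Definition vbump k c v : R := flat k (1 - c * sqn v).

Lemma hasgrad_bump k c : hasgrad (vbump k c)
  (fun v => ((- k%:R * vbump k.+1 c v + vbump k.+2 c v) * (- (2 * c))) *: v).
Proof.
have H1 : hasgrad (fun v => 1 - c * sqn v) (fun v => - (2 * c) *: v).
  have := hasgradD _ _ _ _ (@hasgrad_cst R n 1)
    (hasgradM _ _ _ _ (@hasgrad_cst R n (- c)) (@hasgrad_sqn R n)).
  have -> : (fun x : 'rV[R]_n => 1 + - c * sqn x) = (fun v => 1 - c * sqn v).
    by apply/funext => v; rewrite mulNr.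
  move=> /eq_hasgrad; apply => v /=.
  by rewrite scaler0 addr0 add0r scalerA; congr (_ *: _); ring.
apply: (eq_hasgrad _ _ _ (hasgrad_comp _ _ _ _ (is_derive_flat k) H1)) => v /=.
by rewrite scalerA.
Qed.

Lemma bump_supp k c v : 1 <= c * sqn v -> vbump k c v = 0.
Proof. by move=> h; rewrite /vbump flat_le0// subr_le0. Qed.

Lemma bump_ge0 k c v : 0 <= vbump k c v. Proof. exact: flat_ge0. Qed.

Lemma bump_le k c v : vbump k c v <= k%:R ^+ k. Proof. exact: flat_le. Qed.

Lemma continuous_bump k c : continuous (vbump k c).
Proof.
have pS : polyf (fun v : 'rV[R]_n => 1 - c * sqn v).
  have -> : (fun v : 'rV[R]_n => 1 - c * sqn v) =
      (fun v => 1 + (- c) * \sum_i v ord0 i * v ord0 i).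
    by apply/funext => v; rewrite mulNr.
  apply: polyfD; first exact: polyf_cst.
  apply: polyfM; first exact: polyf_cst.
  by apply: polyf_sum => i; apply: polyfM; exact: polyf_coord.
move=> v; apply: (@continuous_comp _ _ _ (fun v : 'rV[R]_n => 1 - c * sqn v) (flat k)).
  exact: polyf_continuous.
exact: flat_continuous.
Qed.

Section BumpConvolution.
Variables (s c D : R) (L : rvm R n -> R).
Hypothesis s0 : 0 < s.
Hypothesis c0 : 0 < c.
Hypothesis mL : measurable_fun setT L.
Hypothesis LD : forall w, `|L w| <= D * (1 + sqn w).

(** An invariant class for [smooth_class]: a derivative raises the index of the bump, multiplies or
    differentiates the polynomial, or differentiates the kernel, and the result is a sum of products
    of the same shape. *)
Inductive bumpconv : ('rV[R]_n -> R) -> Prop :=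
| bumpconv_base P k K : polyf P -> gker s K ->
    bumpconv (fun v => P v * vbump k c v * convol K L v)
| bumpconvD F1 F2 : bumpconv F1 -> bumpconv F2 -> bumpconv (fun v => F1 v + F2 v).

Lemma bumpconv_smooth F : bumpconv F -> smooth F.
Proof.
move: F; apply: smooth_class => F; elim.
- move=> P k K pP gK; split.
    move=> v; apply: (continuousM (continuousM (polyf_continuous _ pP v) (continuous_bump k c v))).
    exact: (continuous_conv s D L s0 mL LD K gK v).
  have [GP HP pGP] := polyf_grad P pP.
  have [GK HK gGK] := gker_grad s s0 K gK.
  have H1 := hasgradM _ _ _ _ HP (hasgrad_bump k c).
  have HC := hasgrad_conv s D L s0 mL LD K GK gK HK gGK.
  eexists; first exact: (hasgradM _ _ _ _ H1 HC).
  move=> e.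
  have ge : gker s (fun y => dotv e (GK y)) by exact: gker_dotv.
  have pe : polyf (fun x : 'rV[R]_n => dotv e x).
    by apply: polyf_dotv => i; exact: polyf_coord.
  have E : (fun x => dotv e ((P x * vbump k c x) *:
       (\row_i convol (fun x0 => GK x0 ord0 i) L x) +
     convol K L x *: (P x *: (((- k%:R * vbump k.+1 c x + vbump k.+2 c x) * - (2 * c)) *: x) +
       vbump k c x *: GP x))) =
    (fun x => (P x * vbump k c x * convol (fun y => dotv e (GK y)) L x +
      ((2 * c * k%:R * (P x * dotv e x)) * vbump k.+1 c x * convol K L x +
      ((- (2 * c) * (P x * dotv e x)) * vbump k.+2 c x * convol K L x +
       dotv e (GP x) * vbump k c x * convol K L x)))).
    apply/funext => x.
    have -> : convol (fun y => dotv e (GK y)) L x =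
        dotv e (\row_i convol (fun x0 => GK x0 ord0 i) L x).
      rewrite (conv_lin s D L s0 mL LD)//.
      by apply: eq_bigr => i _; rewrite mxE.
    by rewrite dotvDr !dotvZr dotvDr !dotvZr; ring.
  rewrite E; apply: bumpconvD; first exact: bumpconv_base.
  apply: bumpconvD; first apply: bumpconv_base => //.
    by apply: polyfM; [exact: polyf_cst|exact: polyfM].
  apply: bumpconvD; first apply: bumpconv_base => //.
    by apply: polyfM; [exact: polyf_cst|exact: polyfM].
  by apply: bumpconv_base => //; exact: polyf_dotv.
- move=> F1 F2 _ [c1 [G1 H1 S1]] _ [c2 [G2 H2 S2]]; split.
    by move=> v; exact: (continuousD (c1 v) (c2 v)).
  eexists; first exact: (hasgradD _ _ _ _ H1 H2).
  by move=> e; under eq_fun do rewrite dotvDr; exact: bumpconvD.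
Qed.

(** The factor [expR 1] normalizes the value at the origin to 1, since [flat 0 1] is [expR (-1)]. *)
Definition cutoff v : R := expR 1 * vbump 0 c v.

(** The cutoff is radial and its gradient is this scalar times [v]; the index 2 appears because the
    derivative of [flat 0] is [flat 2]. *)
Definition cutoff_slope v : R := - (2 * c) * (expR 1 * vbump 2 c v).

Lemma test_fun_cutoff_convol K : gker s K -> test_fun (fun v => cutoff v * convol K L v).
Proof.
move=> gK; split.
  apply: bumpconv_smooth.
  by apply: (bumpconv_base (fun=> expR 1) 0 K) => //; exact: polyf_cst.
exists (Num.sqrt c^-1) => v hv; rewrite /cutoff bump_supp ?mulr0 ?mul0r//.
rewrite -normv_sqr mulrC -ler_pdivrMr// mul1r.
rewrite -[leLHS]sqr_sqrtr ?invr_ge0 ?(ltW c0)//.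
by rewrite lerXn2r ?nnegrE ?sqrtr_ge0 ?normv_ge0// ltW.
Qed.

End BumpConvolution.

Lemma hasgrad_cutoff c : hasgrad (cutoff c) (fun v => cutoff_slope c v *: v).
Proof.
have := hasgradM _ _ _ _ (@hasgrad_cst R n (expR 1)) (hasgrad_bump 0 c).
move=> /eq_hasgrad; apply => v /=.
by rewrite scaler0 addr0 scalerA oppr0 mul0r add0r; congr (_ *: _); rewrite /cutoff_slope; ring.
Qed.

Lemma cutoff_ge0 c v : 0 <= cutoff c v.
Proof. by rewrite mulr_ge0 ?expR_ge0 ?bump_ge0. Qed.

Lemma cutoff_le c v : cutoff c v <= expR 1.
Proof. by rewrite ler_piMr ?expR_ge0// (le_trans (bump_le 0 c v)). Qed.

Lemma bump2_le c v : expR 1 * vbump 2 c v <= 4 * expR 1.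
Proof. by rewrite mulrC ler_wpM2r ?expR_ge0// (le_trans (bump_le 2 c v))// -natrX. Qed.

Lemma cutoff_slope_supp c v : 1 <= c * sqn v -> cutoff_slope c v = 0.
Proof. by move=> h; rewrite /cutoff_slope bump_supp// !mulr0. Qed.

Lemma cutoff_slope_norm c v : 0 <= c -> `|cutoff_slope c v| <= 8 * expR 1 * c.
Proof.
move=> c0; have e0 : 0 <= expR 1 * vbump 2 c v by rewrite mulr_ge0 ?expR_ge0 ?bump_ge0.
rewrite /cutoff_slope mulNr normrN ger0_norm; last by rewrite mulr_ge0// mulr_ge0.
have := bump2_le c v; set b := expR 1 * vbump 2 c v; move: (expR 1) => e h.
have -> : 8 * e * c = 2 * c * (4 * e) by ring.
by rewrite ler_wpM2l// mulr_ge0.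
Qed.

(* On the support of the cutoff, [c * sqn v < 1]; hence also [c * normv v <= 1]. *)
Lemma cutoff_slope_bound c v : 0 < c <= 1 ->
  `|cutoff_slope c v| * normv v * (1 + sqn v) <= 16 * expR 1 * (1 + normv v).
Proof.
move=> /andP[c0 c1]; have e0 : 0 < expR 1 :> R := expR_gt0 _.
have [h|h] := leP 1 (c * sqn v).
  rewrite cutoff_slope_supp// normr0 !mul0r !mulr_ge0 ?(ltW e0)//.
  by rewrite addr_ge0// normv_ge0.
have n0 := normv_ge0 v.
rewrite (le_trans (ler_wpM2r _ (ler_wpM2r n0 (cutoff_slope_norm c v (ltW c0)))))//.
  by rewrite addr_ge0// sqn_ge0.
rewrite -normv_sqr in h *; move: (normv v) n0 h => x x0 h.
have -> : 8 * expR 1 * c * x * (1 + x ^+ 2) = (8 * expR 1) * (c * x * (1 + x ^+ 2)) by ring.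
have -> : 16 * expR 1 * (1 + x) = (8 * expR 1) * (2 * (1 + x)) by ring.
rewrite ler_wpM2l// ?mulr_ge0 ?(ltW e0)//.
have a1 : c * x <= x by rewrite ler_piMl.
have a2 : c * x ^+ 2 * x <= 1 * x by rewrite ler_wpM2r// ltW.
have -> : c * x * (1 + x ^+ 2) = c * x + c * x ^+ 2 * x by ring.
lra.
Qed.

Lemma cutoff_grad_bound c v : 0 < c <= 1 -> normv (cutoff_slope c v *: v) <= 8 * expR 1.
Proof.
move=> /andP[c0 c1]; have e0 : 0 < expR 1 :> R := expR_gt0 _.
have [h|h] := leP 1 (c * sqn v).
  by rewrite cutoff_slope_supp// scale0r normv0 mulr_ge0// ltW.
rewrite normvZ (le_trans (ler_wpM2r (normv_ge0 v) (cutoff_slope_norm c v (ltW c0))))//.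
rewrite -(mulrA _ c) ler_piMr ?mulr_ge0 ?(ltW e0)//.
rewrite -normv_sqr in h; move: (normv v) (normv_ge0 v) h => x x0 h.
rewrite -ler_sqr ?nnegrE ?mulr_ge0 ?(ltW c0)// expr1n exprMn expr2 -mulrA.
by rewrite (le_trans _ c1)// ler_piMr// ltW.
Qed.

Lemma cutoff_lipschitz c v w : 0 < c <= 1 ->
  `|cutoff c v - cutoff c w| <= 8 * expR 1 * normv (v - w).
Proof.
move=> c01; apply: (hasgrad_lipschitz _ _ _ (hasgrad_cutoff c)) => x.
exact: cutoff_grad_bound.
Qed.

(** Bounds the derivative [- 2 * flat 3 + flat 4] of [flat 2], by [flat_le]. *)
Let q : R := 2 * 3%:R ^+ 3 + 4%:R ^+ 4.

Let q0 : 0 <= q.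
Proof. by apply: addr_ge0; [apply: mulr_ge0 => //|]; apply: exprn_ge0; exact: ler0n. Qed.

(** The second derivatives are bounded uniformly in [c]: they carry a factor [c] or [c^2 |x|^2], and
    [c |x|^2 < 1] on the support. Coordinates are treated separately, whence the factor [n]. *)
Lemma cutoff_grad_lipschitz : exists2 M, 0 <= M & forall c v w, 0 < c <= 1 ->
  normv (cutoff_slope c v *: v - cutoff_slope c w *: w) <= M * normv (v - w).
Proof.
have e0 : 0 < expR 1 :> R := expR_gt0 _.
pose M : R := 4 * q * expR 1 + 8 * expR 1.
have M0 : 0 <= M.
  by rewrite /M -mulrDl mulr_ge0 ?(ltW e0)// addr_ge0// mulr_ge0.
exists (n%:R * M) => [|c v w /andP[c0 c1]]; first by rewrite mulr_ge0.
rewrite (le_trans (normv_le_sum _))// -mulrA.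
have -> : n%:R * (M * normv (v - w)) = \sum_(i < n) (M * normv (v - w)).
  by rewrite sumr_const card_ord mulr_natl.
apply: ler_sum => i _; rewrite !mxE.
have H := hasgradM _ _ _ _ (@hasgrad_cst R n (- (2 * c) * expR 1)) (hasgrad_bump 2 c).
have {}H := hasgradM _ _ _ _ H (@hasgrad_coord R n i).
have E x : cutoff_slope c x * x ord0 i = - (2 * c) * expR 1 * vbump 2 c x * x ord0 i.
  by rewrite /cutoff_slope mulrA.
rewrite !E; apply: (hasgrad_lipschitz _ _ _ H) => x /=.
have [h|h] := leP 1 (c * sqn x).
  by rewrite !bump_supp// !(mulr0, addr0, mul0r, scale0r, scaler0) normv0.
set K := (- 2 * vbump 3 c x + vbump 4 c x) * - (2 * c).
rewrite scaler0 addr0.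
have b3 := bump_le 3 c x; have b4 := bump_le 4 c x.
have p3 := bump_ge0 3 c x; have p4 := bump_ge0 4 c x.
have Kle : `|K| <= 2 * q * c.
  rewrite /K normrM normrN (ger0_norm (mulr_ge0 _ (ltW c0)))// mulrA (mulrC 2 q).
  rewrite ler_wpM2r ?(ltW c0)// ler_wpM2r//.
  rewrite (le_trans (ler_normD _ _))// mulNr normrN (ger0_norm p4) ger0_norm ?mulr_ge0//.
  by rewrite lerD// ler_wpM2l.
rewrite (le_trans (ler_normvD _ _))// !normvZ normv_unitv mulr1.
have h1 : `|- (2 * c) * expR 1 * vbump 2 c x| <= 8 * expR 1.
  rewrite -mulrA -[X in `|X|]/(cutoff_slope c x).
  rewrite (le_trans (cutoff_slope_norm c x (ltW c0)))//.
  by rewrite ler_piMr// mulr_ge0// ltW.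
have h2 : `|x ord0 i| * (`|- (2 * c) * expR 1| * (`|K| * normv x)) <= 4 * q * expR 1.
  have xi := coord_le_normv x i; have x0 := normv_ge0 x.
  rewrite !mulNr normrN (ger0_norm (mulr_ge0 (mulr_ge0 _ (ltW c0)) (ltW e0)))//.
  apply: le_trans (_ : normv x * (2 * c * expR 1 * (2 * q * c * normv x)) <= _).
    have c20 : 0 <= 2 * c * expR 1 by rewrite mulr_ge0 ?(ltW e0)// mulr_ge0 ?(ltW c0).
    apply: ler_pM => //; first by rewrite mulr_ge0// mulr_ge0.
    by apply: ler_wpM2l => //; apply: ler_wpM2r.
  have -> : normv x * (2 * c * expR 1 * (2 * q * c * normv x)) =
    4 * q * expR 1 * (c * (c * normv x ^+ 2)) by ring.
  rewrite ler_piMr//; first by rewrite mulr_ge0 ?(ltW e0)// mulr_ge0.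
  rewrite normv_sqr (le_trans _ c1)// ler_piMr// ltW//.
by rewrite addrC lerD.
Qed.

End Cutoff.

(** * The collision integral *)

Section CollisionKernel.
Context {R : realType} {n : nat}.
Implicit Types (a b z v w : 'rV[R]_n).

Lemma dotvE a b : (a *m b^T) ord0 ord0 = dotv a b.
Proof. by rewrite mxE; apply: eq_bigr => i _; rewrite mxE. Qed.

Lemma AformE gamma a z b :
  Aform gamma a z b = normv z `^ gamma * (sqn z * dotv a b - dotv a z * dotv z b).
Proof.
rewrite /Aform /Akern -scalemxAr -scalemxAl mxE; congr (_ * _).
rewrite mulmxBr mulmxBl mxE -scalemxAr -scalemxAl mulmx1 mxE dotvE mxE.
congr (_ - _); rewrite mulmxA [a *m z^T]mx11_scalar mul_scalar_mx -scalemxAl mxE.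
by rewrite [ord0]ord1 -[(0 : 'I_1)]/ord0 !dotvE.
Qed.

Lemma Aform_norm gamma a z b :
  `|Aform gamma a z b| <= 2 * (normv z `^ gamma * sqn z * (normv a * normv b)).
Proof.
rewrite AformE normrM (ger0_norm (powR_ge0 _ _)) mulrCA -mulrA ler_wpM2l ?powR_ge0//.
have c1 := cauchy_schwarz a b; have c2 := cauchy_schwarz a z; have c3 := cauchy_schwarz z b.
have c4 : `|dotv a z * dotv z b| <= sqn z * (normv a * normv b).
  rewrite normrM (le_trans (ler_pM _ _ c2 c3))// -normv_sqr le_eqVlt.
  by apply/orP; left; apply/eqP; ring.
have c5 : `|sqn z * dotv a b| <= sqn z * (normv a * normv b).
  by rewrite normrM (ger0_norm (sqn_ge0 _)) ler_wpM2l ?sqn_ge0.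
by rewrite (le_trans (ler_normB _ _))// mulrCA mulr_natl mulr2n lerD.
Qed.

Lemma Aform_ge0 gamma a z : 0 <= Aform gamma a z a.
Proof.
rewrite AformE mulr_ge0 ?powR_ge0// (dotvC z a) -expr2 subr_ge0 -[dotv a a]/(sqn a).
rewrite -!normv_sqr -exprMn -real_normK ?num_real// lerXn2r ?nnegrE ?mulr_ge0 ?normv_ge0//.
by rewrite mulrC cauchy_schwarz.
Qed.

Lemma powR_1D_le (x k : R) : 0 <= x -> 0 <= k -> (1 + x) `^ k <= 2 `^ k * (1 + x `^ k).
Proof.
move=> x0 k0; have p20 : 0 <= 2 `^ k :> R := powR_ge0 _ _.
have [x1|x1] := leP x 1.
  apply: le_trans (_ : 2 `^ k <= _).
    by rewrite ge0_ler_powR ?nnegrE ?addr_ge0//; lra.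
  by rewrite ler_peMr// lerDl powR_ge0.
apply: le_trans (_ : (2 * x) `^ k <= _).
  by rewrite ge0_ler_powR ?nnegrE ?addr_ge0 ?mulr_ge0//; lra.
by rewrite powRM// ler_wpM2l// lerDr.
Qed.

Lemma kappa_ge2 (gamma : R) : -4 <= gamma <= 0 -> 2 <= kappa gamma.
Proof. by rewrite /kappa => /andP[? ?]; case: ifP => ?; lra. Qed.

(* For [gamma >= -2] only the linear growth of [a] and [b] is used; for
   [gamma < -2] the singularity at [z = 0] is absorbed by their Lipschitz bounds. *)
Lemma collision_bound (gamma C : R) a b v w (s := 1 + normv v + normv w) :
  -4 <= gamma <= 0 -> 0 <= C ->
  normv a <= C * s -> normv b <= C * s ->
  normv a <= C * normv (v - w) * s ^+ 2 -> normv b <= C * normv (v - w) * s ^+ 2 ->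
  `|Aform gamma a (v - w) b| <= 2 * C ^+ 2 * s `^ kappa gamma.
Proof.
move=> /andP[g4 g0] C0 a1 b1 a2 b2.
have s1 : 1 <= s by rewrite /s -addrA lerDl addr_ge0// normv_ge0.
have s0 : 0 < s by lra.
have [z0|z0] := eqVneq (normv (v - w)) 0.
  apply: le_trans (Aform_norm _ _ _ _) _.
  by rewrite -normv_sqr z0 expr0n mulr0 mul0r mulr0 !mulr_ge0 ?sqr_ge0 ?powR_ge0.
have zp : 0 < normv (v - w) by rewrite lt_def z0 normv_ge0.
have zs : normv (v - w) <= s.
  by rewrite (le_trans (ler_normvB _ _))// /s -addrA lerDr.
apply: le_trans (Aform_norm _ _ _ _) _; rewrite -[leRHS]mulrA ler_wpM2l//.
rewrite -normv_sqr; move: (normv (v - w)) z0 zp zs a1 a2 b1 b2 => z z0 zp zs.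
move: (normv a) (normv b) (normv_ge0 a) (normv_ge0 b) => x y x0 y0 a1 a2 b1 b2.
have s2 : C ^+ 2 * s ^+ 2 = (C * s) * (C * s) by ring.
have zg : z `^ gamma * z ^+ 2 = z `^ (gamma + 2).
  by rewrite powRD ?z0 ?implybT// powR_mulrn// ltW.
have sn : s != 0 by rewrite gt_eqF.
have sk k : s `^ (k + 2) = s `^ k * s ^+ 2.
  by rewrite powRD ?sn ?implybT// powR_mulrn// ltW.
rewrite zg /kappa; case: ifPn => [h2|]; last rewrite -ltNge => h2.
  rewrite (_ : 4 + gamma = (gamma + 2) + 2); last by ring.
  rewrite sk [leRHS]mulrCA s2 ler_pM ?powR_ge0 ?mulr_ge0//; last exact: ler_pM.
  by rewrite ge0_ler_powR ?nnegrE//; lra.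
have s4k : s ^+ 4 <= s `^ (6 + gamma / 2).
  by rewrite -powR_mulrn ?(ltW s0)// ler_powR//; lra.
have s24 : s ^+ 2 <= s ^+ 4 by exact: ler_weXn2l.
(* Far apart, [z ^ (gamma + 2) <= 1] and the linear bounds suffice. Close together, the two
   Lipschitz bounds supply a factor [z ^ 2], and [gamma + 4 >= 0] removes the singularity. Both
   cases need at most [s ^ 4]. *)
have [z1|z1] := leP 1 z.
  apply: le_trans (_ : 1 * (C * s * (C * s)) <= _).
    rewrite ler_pM ?powR_ge0 ?mulr_ge0//; last exact: ler_pM.
    by rewrite -[leRHS](powRr0 z) ler_powR//; lra.
  rewrite mul1r -s2 ler_wpM2l ?sqr_ge0//; exact: le_trans s24 s4k.
apply: le_trans (_ : z `^ (gamma + 2) * ((C * z * s ^+ 2) * (C * z * s ^+ 2)) <= _).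
  by rewrite ler_wpM2l ?powR_ge0// ler_pM.
have -> : z `^ (gamma + 2) * ((C * z * s ^+ 2) * (C * z * s ^+ 2)) =
    z `^ (gamma + 4) * (C ^+ 2 * s ^+ 4).
  rewrite (_ : gamma + 4 = (gamma + 2) + 2); last by ring.
  by rewrite [in RHS]powRD ?z0 ?implybT// (@powR_mulrn _ z 2) ?(ltW zp)//; ring.
apply: le_trans (_ : 1 * (C ^+ 2 * s ^+ 4) <= _).
  rewrite ler_wpM2r ?mulr_ge0 ?exprn_ge0 ?(ltW s0)//.
  have : z `^ (gamma + 4) <= 1 `^ (gamma + 4) by rewrite ge0_ler_powR ?nnegrE//; lra.
  by rewrite powR1.
by rewrite mul1r ler_wpM2l ?sqr_ge0.
Qed.

(** In product form the majorant of the collision integrand is integrable on pairs, each factor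
    being a moment of [f]. *)
Lemma weight_bound (k : R) v w : 0 <= k ->
  (1 + normv v + normv w) `^ k <=
  (2 `^ k * 2 `^ k) * ((1 + normv v `^ k) * (1 + normv w `^ k)).
Proof.
move=> k0; have v0 := normv_ge0 v; have w0 := normv_ge0 w.
apply: le_trans (_ : ((1 + normv v) * (1 + normv w)) `^ k <= _).
  rewrite ge0_ler_powR ?nnegrE ?mulr_ge0 ?addr_ge0//.
  by rewrite mulrDl mul1r mulrDr mulr1; have := mulr_ge0 v0 w0; lra.
rewrite powRM ?addr_ge0// mulrACA ler_pM ?powR_ge0//; exact: powR_1D_le.
Qed.

End CollisionKernel.

(** * Double integrals over pairs of velocities *)

Section ProductIntegral.
Context {R : realType}.

Definition pleb n : {measure set (rvm R n * rvm R n)%type -> \bar R} :=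
  (lebn n \x lebn n)%E.

Lemma integ_prod n (g h : rvm R n -> R) : integ (lebn n) g -> integ (lebn n) h ->
  integ (pleb n) (fun p => g p.1 * h p.2).
Proof.
move=> ig ih; have mg := integ_meas _ _ ig; have mh := integ_meas _ _ ih.
have mgh : measurable_fun setT (fun p : rvm R n * rvm R n => g p.1 * h p.2).
  apply: measurable_funM.
    exact: (measurableT_comp mg measurable_fst).
  exact: (measurableT_comp mh measurable_snd).
apply/(integrable12ltyP (lebn n) (lebn n)); first exact/measurable_EFinP.
rewrite (_ : (fun x => _) = (fun x => (`|g x| * \int[lebn n]_y `|h y|)%:E)); last first.
  apply/funext => x; rewrite EFinM EFin_Rintegral; last exact: integ_norm.
  rewrite -ge0_integralZl//; last by apply/measurable_EFinP/mnorm.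
  by apply: eq_integral => y _; rewrite /= normrM.
have := integZ (lebn n) (\int[lebn n]_y `|h y|) _ (integ_norm _ _ ig).
move=> /integrableP[_]; apply: le_lt_trans.
apply: ge0_le_integral => //.
- by move=> x _; rewrite lee_fin mulr_ge0// Rintegral_ge0.
- by apply/measurable_EFinP; apply: measurable_funM; [exact: mnorm|exact: measurable_cst].
- apply/measurable_EFinP; apply: mnorm; apply: measurable_funM; first exact: measurable_cst.
  exact: mnorm.
- by move=> x _; rewrite lee_fin mulrC ler_norm.
Qed.

(** As in one variable, the inner [iint] equals the Fubini integral for almost every [v] only, which
    the outer integral does not see. *)
Lemma iint2E n (F : rvm R n * rvm R n -> R) : integ (pleb n) F ->
  iint n (fun v => iint n (fun w => (F (v, w))%:E)) = (\int[pleb n]_p F p)%:E.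
Proof.
move=> iF; have mF : measurable_fun setT (EFin \o F) by exact: measurable_int iF.
have mH := measurable_iint n (EFin \o F) mF.
have iG := integrable_fubini_F iF.
have HG : {ae lebn n, forall v, iint n (fun w => (EFin \o F) (v, w)) =
    fubini_F (lebn n) (EFin \o F) v}.
  by have := ae_integrable1 iF; apply: filterS => v /= iv; rewrite integrable_iintE.
have iH : (lebn n).-integrable setT (fun v => iint n (fun w => (EFin \o F) (v, w))).
  apply/integrableP; split => //.
  move/integrableP : iG => [mG]; apply: le_lt_trans; rewrite le_eqVlt; apply/orP; left; apply/eqP.
  apply: ae_eq_integral => //; [exact: measurableT_comp|exact: measurableT_comp|].
  by apply: filterS HG => v + _ => ->.
rewrite (integrable_iintE _ _ iH) EFin_Rintegral//.
rewrite -[RHS](integral12_prod_meas1 iF); apply: ae_eq_integral => //.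
  exact: measurable_fubini_F iF.
by apply: filterS HG => v + _ => ->.
Qed.

End ProductIntegral.

Lemma coordB {R : realType} {n} (a b : 'rV[R]_n) i : (a - b) ord0 i = a ord0 i - b ord0 i.
Proof. by rewrite !mxE. Qed.

Lemma scaler_telescope {R : realType} {n} (a a' e e' : R) (b b' x x' : 'rV[R]_n) :
  (a *: b + e *: x) - (a' *: b' + e' *: x') =
  a *: (b - b') + (a - a') *: b' + (e *: (x - x') + (e - e') *: x').
Proof. by apply/rowP => i; rewrite !mxE; ring. Qed.

(** * Regularity of the first variation of the entropy *)

Section EnergyDerivative.
Context {R : realType} {n : nat}.
Variables (gamma eps : R) (f : rvm R n -> R).
Hypothesis eps0 : 0 < eps.
Hypothesis f0 : forall v, 0 <= f v.
Hypothesis fi : integ (lebn n) f.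
Hypothesis fi2 : integ (lebn n) (fun v => f v * sqn v).
Hypothesis mass : 0 < \int[lebn n]_w f w.

Let mf : measurable_fun setT f := integ_meas _ _ fi.
Let L := lnm eps f.
Let mL : measurable_fun setT L := measurable_lnm eps f eps0 f0 fi.
Let B (v : 'rV[R]_n) : 'rV[R]_n := graddE eps f v.

Lemma dE_convol v : dE eps f v = convol (psi eps) L v.
Proof.
have [D _ LD] := lnm_growth eps f eps0 f0 fi fi2 mass.
by rewrite /dE rintE//; exact: (conv_integ eps D L eps0 mL LD _ _ (gker_psi eps)).
Qed.

Lemma graddE_convol v i : graddE eps f v ord0 i = convol (dpsi eps i) L v.
Proof.
have [D _ LD] := lnm_growth eps f eps0 f0 fi fi2 mass.
rewrite /graddE mxE; under [X in rint X]eq_fun do rewrite grad_psi_coord//.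
by rewrite rintE//; exact: (conv_integ eps D L eps0 mL LD _ _ (gker_dpsi eps i)).
Qed.

Lemma hasgrad_dE : hasgrad (dE eps f) (graddE eps f).
Proof.
have [D _ LD] := lnm_growth eps f eps0 f0 fi fi2 mass.
have -> : (dE eps f : 'rV[R]_n -> R) = convol (psi eps) L.
  by apply/funext => v; exact: dE_convol.
apply: (eq_hasgrad _ _ _ (hasgrad_conv_psi eps eps0 L D mL LD)) => v.
by apply/rowP => i; rewrite graddE_convol mxE.
Qed.

(** The third bound is linear thanks to the mean zero of [dpsi] and to [lnm_lipschitz]; the others
    follow from the quadratic growth of [lnm]. *)
Lemma dE_bounds : exists2 C, 0 <= C & [/\
  (forall v, `|dE eps f v| <= C * (1 + sqn v)),
  (forall v w, `|dE eps f v - dE eps f w| <= C * normv (v - w) * (1 + sqn v + sqn w)),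
  (forall v, normv (graddE eps f v) <= C * (1 + normv v)) &
  (forall v w, normv (graddE eps f v - graddE eps f w) <=
     C * normv (v - w) * (1 + sqn v + sqn w))].
Proof.
have [D _ LD] := lnm_growth eps f eps0 f0 fi fi2 mass.
have [M M0 LM] := lnm_lipschitz eps f eps0 f0 fi fi2 mass.
have [C1 C10 H1] := conv_growth eps D L eps0 mL LD _ (gker_psi eps).
have [C2 C20 H2] := conv_lipschitz eps D L eps0 mL LD _ (gker_psi eps).
have /choice [C3 /all_and2 [C30 H3]] : forall i, exists C, 0 <= C /\ forall v,
    `|convol (dpsi eps i) L v| <= C * (1 + normv v).
  move=> i; have [C ? ?] := convol_affine_growth eps eps0 L D M _ mL LD LM M0 (gker_dpsi eps i)
    (conv_dpsi1 eps eps0 i).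
  by exists C.
have /choice [C4 /all_and2 [C40 H4]] : forall i, exists C, 0 <= C /\ forall v w,
    `|convol (dpsi eps i) L v - convol (dpsi eps i) L w| <=
      C * normv (v - w) * (1 + sqn v + sqn w).
  move=> i; have [C ? ?] := conv_lipschitz eps D L eps0 mL LD _ (gker_dpsi eps i).
  by exists C.
have S3 : 0 <= \sum_i C3 i by apply: sumr_ge0.
have S4 : 0 <= \sum_i C4 i by apply: sumr_ge0.
pose C := C1 + C2 + \sum_i C3 i + \sum_i C4 i.
have Q0 (v w : 'rV[R]_n) : 0 <= 1 + sqn v + sqn w by rewrite !addr_ge0// sqn_ge0.
exists C; first by rewrite !addr_ge0.
split.
- move=> v; rewrite dE_convol (le_trans (H1 v))// ler_wpM2r ?addr_ge0 ?sqn_ge0//.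
  by rewrite /C; lra.
- move=> v w; rewrite !dE_convol (le_trans (H2 v w))// ler_wpM2r// ler_wpM2r ?normv_ge0//.
  by rewrite /C; lra.
- move=> v; rewrite (le_trans (normv_le_sum _))//.
  apply: le_trans (_ : (\sum_i C3 i) * (1 + normv v) <= _).
    by rewrite mulr_suml; apply: ler_sum => i _; rewrite graddE_convol.
  by rewrite ler_wpM2r ?addr_ge0 ?normv_ge0// /C; lra.
- move=> v w; rewrite (le_trans (normv_le_sum _))//.
  apply: le_trans (_ : (\sum_i C4 i) * normv (v - w) * (1 + sqn v + sqn w) <= _).
    rewrite !mulr_suml; apply: ler_sum => i _.
    have E : (graddE eps f v - graddE eps f w) ord0 i =
        convol (dpsi eps i) L v - convol (dpsi eps i) L w.
      exact: (etrans (coordB _ _ i)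
        (congr2 (fun x y => x - y) (graddE_convol v i) (graddE_convol w i))).
    rewrite E; exact: (H4 i v w).
  by rewrite ler_wpM2r// ler_wpM2r ?normv_ge0// /C; lra.
Qed.

Let tphi c (v : 'rV[R]_n) : R := cutoff c v * dE eps f v.
Let tgrad c (v : 'rV[R]_n) : 'rV[R]_n :=
  cutoff c v *: graddE eps f v + dE eps f v *: (cutoff_slope c v *: v).

Lemma test_fun_tphi c : 0 < c -> test_fun (tphi c).
Proof.
move=> c0; have [D _ LD] := lnm_growth eps f eps0 f0 fi fi2 mass.
have -> : tphi c = (fun v => cutoff c v * convol (psi eps) L v).
  by apply/funext => v; rewrite /tphi dE_convol.
exact: (test_fun_cutoff_convol eps c D L eps0 c0 mL LD _ (gker_psi eps)).
Qed.

Lemma grad_tphi c v : grad (tphi c) v = tgrad c v.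
Proof. exact: (hasgradE _ _ (hasgradM _ _ _ _ (hasgrad_cutoff c) hasgrad_dE)). Qed.

(** The constant is independent of [c]. The critical term of the product rule pairs the quadratic
    growth of [dE] with the slope of the cutoff, which is of order [c] on the ball
    [c * sqn v < 1]. *)
Lemma tgrad_bounds : exists2 C, 0 <= C & forall c v w, 0 < c <= 1 ->
  normv (tgrad c v) <= C * (1 + normv v) /\
  normv (tgrad c v - tgrad c w) <= C * normv (v - w) * (1 + sqn v + sqn w).
Proof.
have [C C0 [H1 H2 H3 H4]] := dE_bounds.
have [M M0 HM] := @cutoff_grad_lipschitz R n.
have e0 : 0 < expR 1 :> R := expR_gt0 _.
move: (expR 1) e0 (@cutoff_le R n) (@cutoff_slope_bound R n) (@cutoff_grad_bound R n)
  (@cutoff_lipschitz R n) => e e0 cle cslope cgrad clip.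
(* Large enough for both parts: the linear bound uses [17 * e], the Lipschitz bound [25 * e + M]. *)
exists (C * (34 * e + M)) => [|c v w c01].
  by rewrite mulr_ge0// addr_ge0// mulr_ge0// ltW.
have v0 := normv_ge0 v; have w0 := normv_ge0 w; have z0 := normv_ge0 (v - w).
have sv0 := sqn_ge0 v; have sw0 := sqn_ge0 w.
split.
  rewrite (le_trans (ler_normvD _ _))// !normvZ (ger0_norm (cutoff_ge0 c v)).
  have h1 : cutoff c v * normv (graddE eps f v) <= e * (C * (1 + normv v)).
    by rewrite ler_pM ?cutoff_ge0 ?normv_ge0.
  have h2 : `|dE eps f v| * (`|cutoff_slope c v| * normv v) <= C * (16 * e * (1 + normv v)).
    apply: le_trans (_ : C * (1 + sqn v) * (`|cutoff_slope c v| * normv v) <= _).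
      by rewrite ler_wpM2r// mulr_ge0.
    by rewrite -mulrA (mulrC (1 + sqn v)) ler_wpM2l// cslope.
  apply: le_trans (lerD h1 h2) _.
  have -> : e * (C * (1 + normv v)) + C * (16 * e * (1 + normv v)) =
    C * (17 * e) * (1 + normv v) by ring.
  rewrite ler_wpM2r ?addr_ge0// ler_wpM2l//; lra.
have -> : tgrad c v - tgrad c w =
  cutoff c v *: (graddE eps f v - graddE eps f w) +
  (cutoff c v - cutoff c w) *: graddE eps f w +
  (dE eps f v *: (cutoff_slope c v *: v - cutoff_slope c w *: w) +
   (dE eps f v - dE eps f w) *: (cutoff_slope c w *: w)).
  exact: scaler_telescope.
set z := normv (v - w) in z0 *; set Q := 1 + sqn v + sqn w.
have Q1 : 1 + sqn v <= Q by rewrite /Q; lra.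
have Q2 : 1 + normv w <= 2 * Q.
  by rewrite /Q -(normv_sqr w); have := sqr_ge0 (normv w - 2^-1); nra.
have t1 : normv (cutoff c v *: (graddE eps f v - graddE eps f w)) <= e * (C * z * Q).
  by rewrite normvZ (ger0_norm (cutoff_ge0 c v)) ler_pM ?cutoff_ge0 ?normv_ge0 ?cle.
have t2 : normv ((cutoff c v - cutoff c w) *: graddE eps f w) <= 8 * e * z * (C * (2 * Q)).
  rewrite normvZ ler_pM ?normv_ge0 ?clip//.
  by rewrite (le_trans (H3 w))// ler_wpM2l.
have t3 : normv (dE eps f v *: (cutoff_slope c v *: v - cutoff_slope c w *: w)) <=
    C * Q * (M * z).
  rewrite normvZ ler_pM ?normv_ge0 ?HM//.
  by rewrite (le_trans (H1 v))// ler_wpM2l.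
have t4 : normv ((dE eps f v - dE eps f w) *: (cutoff_slope c w *: w)) <= C * z * Q * (8 * e).
  by rewrite normvZ ler_pM ?normv_ge0 ?cgrad ?H2.
rewrite (le_trans (ler_normvD _ _))// (le_trans (lerD (ler_normvD _ _) (ler_normvD _ _)))//.
rewrite (le_trans (lerD (lerD t1 t2) (lerD t3 t4)))//.
have CzQ : 0 <= C * z * Q by rewrite !mulr_ge0// !addr_ge0.
have -> : e * (C * z * Q) + 8 * e * z * (C * (2 * Q)) + (C * Q * (M * z) + C * z * Q * (8 * e))
  = (25 * e + M) * (C * z * Q) by ring.
have -> : C * (34 * e + M) * z * Q = (34 * e + M) * (C * z * Q) by ring.
by rewrite ler_wpM2r//; lra.
Qed.

End EnergyDerivative.

Section CutoffLimit.
Context {R : realType} {n : nat}.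

Lemma cvg_mulr (u : nat -> R) (a c : R) : u @ \oo --> a -> (fun j => u j * c) @ \oo --> a * c.
Proof. by move=> ua; apply: cvgM => //; exact: cvg_cst. Qed.

Lemma cvg_mull (u : nat -> R) (a c : R) : u @ \oo --> a -> (fun j => c * u j) @ \oo --> c * a.
Proof. by move=> ua; apply: cvgM => //; exact: cvg_cst. Qed.

Definition cseq (j : nat) : R := j.+1%:R^-1.

Lemma cseq_01 j : 0 < cseq j <= 1.
Proof. by rewrite invr_gt0 ltr0n /= invf_le1 ?ltr0n// ler1n. Qed.

Lemma cvg_cseq : cseq j @[j --> \oo] --> (0 : R).
Proof. exact: cvg_harmonic. Qed.

Lemma cvg_bump k (v : 'rV[R]_n) : vbump k (cseq j) v @[j --> \oo] --> flat k 1.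
Proof.
have h : (1 - cseq j * sqn v) @[j --> \oo] --> (1 : R).
  rewrite -[X in _ --> X](subr0 1) -[X in _ --> _ - X](mul0r (sqn v)).
  apply: cvgB; first exact: cvg_cst.
  by apply: cvgMl; exact: cvg_cseq.
exact: (cvg_comp _ _ h (flat_continuous k 1)).
Qed.

Lemma cvg_cutoff (v : 'rV[R]_n) : cutoff (cseq j) v @[j --> \oo] --> (1 : R).
Proof.
have -> : (1 : R) = expR 1 * flat 0 1.
  by rewrite /flat ltr01 expr0 mul1r invr1 -expRD subrr expR0.
by apply: cvgMr; exact: cvg_bump.
Qed.

Lemma cvg_cutoff_slope (v : 'rV[R]_n) : cutoff_slope (cseq j) v @[j --> \oo] --> (0 : R).
Proof.
rewrite -[X in _ --> X](mul0r (expR 1 * flat 2 1)).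
apply: cvgM; last by apply: cvgMr; exact: cvg_bump.
rewrite -[X in _ --> X]oppr0; apply: cvgN.
by rewrite -[X in _ --> X](mulr0 2); apply: cvgMr; exact: cvg_cseq.
Qed.

Lemma cvg_cutoff_combination (u : 'rV[R]_n) (a b c : R) :
  (fun j => cutoff (cseq j) u * a + b * (cutoff_slope (cseq j) u * c)) @ \oo --> a.
Proof.
suff : (fun j => cutoff (cseq j) u * a + b * (cutoff_slope (cseq j) u * c)) @ \oo -->
    1 * a + b * (0 * c) by rewrite mul1r mul0r mulr0 addr0.
apply: cvgD; first exact: (cvg_mulr _ _ _ (cvg_cutoff u)).
exact: (cvg_mull _ _ _ (cvg_mulr _ _ _ (cvg_cutoff_slope u))).
Qed.

End CutoffLimit.

(** * Vanishing of the dissipation *)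

Section CollisionNull.
Context {R : realType} {n : nat}.
Variables (gamma eps : R) (f : rvm R n -> R).
Hypothesis hgamma : -4 <= gamma <= 0.
Hypothesis eps0 : 0 < eps.
Hypothesis f0 : forall v, 0 <= f v.
Hypothesis fi : integ (lebn n) f.
Hypothesis fi2 : integ (lebn n) (fun v => f v * sqn v).
Hypothesis fk : integ (lebn n) (fun v => (1 + normv v `^ kappa gamma) * f v).
Hypothesis mass : 0 < \int[lebn n]_w f w.

Let mf : measurable_fun setT f := integ_meas _ _ fi.
Let L := lnm eps f.
Let mL : measurable_fun setT L := measurable_lnm eps f eps0 f0 fi.

Lemma measurable_convol K : gker eps K -> measurable_fun setT (convol K L : rvm R n -> R).
Proof.
move=> gK.
apply: (measurable_Rintegral_param (lebn n)
  (fun p : rvm R n * rvm R n => K ((p.1 : 'rV[R]_n) - p.2) * L p.2)).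
apply: measurable_funM; last exact: (measurableT_comp mL measurable_snd).
by apply: (measurable_gker eps) => //; apply: mrvB; [exact: measurable_fst|exact: measurable_snd].
Qed.

Lemma measurable_dE : measurable_fun setT (dE eps f : rvm R n -> R).
Proof.
have -> : (dE eps f : 'rV[R]_n -> R) = convol (psi eps) L.
  by apply/funext => v; exact: dE_convol.
exact: (measurable_convol _ (gker_psi eps)).
Qed.

Lemma measurable_graddE : measurable_fun setT (graddE eps f : rvm R n -> rvm R n).
Proof.
apply: measurable_rvP => i.
have -> : (fun v : rvm R n => graddE eps f v ord0 i) = convol (dpsi eps i) L.
  by apply/funext => v; exact: graddE_convol.
exact: (measurable_convol _ (gker_dpsi eps i)).
Qed.

Lemma measurable_bump k c : measurable_fun setT (vbump k c : rvm R n -> R).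
Proof.
apply: (measurableT_comp (measurable_flat k)); apply: measurable_funB => //.
by apply: measurable_funM => //; apply: msqn; exact: measurable_id.
Qed.

Let tgrad c (v : 'rV[R]_n) : 'rV[R]_n :=
  cutoff c v *: graddE eps f v + dE eps f v *: (cutoff_slope c v *: v).

Lemma measurable_tgrad c : measurable_fun setT (tgrad c : rvm R n -> rvm R n).
Proof.
apply: mrvD; apply: mrvZ.
- by apply: measurable_funM => //; exact: measurable_bump.
- exact: measurable_graddE.
- exact: measurable_dE.
- apply: mrvZ; last exact: measurable_id.
  by apply: measurable_funM => //; apply: measurable_funM => //; exact: measurable_bump.
Qed.

(** The integrand of [coll] with a vector field [g] in place of [grad phi]: the truncated gradients
    and their limit [graddE], whose potential has no compact support, are then treated alike. *)
Definition collf (g : 'rV[R]_n -> 'rV[R]_n) (p : rvm R n * rvm R n) : R :=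
  Aform gamma (g p.1 - g p.2) ((p.1 : 'rV[R]_n) - p.2)
    (graddE eps f p.1 - graddE eps f p.2) * f p.1 * f p.2.

Lemma measurable_collf (g : rvm R n -> rvm R n) : measurable_fun setT g ->
  measurable_fun setT (collf g).
Proof.
move=> mg; have m1 := @measurable_fst _ _ (rvm R n) (rvm R n).
have m2 := @measurable_snd _ _ (rvm R n) (rvm R n).
have mB := measurable_graddE.
have mz : measurable_fun setT
    (fun p : rvm R n * rvm R n => (p.1 : 'rV[R]_n) - p.2 : rvm R n) by exact: mrvB.
have mgz : measurable_fun setT
    (fun p : rvm R n * rvm R n => (g p.1 : 'rV[R]_n) - g p.2 : rvm R n).
  by apply: mrvB; [exact: (measurableT_comp mg m1)|exact: (measurableT_comp mg m2)].
have mBz : measurable_fun setT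
    (fun p : rvm R n * rvm R n => graddE eps f p.1 - graddE eps f p.2 : rvm R n).
  by apply: mrvB; [exact: (measurableT_comp mB m1)|exact: (measurableT_comp mB m2)].
apply: measurable_funM; last exact: (measurableT_comp mf m2).
apply: measurable_funM; last exact: (measurableT_comp mf m1).
under eq_fun do rewrite AformE.
apply: measurable_funM.
  by apply: (measurableT_comp (measurable_powR gamma)); exact: mnormv.
apply: measurable_funB; apply: measurable_funM; by [exact: msqn|exact: mdotv].
Qed.

Lemma collf_dom (g : 'rV[R]_n -> 'rV[R]_n) C : 0 <= C ->
  (forall v, normv (g v) <= C * (1 + normv v)) ->
  (forall v w, normv (g v - g w) <= C * normv (v - w) * (1 + sqn v + sqn w)) ->
  (forall v, normv (graddE eps f v) <= C * (1 + normv v)) ->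
  (forall v w, normv (graddE eps f v - graddE eps f w) <=
     C * normv (v - w) * (1 + sqn v + sqn w)) ->
  forall p, `|collf g p| <=
    2 * (2 * C) ^+ 2 * (2 `^ kappa gamma * 2 `^ kappa gamma) *
    (((1 + normv p.1 `^ kappa gamma) * f p.1) * ((1 + normv p.2 `^ kappa gamma) * f p.2)).
Proof.
move=> C0 g1 g2 b1 b2 [v w] /=; rewrite /collf /=.
have v0 := normv_ge0 v; have w0 := normv_ge0 w.
have k0 : 0 <= kappa gamma by rewrite (le_trans _ (kappa_ge2 gamma hgamma)).
have lin (h : 'rV[R]_n -> 'rV[R]_n) : (forall v, normv (h v) <= C * (1 + normv v)) ->
    normv (h v - h w) <= 2 * C * (1 + normv v + normv w).
  move=> H; rewrite (le_trans (ler_normvB _ _))// (le_trans (lerD (H v) (H w)))//.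
  move: (normv v) (normv w) v0 w0 => x y x0 y0.
  have -> : C * (1 + x) + C * (1 + y) = C * (2 + x + y) by ring.
  have -> : 2 * C * (1 + x + y) = C * (2 * (1 + x + y)) by ring.
  by rewrite ler_wpM2l//; lra.
have quad (h : 'rV[R]_n -> 'rV[R]_n) :
    normv (h v - h w) <= C * normv (v - w) * (1 + sqn v + sqn w) ->
    normv (h v - h w) <= 2 * C * normv (v - w) * (1 + normv v + normv w) ^+ 2.
  move/le_trans; apply; rewrite -!normv_sqr.
  have z0 := normv_ge0 (v - w); move: (normv v) (normv w) v0 w0 => x y x0 y0.
  apply: le_trans (_ : C * normv (v - w) * (1 + x + y) ^+ 2 <= _).
    by rewrite ler_wpM2l ?mulr_ge0//; have := mulr_ge0 x0 y0; nra.
  by rewrite ler_wpM2r ?sqr_ge0// ler_wpM2r// ler_peMl// ler1n.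
have h := collision_bound gamma (2 * C) (g v - g w) (graddE eps f v - graddE eps f w) v w
  hgamma (mulr_ge0 (ler0n _ 2) C0) (lin g g1) (lin _ b1) (quad g (g2 v w)) (quad _ (b2 v w)).
have ff0 : 0 <= f v * f w by rewrite mulr_ge0.
rewrite -mulrA normrM (ger0_norm ff0).
apply: le_trans (ler_wpM2r ff0 (le_trans h (ler_wpM2l _ (weight_bound _ v w k0)))) _.
  by rewrite mulr_ge0// sqr_ge0.
by rewrite le_eqVlt; apply/orP; left; apply/eqP; ring.
Qed.

Lemma collf_integ (g : 'rV[R]_n -> 'rV[R]_n) C : 0 <= C ->
  measurable_fun setT (g : rvm R n -> rvm R n) ->
  (forall v, normv (g v) <= C * (1 + normv v)) ->
  (forall v w, normv (g v - g w) <= C * normv (v - w) * (1 + sqn v + sqn w)) ->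
  (forall v, normv (graddE eps f v) <= C * (1 + normv v)) ->
  (forall v w, normv (graddE eps f v - graddE eps f w) <=
     C * normv (v - w) * (1 + sqn v + sqn w)) ->
  integ (pleb n) (collf g).
Proof.
move=> C0 mg g1 g2 b1 b2.
apply: (integ_le _ _ _ (measurable_collf g mg) (collf_dom g C C0 g1 g2 b1 b2)).
exact: (integZ _ _ _ (integ_prod _ _ _ fk fk)).
Qed.

(* Test with [cutoff c * dE] and let [c] tend to 0; the bounds on the cutoff are
   uniform enough for dominated convergence. *)
Lemma collf_grad_eq0 :
  (forall phi : 'rV[R]_n -> R, test_fun phi -> coll gamma eps f phi = 0%E) ->
  {ae pleb n, forall p, collf (graddE eps f) p = 0}.
Proof.
move=> hcoll.
have [C1 C10 H1] := tgrad_bounds eps f eps0 f0 fi fi2 mass.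
have [C2 C20 [_ _ H2 H3]] := dE_bounds eps f eps0 f0 fi fi2 mass.
have CC : 0 <= C1 + C2 by rewrite addr_ge0.
have Q0 (v w : 'rV[R]_n) : 0 <= normv (v - w) * (1 + sqn v + sqn w).
  by rewrite mulr_ge0 ?normv_ge0// !addr_ge0// sqn_ge0.
have b1 v : normv (graddE eps f v) <= (C1 + C2) * (1 + normv v).
  by rewrite (le_trans (H2 v))// ler_wpM2r ?addr_ge0 ?normv_ge0// lerDr.
have b2 v w : normv (graddE eps f v - graddE eps f w) <=
    (C1 + C2) * normv (v - w) * (1 + sqn v + sqn w).
  by rewrite (le_trans (H3 v w))// -!mulrA ler_wpM2r// lerDr.
have g1 j v : normv (tgrad (cseq j) v) <= (C1 + C2) * (1 + normv v).
  have [h _] := H1 _ v v (cseq_01 j).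
  by rewrite (le_trans h)// ler_wpM2r ?addr_ge0 ?normv_ge0// lerDl.
have g2 j v w : normv (tgrad (cseq j) v - tgrad (cseq j) w) <=
    (C1 + C2) * normv (v - w) * (1 + sqn v + sqn w).
  have [_ h] := H1 _ v w (cseq_01 j).
  by rewrite (le_trans h)// -!mulrA ler_wpM2r// lerDl.
have iI j : integ (pleb n) (collf (tgrad (cseq j))).
  by apply: (collf_integ _ _ CC (measurable_tgrad _) (g1 j) (g2 j) b1 b2).
have I0 j : \int[pleb n]_p collf (tgrad (cseq j)) p = 0.
  have c0 : (0 : R) < cseq j by rewrite invr_gt0 ltr0n.
  have := hcoll _ (test_fun_tphi eps f eps0 f0 fi fi2 mass _ c0).
  rewrite /coll; under [X in iint n X]eq_fun => v do
    (under [X in iint n X]eq_fun => w do rewrite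
      !(grad_tphi eps f eps0 f0 fi fi2 mass (cseq j)) /Beps).
  by rewrite (iint2E n (collf (tgrad (cseq j))) (iI j)) => -[].
pose G (p : rvm R n * rvm R n) := 2 * (2 * (C1 + C2)) ^+ 2 *
  (2 `^ kappa gamma * 2 `^ kappa gamma) *
  (((1 + normv p.1 `^ kappa gamma) * f p.1) * ((1 + normv p.2 `^ kappa gamma) * f p.2)).
have iG : integ (pleb n) G by exact: (integZ _ _ _ (integ_prod _ _ _ fk fk)).
have cv p : collf (tgrad (cseq j)) p @[j --> \oo] --> collf (graddE eps f) p.
  case: p => v w; rewrite /collf /=.
  apply: cvg_mulr; apply: cvg_mulr.
  under eq_fun do rewrite AformE; rewrite AformE.
  have cd u b : dotv (tgrad (cseq j) u) b @[j --> \oo] --> dotv (graddE eps f u) b.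
    under eq_fun do rewrite /tgrad dotvDl !dotvZl.
    exact: cvg_cutoff_combination.
  have cdB b : dotv (tgrad (cseq j) v - tgrad (cseq j) w) b @[j --> \oo] -->
      dotv (graddE eps f v - graddE eps f w) b.
    by under eq_fun do rewrite dotvBl; rewrite dotvBl; apply: cvgB; exact: cd.
  apply: cvg_mull.
  exact: (cvgB (cvg_mull _ _ _ (cdB _)) (cvg_mulr _ _ _ (cdB _))).
have [i1 c1] := dct (pleb n) (fun j => collf (tgrad (cseq j))) _ G
  (fun j => measurable_collf _ (measurable_tgrad _)) iG
  (fun j => collf_dom _ _ CC (g1 j) (g2 j) b1 b2) cv.
(* The limit integrand is twice that of [dissip], hence nonnegative, and its integral is a limit of
   zeros. *)
apply: Rintegral_eq0 => //.
  by move=> [v w]; rewrite /collf /= -mulrA mulr_ge0 ?Aform_ge0// mulr_ge0.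
have c2 : (\int[pleb n]_p collf (tgrad (cseq j)) p) @[j --> \oo] --> (0 : R).
  by under eq_fun do rewrite I0; exact: cvg_cst.
exact: (cvg_unique _ c1 c2).
Qed.

End CollisionNull.

(** * Entire functions along lines *)

Section Entire.
Context {R : realType}.

Lemma ler_expr_fact_expR (x : R) m : 0 <= x -> x ^+ m <= m`!%:R * expR x.
Proof.
move=> x0; case: m => [|m].
  by rewrite expr0 fact0 mul1r (le_trans _ (expR_ge1Dx x))// lerDl.
have /(le_trans _) h := expR_ge1Dxn m x0.
have {h} : x ^+ m.+1 / m.+1`!%:R <= expR x by apply: h; rewrite lerDr.
by rewrite ler_pdivrMr ?ltr0n ?fact_gt0// mulrC.
Qed.

(* The bounds [m`! * rho ^- m] for every [rho] say that the Taylor series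
   converges everywhere, uniformly on bounded sets. *)
Definition entire (u : R -> R) := exists us : nat -> R -> R,
  [/\ us 0%N = u, forall m (x : R), is_derive x (1 : R) (us m) (us m.+1 x) &
   forall K rho : R, 0 < K -> 0 < rho -> exists2 C, 0 <= C &
     forall m x, `|x| <= K -> `|us m x| <= C * m`!%:R * rho ^- m].

Lemma entire_cst c : entire (fun=> c).
Proof.
exists (fun m x => if m is 0 then c else 0); split => //.
  by case=> [|m] x; exact: is_derive_cst.
move=> K rho K0 rho0; exists `|c| => // -[|m] x _.
  by rewrite fact0 expr0 invr1 !mulr1.
by rewrite normr0 !mulr_ge0// invr_ge0 exprn_ge0// ltW.
Qed.

Lemma entireD u w : entire u -> entire w -> entire (fun x => u x + w x).
Proof.
move=> [us [<- du bu]] [ws [<- dw bw]]; exists (fun m x => us m x + ws m x); split => //.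
  by move=> m x; exact: (is_deriveD (du m x) (dw m x)).
move=> K rho K0 rho0; have [C C0 HC] := bu K rho K0 rho0; have [D D0 HD] := bw K rho K0 rho0.
exists (C + D) => [|m x xK]; first exact: addr_ge0.
by rewrite !mulrDl (le_trans (ler_normD _ _))// lerD// ?HC ?HD.
Qed.

Lemma entireZ c u : entire u -> entire (fun x => c * u x).
Proof.
move=> [us [<- du bu]]; exists (fun m x => c * us m x); split => //.
  move=> m x; apply: is_derive_eq (is_deriveM (is_derive_cst _ _ _) (du m x)) _.
  by rewrite scaler0 addr0.
move=> K rho K0 rho0; have [C C0 HC] := bu K rho K0 rho0.
exists (`|c| * C) => [|m x xK]; first exact: mulr_ge0.
by rewrite normrM -!mulrA ler_wpM2l// mulrA HC.
Qed.

Lemma entire_mulx u : entire u -> entire (fun x => x * u x).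
Proof.
(* Leibniz' rule. At [m = 0] the predecessor [m.-1] is again 0, and the coefficient [m%:R] removes
   that spurious term. *)
move=> [us [<- du bu]]; exists (fun m x => x * us m x + m%:R * us m.-1 x); split.
- by apply/funext => x; rewrite mul0r addr0.
- move=> [|m] x /=.
    under eq_fun do rewrite mul0r addr0.
    apply: is_derive_eq (is_deriveM (is_derive_id _ _) (du 0%N x)) _.
    by rewrite /GRing.scale /= mulr1 mul1r.
  have h1 := is_deriveM (is_derive_id x (1 : R)) (du m.+1 x).
  have h2 := is_deriveM (is_derive_cst (m.+1%:R : R) x (1 : R)) (du m x).
  apply: is_derive_eq (is_deriveD h1 h2) _.
  by rewrite /GRing.scale /= [m.+2%:R]mulrSr; ring.
move=> K rho K0 rho0; have [C C0 HC] := bu K rho K0 rho0.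
exists (C * (K + rho)) => [|m x xK]; first by rewrite mulr_ge0// addr_ge0// ltW.
have h1 : `|x * us m x| <= K * (C * m`!%:R * rho ^- m).
  by rewrite normrM ler_pM//; exact: HC.
have h2 : `|m%:R * us m.-1 x| <= rho * (C * m`!%:R * rho ^- m).
  case: m {h1} => [|m] /=.
    by rewrite mul0r normr0 !mulr_ge0// ?invr_ge0 ?exprn_ge0// ltW.
  rewrite normrM normr_nat (le_trans (ler_wpM2l _ (HC m x xK)))//.
  rewrite factS natrM exprS invfM le_eqVlt; apply/orP; left; apply/eqP.
  by field; rewrite ?expf_neq0// gt_eqF.
rewrite (le_trans (ler_normD _ _))// (le_trans (lerD h1 h2))// le_eqVlt.
by apply/orP; left; apply/eqP; ring.
Qed.

(** No order between [a] and [b] is imposed. The bound keeps [xi] at least as close to [a] as [b]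
    is; both the Taylor estimate and the accumulation of zeros of the derivatives rely on it. *)
Lemma rolle_ne (g dg : R -> R) (a b : R) : a != b ->
  (forall x : R, is_derive x (1 : R) g (dg x)) -> g a = g b ->
  exists xi, [/\ dg xi = 0, xi != a & `|xi - a| <= `|b - a|].
Proof.
move=> ab dG gab.
have cont c d : {within `[c, d], continuous g}.
  by apply: derivable_within_continuous => x _; exact: (@ex_derive _ _ _ _ _ _ _ (dG x)).
have der (c d x : R) : x \in `]c, d[%R -> derivable g x 1.
  by move=> _; exact: (@ex_derive _ _ _ _ _ _ _ (dG x)).
have E (xi : R) : is_derive xi (1 : R) g 0 -> dg xi = 0.
  by move=> h; rewrite -(@derive_val _ _ _ _ _ _ _ (dG xi)) (@derive_val _ _ _ _ _ _ _ h).
case: (ltgtP a b) ab => // l _.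
  have [xi + /E dx] := Rolle l (@der a b) (cont a b) gab.
  rewrite in_itv /= => /andP[h1 h2]; exists xi; rewrite gt_eqF//; split=> //.
  by rewrite !gtr0_norm ?subr_gt0//; lra.
have [xi + /E dx] := Rolle l (@der b a) (cont b a) (esym gab).
rewrite in_itv /= => /andP[h1 h2]; exists xi; rewrite lt_eqF//; split=> //.
by rewrite !ltr0_norm ?subr_lt0//; lra.
Qed.

(** Taylor remainder at a point where all derivatives vanish, by going down from order [N]. Rolle's
    theorem for [g] is Cauchy's mean value theorem: it compares [us j] with the power [m.+1] of the
    distance to [p], and produces [us j.+1] and the power [m]. *)
Lemma entire_taylor (u : R -> R) (us : nat -> R -> R) (p r S : R) N :
  (forall m (x : R), is_derive x (1 : R) (us m) (us m.+1 x)) -> us 0%N = u ->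
  (forall m, us m p = 0) -> (forall x, `|x - p| <= r -> `|us N x| <= S) ->
  forall x, `|x - p| <= r -> `|u x| <= S * `|x - p| ^+ N / N`!%:R.
Proof.
move=> du <- up bS.
suff H m : (m <= N)%N -> forall x, `|x - p| <= r ->
    `|us (N - m)%N x| <= S * `|x - p| ^+ m / m`!%:R.
  by move=> x xr; have := H N (leqnn _) x xr; rewrite subnn.
elim: m => [_ x xr|m IH mN x xr].
  by rewrite subn0 fact0 expr0 divr1 mulr1; exact: bS.
have S0 : 0 <= S by apply: le_trans (bS x xr).
have [->|xp] := eqVneq x p.
  by rewrite up normr0 subrr normr0 exprS mul0r mulr0 mul0r.
have {}IH := IH (ltnW mN); set j := (N - m.+1)%N.
have jE : (N - m)%N = j.+1 by rewrite /j subnSK.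
rewrite jE in IH.
pose g y := (x - p) ^+ m.+1 * us j y + (- us j x) * (y - p) ^+ m.+1.
pose dg y := (x - p) ^+ m.+1 * us j.+1 y + (- us j x) * (m.+1%:R * (y - p) ^+ m).
have dG (y : R) : is_derive y (1 : R) g (dg y).
  have h1 := is_deriveM (is_derive_cst ((x - p) ^+ m.+1 : R) y (1 : R)) (du j y).
  have h0 := is_deriveB (is_derive_id y (1 : R)) (is_derive_cst p y (1 : R)).
  have h2 := is_deriveM (is_derive_cst (- us j x : R) y (1 : R)) (is_deriveX m.+1 h0).
  rewrite exprfctE in h2.
  apply: is_derive_eq (is_deriveD h1 h2) _.
  by rewrite /dg /GRing.scale /= !mulr0 !addr0 subr0 mulr1 [RHS]addrC -mulr_natl addrC.
have gxp : g p = g x by rewrite /g subrr expr0n up /=; ring.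
have px : p != x by rewrite eq_sym.
have [xi [xi0 xip xir]] := rolle_ne g dg p x px dG gxp.
have IHx := IH xi (le_trans xir xr).
have np : 0 < `|xi - p| ^+ m by rewrite exprn_gt0// normr_gt0 subr_eq0.
have E : `|us j x| * (m.+1%:R * `|xi - p| ^+ m) = `|x - p| ^+ m.+1 * `|us j.+1 xi|.
  move: xi0; rewrite /dg mulNr => /eqP; rewrite subr_eq0 => /eqP /(congr1 Num.norm).
  by rewrite !normrM !normrX normr_nat.
have m0 : 0 < (m.+1)%:R :> R by rewrite ltr0n.
rewrite -(ler_pM2r (mulr_gt0 m0 np)) E.
apply: le_trans (ler_wpM2l _ IHx) _; first by rewrite exprn_ge0.
rewrite factS natrM le_eqVlt; apply/orP; left; apply/eqP; field.
by rewrite pnatr_eq0 -lt0n fact_gt0 gt_eqF.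
Qed.

(** A set of positive measure is uncountable, so its part in some bounded interval is infinite and
    has a limit point [p]. By Rolle's theorem the zeros of each derivative accumulate at [p] too;
    all derivatives vanish there and the Taylor remainder tends to 0. *)
Lemma entire_identity u : entire u -> (0 < lebesgue_measure [set x | u x = 0%R])%E ->
  forall x, u x = 0.
Proof.
move=> [us [u0 du bu]] Z0; set Z := [set x | _] in Z0.
have [m Zm] : exists m : nat, infinite_set (Z `&` [set x | `|x| <= m%:R]).
  apply: contrapT => /forallNP Zf.
  have : countable Z.
    have -> : Z = \bigcup_(m in setT) (Z `&` [set x | `|x| <= m%:R]).
      apply/seteqP; split => [x Zx|x [m _ []]//].
      by exists (Num.bound `|x|) => //; split => //=; exact: ltW (archi_boundP (normr_ge0 x)).
    by apply: bigcup_countable => // m _; apply: finite_set_countable; exact: contrapT (Zf m).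
  by move/countable_lebesgue_measure0 => e; rewrite e ltxx in Z0.
have [p lp] : limit_point (Z `&` [set x | `|x| <= m%:R]) !=set0.
  apply: infinite_bounded_limit_point_nonempty => //.
  exists m%:R; split; first exact: num_real.
  by move=> M mM x [_ /= xm]; rewrite (le_trans xm)// ltW.
have cz j : (forall e : R, 0 < e -> exists x, [/\ x != p, `|x - p| < e & us j x = 0]) ->
    us j p = 0.
  move=> h; apply: contrapT => /eqP ujp.
  have cu : {for p, continuous (us j)}.
    apply: differentiable_continuous; apply/derivable1_diffP.
    exact: (@ex_derive _ _ _ _ _ _ _ (du j p)).
  have n0 : 0 < `|us j p| by rewrite normr_gt0.
  have /cvgrPdist_lt /(_ _ n0) /nbhs_ballP [e /= e0 he] := cu.
  have [x [xp xe ux]] := h e e0.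
  by have := he x; rewrite /ball /= distrC ux subr0 ltxx => /(_ xe).
have acc k : forall e : R, 0 < e -> exists x, [/\ x != p, `|x - p| < e & us k x = 0].
  elim: k => [e e0|k IH e e0].
    have [x [xp [Zx _] xe]] := lp _ (nbhsx_ballx p e e0).
    by exists x; split => //; [rewrite distrC|rewrite u0].
  have up := cz k IH; have [x [xp xe ux]] := IH e e0.
  have px : p != x by rewrite eq_sym.
  have [xi [xi0 xip xir]] := rolle_ne (us k) (us k.+1) p x px (du k) (etrans up (esym ux)).
  by exists xi; split => //; exact: le_lt_trans xe.
have up k : us k p = 0 by exact: cz (acc k).
move=> x; set r := `|x - p|; have r0 : 0 <= r by exact: normr_ge0.
have K0 : 0 < `|p| + r + 1 by rewrite ltr_wpDl// addr_ge0.
(* With this radius the remainder of order [N] is at most [C] times the [N]-th power of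
   [r / (2 * (r + 1))], which is below one half. *)
have rho0 : 0 < 2 * (r + 1) by rewrite mulr_gt0// ltr_wpDl.
have [C C0 HC] := bu _ _ K0 rho0.
have B N : `|u x| <= C * 2^-1 ^+ N.
  have bS y : `|y - p| <= r -> `|us N y| <= C * N`!%:R * (2 * (r + 1)) ^- N.
    move=> yr; apply: HC; rewrite -[y](subrK p) (le_trans (ler_normD _ _))//; lra.
  apply: le_trans (entire_taylor u us p r _ N du u0 up bS x (lexx _)) _.
  rewrite -/r; have -> : C * N`!%:R * (2 * (r + 1)) ^- N * r ^+ N / N`!%:R =
      C * ((2 * (r + 1)) ^- N * r ^+ N).
    by field; rewrite pnatr_eq0 -lt0n fact_gt0/= expf_neq0// gt_eqF.
  rewrite ler_wpM2l// -exprVn -exprMn lerXn2r ?nnegrE ?invr_ge0 ?mulr_ge0 ?invr_ge0 ?(ltW rho0)//.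
  rewrite mulrC ler_pdivrMr// mulrA mulVf// mul1r lerDl//.
apply: contrapT => /eqP; rewrite -normr_gt0 => n0.
have h : (C * 2^-1 ^+ N) @[N --> \oo] --> (0 : R).
  by apply: cvg_geometric; rewrite ger0_norm ?invr_ge0// invf_lt1// ltr1n.
have /cvgrPdist_lt /(_ _ n0) [N _ /(_ N (leqnn N))] := h.
rewrite /= sub0r normrN ger0_norm ?mulr_ge0 ?exprn_ge0 ?invr_ge0//.
by rewrite ltNge B.
Qed.

End Entire.

(** * Laplace transforms are entire *)

Section LaplaceEntire.
Context {R : realType} {d} {T : measurableType d}.
Variables (mu : {measure set T -> \bar R}) (h Y : T -> R).
Hypothesis mh : measurable_fun setT h.
Hypothesis mY : measurable_fun setT Y.
Hypothesis hY : forall b, integ mu (fun x => `|h x| * expR (b * `|Y x|)).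

Lemma measurable_laplace m s : measurable_fun setT (fun x => h x * Y x ^+ m * expR (s * Y x)).
Proof.
apply: measurable_funM; first by apply: measurable_funM => //; exact: measurable_funX.
by apply: mexpR; apply: measurable_funM.
Qed.

(** One term of the exponential series gives [|Y|^m <= m! rho^-m expR (rho |Y|)]. The factor
    [m! rho^-m] is the one in the definition of [entire], and the same bound dominates the
    differentiation under the integral. *)
Lemma laplace_bound m s K rho x : `|s| <= K -> 0 < rho ->
  `|h x * Y x ^+ m * expR (s * Y x)| <=
  m`!%:R * rho ^- m * (`|h x| * expR ((K + rho) * `|Y x|)).
Proof.
move=> sK rho0; rewrite !normrM normrX (ger0_norm (expR_ge0 _)).
have y0 := normr_ge0 (Y x).
have h1 := ler_expr_fact_expR (rho * `|Y x|) m (mulr_ge0 (ltW rho0) y0).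
have h2 : expR (s * Y x) <= expR (K * `|Y x|).
  by rewrite ler_expR (le_trans (ler_norm _))// normrM ler_wpM2r.
have h3 : `|Y x| ^+ m <= m`!%:R * rho ^- m * expR (rho * `|Y x|).
  rewrite mulrAC ler_pdivlMr ?exprn_gt0// mulrC -exprMn; exact: h1.
rewrite mulrDl (addrC (K * _)) expRD -mulrA [leRHS]mulrCA ler_wpM2l// mulrA.
by rewrite ler_pM// ?exprn_ge0 ?expR_ge0.
Qed.

Lemma laplace_integ m s : integ mu (fun x => h x * Y x ^+ m * expR (s * Y x)).
Proof.
apply: (integ_le _ _ _ (measurable_laplace m s)
  (fun x => laplace_bound m s `|s| 1 x (lexx _) ltr01)).
by apply: integZ; exact: hY.
Qed.

Lemma is_derive_laplace m (a : R) : is_derive a (1 : R)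
  (fun s => \int[mu]_x (h x * Y x ^+ m * expR (s * Y x)))
  (\int[mu]_x (h x * Y x ^+ m.+1 * expR (a * Y x))).
Proof.
apply: (derive_under mu (fun s x => h x * Y x ^+ m * expR (s * Y x))
  (fun s x => h x * Y x ^+ m.+1 * expR (s * Y x)) a 1
  (fun x => m.+1`!%:R * 1 ^- m.+1 * (`|h x| * expR ((`|a| + 1 + 1) * `|Y x|)))) => //.
- by move=> x _; exact: laplace_integ.
- move=> s x _; have h0 := is_deriveM (is_derive_id s (1 : R)) (is_derive_cst (Y x) s (1 : R)).
  have h1 := @is_derive1_comp R expR _ s _ _ (is_derive_expR (s * Y x)) h0.
  apply: is_derive_eq (is_deriveM (is_derive_cst (h x * Y x ^+ m : R) s (1 : R)) h1) _.
  by rewrite /GRing.scale /= exprS; ring.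
- by apply: integZ; exact: hY.
move=> s x sa; apply: laplace_bound => //.
by rewrite -[s](subrK a) (le_trans (ler_normD _ _))// addrC lerD2l ltW.
Qed.

Lemma laplace_entire : entire (fun s => \int[mu]_x (h x * expR (s * Y x))).
Proof.
exists (fun m s => \int[mu]_x (h x * Y x ^+ m * expR (s * Y x))); split.
- by apply/funext => s; apply: eq_Rintegral => x _; rewrite expr0 mulr1.
- exact: is_derive_laplace.
move=> K rho K0 rho0; exists (\int[mu]_x (`|h x| * expR ((K + rho) * `|Y x|))).
  by apply: Rintegral_ge0 => x _; rewrite mulr_ge0// expR_ge0.
move=> m s sK; have b x := laplace_bound m s K rho x sK rho0.
apply: le_trans (norm_Rintegral_le mu _ _ (measurable_laplace m s) (integZ _ _ _ (hY _)) b) _.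
by rewrite RintegralZl//= mulrC mulrA.
Qed.

End LaplaceEntire.

Section EntireVector.
Context {R : realType}.

(** Entire on every line parallel to an axis, the form suited to an induction on the dimension. *)
Definition lentire {n} (u : 'rV[R]_n -> R) :=
  forall v k, entire (fun s => u (v + s *: unitv k)).

(** By Tonelli, the slices of the zero set have positive measure for a set of first coordinates of
    positive measure; by induction [u] vanishes on all these slices, and then on every line in the
    first direction. In dimension 0 the space is one point. *)
Lemma lentire_identity n (u : rvm R n -> R) : measurable_fun setT u -> lentire u ->
  (0 < lebn n [set v | u v = 0%R])%E -> forall v, u v = 0.
Proof.
elim: n u => [|n IH] u mu eu Z0 v.
  apply: contrapT => uv; suff e : [set v | u v = 0] = set0 by rewrite e measure0 ltxx in Z0.
  by apply/seteqP; split => // w; rewrite /= (_ : w = v)//; apply/rowP => -[].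
have mZ : measurable ([set v | u v = 0] : set (rvm R n.+1)).
  by rewrite -[X in measurable X]setTI; exact: (mu measurableT [set 0] (measurable_set1 _)).
have mS x : measurable ([set w | u (vcons x w) = 0] : set (rvm R n)).
  rewrite -[X in measurable X]setTI.
  have mc : measurable_fun setT (fun w : rvm R n => u (vcons x w)).
    by apply: (measurableT_comp mu); apply: measurable_vcons_comp => //; exact: measurable_id.
  exact: (mc measurableT [set 0] (measurable_set1 _)).
have E : lebn n.+1 [set v | u v = 0] =
    (\int[lebesgue_measure]_x lebn n [set w | u (vcons x w) = 0%R])%E.
  rewrite -[X in lebn _ X]setIT -integral_indic// ge0_integral_lebS//.
  - by apply: eq_integral => x _; rewrite -[X in lebn _ X]setIT -integral_indic.
  - by apply/measurable_EFinP; exact: measurable_indic.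
rewrite E in Z0.
pose phi (x : measurableTypeR R) := lebn n [set w | u (vcons x w) = 0%R].
have mX : measurable_fun setT phi.
  have mu2 : measurable_fun setT (fun p : measurableTypeR R * rvm R n => u (vcons p.1 p.2)).
    exact: (measurableT_comp mu (measurable_vcons n)).
  have mA := mu2 measurableT [set 0] (measurable_set1 _); rewrite setTI in mA.
  have := measurable_fun_xsection (lebn n) mA; congr measurable_fun.
  by apply/funext => x; congr (lebn n _); apply/seteqP; split => w; rewrite /xsection /= inE.
have mX0 : measurable [set x | (0 < phi x)%E].
  rewrite (_ : mkset _ = setT `&` phi @^-1` `]0%E, +oo[%classic); last first.
    apply/seteqP; split => x /=; rewrite in_itv/= andbT; first by [].
    by case.
  exact: (mX measurableT _ (emeasurable_itv _)).
have X0 : (0 < @lebesgue_measure R [set x | (0 < phi x)%E])%E.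
  rewrite lt_neqAle measure_ge0 andbT; apply/negP => /eqP e.
  suff : ae_eq lebesgue_measure setT phi (cst 0%E).
    move=> /(ae_eq_integral_abs lebesgue_measure measurableT mX).
    under eq_integral do rewrite gee0_abs//.
    by move=> e0; rewrite e0 ltxx in Z0.
  exists [set x | (0 < phi x)%E]; split => // x /= /not_implyP[_ h].
  by rewrite lt_neqAle measure_ge0 andbT eq_sym; apply/eqP.
have line w : forall x, u (vcons x w) = 0.
  apply: (entire_identity (fun x => u (vcons x w))).
    have := eu (vcons 0 w) ord0; congr entire; apply/funext => s; congr u.
    apply/rowP => i; case: (unliftP ord0 i) => [j ->|->].
      by rewrite !mxE liftK mulr0 addr0.
    by rewrite !mxE unlift_none eqxx mulr1 add0r.
  apply: lt_le_trans X0 _; apply: le_measure; rewrite ?inE//.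
    have mc : measurable_fun setT (fun x : measurableTypeR R => u (vcons x w)).
      by apply: (measurableT_comp mu); apply: measurable_vcons_comp => //; exact: measurable_cst.
    by rewrite -[X in measurable X]setTI; exact: (mc measurableT [set 0] (measurable_set1 _)).
  move=> x /= /(IH (fun w => u (vcons x w))) H; apply: H.
    by apply: (measurableT_comp mu); apply: measurable_vcons_comp => //; exact: measurable_id.
  move=> w' k; have := eu (vcons x w') (lift ord0 k); congr entire; apply/funext => s; congr u.
  apply/rowP => i; case: (unliftP ord0 i) => [j ->|->].
    by rewrite !mxE liftK !mxE (inj_eq lift_inj).
  by rewrite !mxE unlift_none eq_sym (negbTE (neq_lift _ _)) mulr0 addr0.
by rewrite (vconsE _ v) line.
Qed.

End EntireVector.

Section GaussianDomination.
Context {R : realType} {n : nat}.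

(** The variance doubles three times: once for each factor [1 + sqn w], and once for the
    exponential, by completing the square. *)
Lemma poly_exp_gk (eps B : R) : 0 < eps -> exists2 C, 0 <= C & forall w : 'rV[R]_n,
  (1 + sqn w) ^+ 2 * gk eps w * expR (B * normv w) <= C * gk (8 * eps) w.
Proof.
move=> e0; exists ((1 + 4 * eps) * (1 + 4 * (2 * eps)) * expR (4 * eps * B ^+ 2)).
  by rewrite !mulr_ge0 ?expR_ge0// !addr_ge0 ?mulr_ge0// ltW.
move=> w; have s0 := sqn_ge0 w.
have h1 : (1 + sqn w) ^+ 2 * gk eps w <= (1 + 4 * eps) * (1 + 4 * (2 * eps)) * gk (4 * eps) w.
  rewrite expr2 -mulrA.
  have g1 := gk_growth eps w e0; have g2 := gk_growth (2 * eps) w (mulr_gt0 (ltr0n _ 2) e0).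
  apply: le_trans (ler_wpM2l _ g1) _; first by rewrite addr_ge0.
  rewrite mulrCA -mulrA ler_wpM2l ?addr_ge0 ?mulr_ge0 ?(ltW e0)//.
  by rewrite (_ : 4 * eps = 2 * (2 * eps))//; ring.
have h2 : gk (4 * eps) w * expR (B * normv w) <= expR (4 * eps * B ^+ 2) * gk (8 * eps) w.
  rewrite /gk -!expRD ler_expR -normv_sqr; move: (normv w) => x.
  have : 0 <= (x - 8 * eps * B) ^+ 2 / (16 * eps) by rewrite divr_ge0 ?sqr_ge0// mulr_ge0// ltW.
  have -> : (x - 8 * eps * B) ^+ 2 / (16 * eps) =
    (4 * eps * B ^+ 2 + - x ^+ 2 / (2 * (8 * eps))) - (- x ^+ 2 / (2 * (4 * eps)) + B * x).
    by field; rewrite gt_eqF.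
  by rewrite subr_ge0.
apply: le_trans (ler_wpM2r (expR_ge0 _) h1) _; rewrite -[leLHS]mulrA -[leRHS]mulrA.
by rewrite ler_wpM2l// mulr_ge0// addr_ge0// !mulr_ge0// ltW.
Qed.

Lemma gk_integ (a : R) : 0 < a -> integ (lebn n) (gk a : rvm R n -> R).
Proof.
move=> a0; have := gauss_integ n a 0 a0; congr (_.-integrable _ _).
by apply/funext => w /=; rewrite /gk sub0r sqnN.
Qed.

End GaussianDomination.

(** * Gaussian convolutions are entire up to a Gaussian factor *)

Section GaussianEntire.
Context {R : realType} {n : nat}.
Variable eps : R.
Hypothesis eps0 : 0 < eps.
Implicit Types (u : 'rV[R]_n -> R) (v w : 'rV[R]_n).

(* The Gaussian factor turns a convolution with [gk eps] into a Laplace transform. *)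
Definition gentire u := lentire (fun v => expR (sqn v / (2 * eps)) * u v).

Lemma gentireD u1 u2 : gentire u1 -> gentire u2 -> gentire (fun v => u1 v + u2 v).
Proof.
by move=> h1 h2 v k; have := entireD _ _ (h1 v k) (h2 v k); congr entire;
  apply/funext => s; rewrite mulrDr.
Qed.

Lemma gentireZ c u : gentire u -> gentire (fun v => c * u v).
Proof.
by move=> h v k; have := entireZ c _ (h v k); congr entire; apply/funext => s; rewrite mulrCA.
Qed.

Lemma gentire_coord i u : gentire u -> gentire (fun v => v ord0 i * u v).
Proof.
move=> h v k; have h1 := entireZ (v ord0 i) _ (h v k).
have h2 := entireZ (unitv k ord0 i) _ (entire_mulx _ (h v k)).
by have := entireD _ _ h1 h2; congr entire; apply/funext => s; rewrite !mxE; ring.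
Qed.

Section Tilt.
Variables (M : rvm R n -> R) (D : R).
Hypothesis mM : measurable_fun setT M.
Hypothesis MD : forall w, `|M w| <= D * (1 + sqn w) ^+ 2.

(** This is [gk eps (v - w) * M w] without its factor [expR (- sqn v / (2 * eps))]. Moving [v] along
    an axis tilts it by an exponential in one coordinate of [w], which is a Laplace kernel. *)
Let h v (w : rvm R n) := M w * (gk eps w * expR (dotv v w / eps)).

Let mh v : measurable_fun setT (h v).
Proof.
apply: measurable_funM => //; apply: measurable_funM.
  by apply: measurable_gk; exact: measurable_id.
apply: mexpR; apply: measurable_funM => //; apply: mdotv; first exact: measurable_cst.
exact: measurable_id.
Qed.

Let h_exp v B : integ (lebn n) (fun w => `|h v w| * expR (B * normv w)).
Proof.
have [C C0 HC] := @poly_exp_gk R n eps (normv v / eps + B) eps0.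
have ig : integ (lebn n) (fun w : rvm R n => `|D| * (C * gk (8 * eps) w)).
  by apply: integZ; apply: integZ; apply: gk_integ; rewrite mulr_gt0.
apply: (integ_le _ _ _ _ _ ig) => [|w].
- apply: measurable_funM; first exact: mnorm.
  by apply: mexpR; apply: measurable_funM => //; apply: mnormv; exact: measurable_id.
- rewrite normrM normr_id (ger0_norm (expR_ge0 _)).
  have h1 : `|h v w| <= `|D| * (1 + sqn w) ^+ 2 * (gk eps w * expR (normv v / eps * normv w)).
    rewrite /h normrM ler_pM//.
      by rewrite (le_trans (MD w))// ler_wpM2r ?sqr_ge0// ler_norm.
    rewrite normrM (ger0_norm (gk_ge0 n eps w)) (ger0_norm (expR_ge0 _)).
    apply: ler_wpM2l; first exact: gk_ge0.
    rewrite ler_expR mulrAC ler_wpM2r ?invr_ge0 ?(ltW eps0)//.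
    exact: le_trans (ler_norm _) (cauchy_schwarz _ _).
  apply: le_trans (ler_wpM2r (expR_ge0 _) h1) _.
  have := HC w; rewrite mulrDl expRD => HCw.
  apply: le_trans (ler_wpM2l (normr_ge0 D) HCw).
  by rewrite le_eqVlt; apply/orP; left; apply/eqP; ring.
Qed.

Let gk_tilt v w : gk eps (v - w) * M w = expR (- sqn v / (2 * eps)) * h v w.
Proof.
rewrite /h /gk.
have -> : - sqn (v - w) / (2 * eps) = - sqn v / (2 * eps) +
    (- sqn w / (2 * eps) + dotv v w / eps) by rewrite sqnB; field; rewrite gt_eqF.
by rewrite !expRD; ring.
Qed.

Let h_integ v : integ (lebn n) (h v).
Proof.
apply: (integ_le _ _ _ (mh v) _ (h_exp v 0)) => w.
by rewrite mul0r expR0 mulr1.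
Qed.

Lemma convol_gk_integ v : integ (lebn n) (fun w => gk eps (v - (w : 'rV[R]_n)) * M w).
Proof. by under eq_fun do rewrite gk_tilt; exact: integZ. Qed.

Lemma gentire_convol_gk : gentire (convol (gk eps) M).
Proof.
move=> v k; pose Y (w : rvm R n) := (w : 'rV[R]_n) ord0 k / eps.
have mY : measurable_fun setT Y by apply: measurable_funM => //; exact: measurable_coord.
have hY b : integ (lebn n) (fun w => `|h v w| * expR (b * `|Y w|)).
  apply: (integ_le _ _ _ _ _ (h_exp v (`|b| / eps))) => [|w].
    apply: measurable_funM; first exact: mnorm.
    by apply: mexpR; apply: measurable_funM => //; exact: mnorm.
  rewrite normrM normr_id (ger0_norm (expR_ge0 _)) ler_wpM2l// ler_expR.
  rewrite (le_trans (ler_norm _))// normrM normr_id -mulrA ler_wpM2l//.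
  rewrite /Y normrM (ger0_norm (x := eps^-1)) ?invr_ge0 ?(ltW eps0)// mulrC.
  by rewrite ler_wpM2l ?invr_ge0 ?(ltW eps0)// coord_le_normv.
have := laplace_entire (lebn n) (h v) Y (mh v) mY hY; congr entire; apply/funext => s.
set V := v + s *: unitv k.
have -> : convol (gk eps) M V = expR (- sqn V / (2 * eps)) * \int[lebn n]_w (h V w).
  rewrite -(RintegralZl _ measurableT (h_integ V)).
  by apply: eq_Rintegral => w _; rewrite gk_tilt.
rewrite mulrA -expRD mulNr subrr expR0 mul1r; apply: eq_Rintegral => w _.
rewrite /h -!mulrA -expRD; congr (_ * (_ * expR _)).
by rewrite /V dotvDl dotvZl dotv_unitl /Y; ring.
Qed.

Lemma convol_psi_integ v : integ (lebn n) (fun w => psi eps (v - (w : 'rV[R]_n)) * M w).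
Proof.
by under eq_fun do rewrite psiE -mulrA; apply: integZ; exact: convol_gk_integ.
Qed.

Lemma gentire_convol_psi : gentire (convol (psi eps) M).
Proof.
have := gentireZ (cpsi n eps) _ gentire_convol_gk; congr gentire; apply/funext => v.
rewrite /convol -(RintegralZl _ measurableT (convol_gk_integ v)).
by apply: eq_Rintegral => w _; rewrite psiE mulrA.
Qed.

End Tilt.

(** Convolution with [psi eps] preserves constants, so [gentire_convol_psi] applies. *)
Lemma gentire_cst c : gentire (fun=> c).
Proof.
have := gentireZ c _ (gentire_convol_psi (fun=> 1) 1 (measurable_cst _) _).
have h w : `|1 : R| <= 1 * (1 + sqn w) ^+ 2 :> R.
  by rewrite normr1 mul1r exprn_ege1// lerDl sqn_ge0.
by move=> /(_ h); congr gentire; apply/funext => v; rewrite conv_psi1// mulr1.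
Qed.

(** The factor [v_i - w_i] of [dpsi] is split: [v_i] leaves the integral and [w_i] joins [L]. This
    is why the growth allowed for [M] above is the square of [1 + sqn w]. *)
Lemma gentire_convol_dpsi (L : rvm R n -> R) D i : measurable_fun setT L ->
  (forall w, `|L w| <= D * (1 + sqn w)) -> gentire (convol (dpsi eps i) L).
Proof.
move=> mL LD.
have D0 : 0 <= D by have := LD 0; rewrite sqn0 addr0 mulr1; exact: le_trans.
have mc : measurable_fun setT (fun w : rvm R n => (w : 'rV[R]_n) ord0 i * L w).
  by apply: measurable_funM => //; exact: measurable_coord.
have LD2 w : `|L w| <= D * (1 + sqn w) ^+ 2.
  rewrite (le_trans (LD w))// ler_wpM2l// expr2; have := sqn_ge0 w; nra.
have LDc (w : 'rV[R]_n) : `|w ord0 i * L w| <= D * (1 + sqn w) ^+ 2.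
  rewrite normrM expr2 mulrCA ler_pM//; first exact: le_trans (coord_le_normv _ _) (normv_le1 _).
have h1 := gentire_convol_psi _ _ mL LD2; have h2 := gentire_convol_psi _ _ mc LDc.
have := gentireD _ _ (gentireZ (- eps^-1) _ (gentire_coord i _ h1)) (gentireZ eps^-1 _ h2).
congr gentire; apply/funext => v.
have i1 := convol_psi_integ _ _ mL LD2 v; have i2 := convol_psi_integ _ _ mc LDc v.
rewrite /convol -!(RintegralZl _ measurableT i1) -!(RintegralZl _ measurableT i2).
rewrite -(RintegralZl _ measurableT (integZ _ _ _ i1)) -RintegralD//; last 2 first.
- by apply: integZ; exact: integZ.
- exact: integZ.
by apply: eq_Rintegral => w _; rewrite /dpsi !mxE; ring.
Qed.

End GaussianEntire.

(** * Vector fields with parallel increments *)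

Section Wedge.
Context {R : realType} {n : nat}.

(** The two-by-two minors of [v - w] and [g v - g w]: parallelism becomes the vanishing of scalar
    functions that are entire up to a Gaussian factor in each variable when [g] is [graddE]. *)
Definition wedge (g : 'rV[R]_n -> 'rV[R]_n) (w : 'rV[R]_n) i j (v : 'rV[R]_n) : R :=
  (v - w) ord0 i * (g v - g w) ord0 j - (v - w) ord0 j * (g v - g w) ord0 i.

Lemma wedgeC g w i j v : wedge g w i j v = wedge g v i j w.
Proof. by rewrite /wedge !coordB; ring. Qed.

Implicit Types (b z : 'rV[R]_n).

(** Equality in the Cauchy-Schwarz inequality: [sqn z *: b - dotv b z *: z] has length 0. *)
Lemma parallel_wedge b z i j : sqn z * sqn b = dotv b z ^+ 2 ->
  z ord0 i * b ord0 j = z ord0 j * b ord0 i.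
Proof.
move=> E; have [->|z0] := eqVneq z 0; first by rewrite !mxE !mul0r.
have sz : sqn z != 0 by rewrite sqn_eq0.
have : sqn z *: b - dotv b z *: z = 0.
  apply/eqP; rewrite -sqn_eq0 sqnB !sqnZ dotvZl dotvZr.
  apply/eqP; move: E; rewrite /sqn -!/(sqn _); move: (sqn z) (sqn b) (dotv b z) => x y t E.
  by rewrite [LHS](_ : _ = x * (x * y - t ^+ 2)); [rewrite E subrr mulr0|ring].
move/eqP; rewrite subr_eq0 => /eqP/rowP E2.
have := E2 i; have := E2 j; rewrite !mxE => ej ei.
apply: (mulfI sz); rewrite mulrCA ej [RHS]mulrCA ei; ring.
Qed.

(** With [h = g - g 0], the relations at [(v, 0)] and [(w, 0)] are subtracted from the one at
    [(v, w)], leaving only mixed terms. At a basis vector these read [h v j = a i * v j] for [i]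
    different from [j]; a second index is needed for this and forces all [a i] to agree. *)
Lemma wedge_affine (g : 'rV[R]_n -> 'rV[R]_n) : (2 <= n)%N ->
  (forall (v w : 'rV[R]_n) i j, (v - w) ord0 i * (g v - g w) ord0 j = (v - w) ord0 j * (g v - g w) ord0 i) ->
  exists c : R, forall v, g v = g 0 + c *: v.
Proof.
case: n g => [|[|m]] // g _ W.
pose h (v : 'rV[R]_m.+2) := g v - g 0.
have W0 (v : 'rV[R]_m.+2) i j : v ord0 i * h v ord0 j = v ord0 j * h v ord0 i.
  by have := W v 0 i j; rewrite subr0.
have W2 (v w : 'rV[R]_m.+2) i j : v ord0 i * h w ord0 j + w ord0 i * h v ord0 j =
    v ord0 j * h w ord0 i + w ord0 j * h v ord0 i.
  have := W v w i j; have := W0 v i j; have := W0 w i j; rewrite /h !mxE; lra.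
pose a (i : 'I_m.+2) := h (unitv i) ord0 i.
have uE (i j : 'I_m.+2) : (unitv i : 'rV[R]_m.+2) ord0 j = (i == j)%:R by rewrite mxE.
have hu i j : i != j -> h (unitv i) ord0 j = 0.
  by move=> ij; have := W0 (unitv i) i j; rewrite !uE eqxx (negbTE ij) mul1r mul0r.
have H (v : 'rV[R]_m.+2) i j : i != j -> h v ord0 j = a i * v ord0 j.
  move=> ij; have := W2 v (unitv i) i j.
  by rewrite !uE eqxx (negbTE ij) (hu i j ij) mulr0 add0r mul1r mul0r addr0 mulrC.
have aE i j : i != j -> a j = a i.
  by move=> ij; rewrite {1}/a (H _ i j ij) uE eqxx mulr1.
exists (a ord0) => v; apply/rowP => j; suff E : h v ord0 j = a ord0 * v ord0 j.
  by rewrite !mxE -E !mxE addrC subrK.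
have [->|j0] := eqVneq j ord0; last by apply: H; rewrite eq_sym.
have l0 : lift ord0 ord0 != ord0 :> 'I_m.+2 by rewrite eq_sym neq_lift.
by rewrite (H _ _ _ l0) (aE _ _ l0).
Qed.

Lemma hasgrad_quadratic (l0 l2 : R) (l1 : 'rV[R]_n) :
  hasgrad (fun v => l0 + dotv l1 v + l2 / 2 * sqn v) (fun v => l1 + l2 *: v).
Proof.
have hdot : hasgrad (dotv l1) (fun=> l1).
  move=> x e h; under eq_fun do rewrite dotvDr dotvZr.
  apply: is_derive_eq; rewrite (dotvC e); move: (dotv _ _) => y.
  by rewrite /GRing.scale /=; ring.
have h1 := hasgradM _ _ _ _ (@hasgrad_cst R n (l2 / 2)) hasgrad_sqn.
have h2 := hasgradD _ _ _ _ (hasgradD _ _ _ _ (@hasgrad_cst R n l0) hdot) h1.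
apply: (eq_hasgrad _ _ _ h2) => x.
by rewrite add0r scaler0 addr0 scalerA divfK// pnatr_eq0.
Qed.

End Wedge.

(** * Propagation of parallelism from the support of [f] *)

Section CollisionAffine.
Context {R : realType} {n : nat}.
Variables (gamma eps : R) (f : rvm R n -> R).
Hypothesis hgamma : -4 <= gamma <= 0.
Hypothesis eps0 : 0 < eps.
Hypothesis f0 : forall v, 0 <= f v.
Hypothesis fi : integ (lebn n) f.
Hypothesis fi2 : integ (lebn n) (fun v => f v * sqn v).
Hypothesis fk : integ (lebn n) (fun v => (1 + normv v `^ kappa gamma) * f v).
Hypothesis mass : 0 < \int[lebn n]_w f w.

Let mf : measurable_fun setT f := integ_meas _ _ fi.
Let L := lnm eps f.
Let mL : measurable_fun setT L := measurable_lnm eps f eps0 f0 fi.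

Lemma gentire_graddE i : gentire eps (fun v => graddE eps f v ord0 i).
Proof.
have [D _ LD] := lnm_growth eps f eps0 f0 fi fi2 mass.
have := gentire_convol_dpsi eps eps0 L D i mL LD; congr gentire.
by apply/funext => v; rewrite graddE_convol.
Qed.

Lemma gentire_wedge w i j : gentire eps (wedge (graddE eps f) w i j).
Proof.
have half a b : gentire eps (fun v =>
    (v - w) ord0 a * (graddE eps f v - graddE eps f w) ord0 b).
  have h := gentireD _ _ _ (gentire_graddE b) (gentire_cst eps eps0 (- graddE eps f w ord0 b)).
  have := gentireD _ _ _ (gentire_coord _ a _ h) (gentireZ _ (- w ord0 a) _ h).
  by congr gentire; apply/funext => v; rewrite !coordB mulrBl mulNr.
have := gentireD _ _ _ (half i j) (gentireZ _ (-1) _ (half j i)).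
by congr gentire; apply/funext => v; rewrite mulN1r.
Qed.

Lemma measurable_wedge w i j : measurable_fun setT (wedge (graddE eps f) w i j : rvm R n -> R).
Proof.
have mg := measurable_graddE eps f eps0 f0 fi fi2 mass.
have mid : measurable_fun setT (fun v : rvm R n => (v : 'rV[R]_n) - w : rvm R n).
  by apply: mrvB; [exact: measurable_id|exact: measurable_cst].
have mgB : measurable_fun setT (fun v : rvm R n => graddE eps f v - graddE eps f w : rvm R n).
  exact: (mrvB _ _ mg (measurable_cst _)).
by apply: measurable_funB; apply: measurable_funM; apply: mrv_coord; first [exact: mid|exact: mgB].
Qed.

(** The Gaussian factor has no zeros, so multiplying by it leaves the zero set unchanged. *)
Lemma wedge_identity w i j : (0 < lebn n [set v | wedge (graddE eps f) w i j v = 0%R])%E ->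
  forall v, wedge (graddE eps f) w i j v = 0.
Proof.
move=> Z0 v; have e0 (u : 'rV[R]_n) : expR (sqn u / (2 * eps)) != 0 by rewrite gt_eqF// expR_gt0.
apply: (mulfI (e0 v)); rewrite mulr0.
apply: (lentire_identity n (fun v => expR (sqn v / (2 * eps)) * wedge (graddE eps f) w i j v)).
- apply: measurable_funM; last exact: measurable_wedge.
  by apply: mexpR; apply: measurable_funM => //; apply: msqn; exact: measurable_id.
- exact: gentire_wedge.
apply: lt_le_trans Z0 _; rewrite le_eqVlt; apply/orP; left; apply/eqP; congr (lebn n _).
apply/seteqP; split => u /=; first by move=> ->; rewrite mulr0.
by move=> h; apply: (mulfI (e0 u)); rewrite mulr0.
Qed.

Lemma measureI_gt0 (A B : set (rvm R n)) : measurable A -> measurable B ->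
  lebn n (~` B) = 0%E -> (0 < lebn n A)%E -> (0 < lebn n (A `&` B))%E.
Proof.
move=> mA mB B0 A0; have <- : lebn n A = lebn n (A `&` B) => //.
rewrite [LHS](@measureDI _ _ _ (lebn n) A B)// [X in (X + _)%E](_ : _ = 0%E) ?add0e//.
apply: (@subset_measure0 _ _ _ (lebn n) _ (~` B)) => //; first exact: measurableD.
  exact: measurableC.
Qed.

(** Nothing is known about the set [A] where [f] is positive beyond its measure, and parallelism
    holds off a null set of pairs. For almost every [v] in [A] the exceptional slice is null, and
    the identity theorem in [w] applies; then, for each [w], it is applied in [v] by the symmetry
    [wedgeC]. *)
Lemma coll_null_wedge :
  (forall phi : 'rV[R]_n -> R, test_fun phi -> coll gamma eps f phi = 0%E) ->
  forall v w i j, wedge (graddE eps f) w i j v = 0.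
Proof.
move=> hcoll; have ae0 := collf_grad_eq0 gamma eps f hgamma eps0 f0 fi fi2 fk mass hcoll.
have mg := measurable_graddE eps f eps0 f0 fi fi2 mass.
pose N := [set p | collf gamma eps f (graddE eps f) p != 0].
have mN : measurable N.
  have mc := measurable_collf gamma eps f eps0 f0 fi fi2 mass _ mg.
  have -> : N = setT `&` collf gamma eps f (graddE eps f) @^-1` (~` [set 0]).
    by apply/seteqP; split => p /=; [move=> /eqP h; split|case=> _ /eqP].
  by apply: mc => //; apply: measurableC; exact: measurable_set1.
have N0 : pleb n N = 0%E.
  by apply: (measure_negligible mN); apply: negligibleS ae0 => p /= /eqP h H; exact: h.
pose phi v := lebn n (xsection N v).
have mphi : measurable_fun setT phi by exact: measurable_fun_xsection.
pose G := [set v | phi v = 0%E].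
have mG : measurable G.
  by rewrite -[G]setTI; exact: (mphi measurableT [set 0%E] (emeasurable_set1 _)).
have G0 : lebn n (~` G) = 0%E.
  have e : (\int[lebn n]_v phi v = 0)%E := N0.
  have : ae_eq (lebn n) setT phi (cst 0%E).
    by apply/(ae_eq_integral_abs (lebn n) measurableT mphi); under eq_integral do rewrite gee0_abs//.
  move=> ae1; apply: (measure_negligible (measurableC mG)); apply: negligibleS ae1 => v /= h H.
  by apply: h; exact: H.
pose A := [set v | 0 < f v].
have mA : measurable A.
  have -> : A = setT `&` f @^-1` `]0, +oo[%classic.
    by apply/seteqP; split => v /=; rewrite in_itv/= andbT; [split|case].
  by apply: mf => //; exact: measurable_itv.
have A0 : (0 < lebn n A)%E.
  rewrite lt_neqAle measure_ge0 andbT; apply/negP => /eqP e.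
  suff e0 : \int[lebn n]_w f w = \int[lebn n]_w 0.
    by move: mass; rewrite e0 /Rintegral integral0 ltxx.
  apply: ae_eq_Rintegral => //.
  exists A; split => // v /= /eqP h.
  by rewrite /A /= lt_neqAle f0 andbT eq_sym.
have par v w i j : ~ N (v, w) -> A v -> A w -> wedge (graddE eps f) w i j v = 0.
  rewrite /N /= => /negP; rewrite negbK /collf /= => /eqP E fv fw.
  have [->|vw] := eqVneq v w; first by rewrite /wedge !subrr !mxE !mul0r subrr.
  apply/eqP; rewrite subr_eq0; apply/eqP; apply: parallel_wedge.
  have z0 : normv (v - w) `^ gamma != 0.
    by rewrite gt_eqF// powR_gt0// lt_def normv_ge0 andbT sqrtr_eq0 -ltNge lt_def sqn_ge0 sqn_eq0 subr_eq0 vw.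
  move: E => /eqP; rewrite !mulf_eq0 (gt_eqF fv) (gt_eqF fw) !orbF AformE mulf_eq0 (negbTE z0)/=.
  by rewrite subr_eq0 (dotvC (v - w)) -expr2 => /eqP.
have step1 v i j w : A v -> G v -> wedge (graddE eps f) v i j w = 0.
  move=> Av Gv; apply: wedge_identity.
  apply: lt_le_trans (measureI_gt0 A (~` xsection N v) mA _ _ A0) _.
  - by apply: measurableC; exact: measurable_xsection.
  - by rewrite setCK.
  apply: le_measure; rewrite ?inE.
  - by apply: measurableI => //; apply: measurableC; exact: measurable_xsection.
  - rewrite -[X in measurable X]setTI.
    exact: (measurable_wedge v i j measurableT [set 0] (measurable_set1 _)).
  move=> u [Au]; rewrite /xsection /= inE => nN.
  have := par v u i j nN Av Au; by rewrite /= wedgeC.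
move=> v w i j; apply: wedge_identity.
apply: lt_le_trans (measureI_gt0 A G mA mG G0 A0) _.
apply: le_measure; rewrite ?inE.
- exact: measurableI.
- rewrite -[X in measurable X]setTI.
  exact: (measurable_wedge w i j measurableT [set 0] (measurable_set1 _)).
move=> u [Au Gu]; have := step1 u i j w Au Gu; by rewrite /= wedgeC.
Qed.

Lemma coll_null_quadratic : (2 <= n)%N ->
  (forall phi : 'rV[R]_n -> R, test_fun phi -> coll gamma eps f phi = 0%E) ->
  exists (l0 : R) (l1 : 'rV[R]_n) (l2 : R), forall v,
    dE eps f v = l0 + dotv l1 v + l2 / 2 * sqn v.
Proof.
move=> n2 hcoll; have W := coll_null_wedge hcoll.
have [v w i j|c gE] := wedge_affine (graddE eps f) n2.
  by have /eqP := W v w i j; rewrite subr_eq0 => /eqP.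
exists (dE eps f 0), (graddE eps f 0), c => v.
(* The gradient of [q] is zero, so [q] is constant by the mean value theorem; its value at 0
   provides [l0]. *)
pose q v := dE eps f v + - 1 * (0 + dotv (graddE eps f 0) v + c / 2 * sqn v).
have hq : hasgrad q (fun=> 0).
  have h2 := hasgradD _ _ _ _ (hasgrad_dE eps f eps0 f0 fi fi2 mass)
    (hasgradM _ _ _ _ (@hasgrad_cst R n (-1)) (hasgrad_quadratic 0 c (graddE eps f 0))).
  apply: (eq_hasgrad _ _ _ h2) => x.
  by rewrite gE scaler0 addr0 scaleN1r subrr.
have [xi] := hasgrad_mvt q _ v 0 hq.
rewrite dotv0r /q dotv0r sqn0; lra.
Qed.

End CollisionAffine.

(** * Injectivity of Gaussian convolution *)

Section ExpSeries.
Context {R : realType}.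

Definition exp_sum N (x : R) : R := \sum_(r < N) r`!%:R^-1 * x ^+ r.

Lemma exp_sumE N x : exp_sum N x = series (exp_coeff x) N.
Proof. by rewrite /series /= exp_coeffE big_mkord. Qed.

Lemma cvg_exp_sum x : exp_sum N x @[N --> \oo] --> expR x.
Proof. by under eq_fun do rewrite exp_sumE; exact: is_cvg_series_exp_coeff. Qed.

Lemma exp_sum_norm N x : `|exp_sum N x| <= expR `|x|.
Proof.
apply: le_trans (_ : exp_sum N `|x| <= _).
  rewrite (le_trans (ler_norm_sum _ _ _))// ler_sum// => r _.
  by rewrite normrM normrX ger0_norm// invr_ge0.
rewrite exp_sumE; apply: nondecreasing_cvgn_le; last exact: is_cvg_series_exp_coeff.
by apply: nondecreasing_series => k _ _; exact: exp_coeff_ge0.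
Qed.

Lemma expRN_le_inv (x : R) : 0 <= x -> expR (- x) <= (1 + x)^-1.
Proof.
move=> x0; have x1 : 0 < 1 + x by rewrite ltr_wpDr.
by rewrite expRN lef_pV2 ?posrE ?expR_gt0// expR_ge1Dx.
Qed.

Lemma cvg_dist_harmonic (u : nat -> R) (a C : R) :
  (forall j, `|u j - a| <= C * (1 + j%:R)^-1) -> u @ \oo --> a.
Proof.
move=> h; have c0 : (fun j => C * harmonic j) @ \oo --> (0 : R).
  by rewrite -(mulr0 C); apply: cvgM; [exact: cvg_cst|exact: cvg_harmonic].
apply/cvgrPdist_le => e e0; have /cvgrPdist_le /(_ e e0) := c0.
apply: filterS => j /=; rewrite sub0r normrN distrC -natr1 addrC => hj.
exact: le_trans (h j) (le_trans (ler_norm _) hj).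
Qed.

(** The summand [j] decides the boundary case [y = 0], where the limit must be 0; for [y > 0] it is
    outweighed by [j^2 y]. *)
Lemma cvg_double_exp (s y : R) : 0 <= s ->
  (fun j => expR (- expR (- s - j%:R ^+ 2 * y + j%:R))) @ \oo --> ((0 < y)%R%:R : R).
Proof.
move=> s0; have [y0|y0] := ltP 0 y; rewrite /=.
  apply: (cvg_dist_harmonic _ _ (expR y^-1)) => j.
  set X := expR (- s - _ + _).
  have X0 : 0 <= X by exact: expR_ge0.
  have h1 : 1 - X <= expR (- X) by exact: expR_ge1Dx.
  have h2 : expR (- X) <= 1 by rewrite -[leRHS]expR0 ler_expR oppr_le0.
  (* Completing the square, [- j^2 y + j <= 1 / y - j]; this is the origin of the constant
     [expR y^-1]. *)
  have hX : X <= expR y^-1 * expR (- j%:R).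
    rewrite -expRD ler_expR.
    have : 0 <= (j%:R * y - 1) ^+ 2 / y by rewrite divr_ge0 ?sqr_ge0// ltW.
    have -> : (j%:R * y - 1) ^+ 2 / y = j%:R ^+ 2 * y - 2 * j%:R + y^-1.
      by field; rewrite gt_eqF.
    lra.
  have hj : expR (- j%:R) <= (1 + j%:R)^-1 :> R by exact: expRN_le_inv.
  have := le_trans hX (ler_wpM2l (expR_ge0 y^-1) hj).
  by rewrite ler_norml => ?; apply/andP; split; lra.
apply: (cvg_dist_harmonic _ _ (expR s)) => j; rewrite subr0 ger0_norm ?expR_ge0//.
set X := expR (- s - _ + _).
apply: le_trans (expRN_le_inv X (expR_ge0 _)) _.
rewrite -[expR s]invrK -invfM -expRN.
rewrite lef_pV2 ?posrE ?mulr_gt0 ?expR_gt0 ?ltr_wpDr ?expR_ge0//.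
have h1 : expR (- s) * expR j%:R <= X.
  by rewrite -expRD ler_expR; have := mulr_ge0_le0 (sqr_ge0 (j%:R : R)) y0; lra.
apply: le_trans (_ : X <= _); last by rewrite lerDr.
by rewrite (le_trans _ h1)// ler_wpM2l ?expR_ge0// expR_ge1Dx.
Qed.

End ExpSeries.

(** * Functions with vanishing integrals against damped exponentials *)

Section LaplaceNull.
Context {R : realType} {n : nat}.
Variable c : R.
Hypothesis c0 : 0 < c.
Implicit Types (k : rvm R n -> R) (v w : 'rV[R]_n).

(** The damping index [m] makes the family closed under products while [gexp 1 v] stays bounded, so
    that exponentials of its members can be expanded under the integral. *)
Definition gexp (m : nat) v w : R := expR (- (m%:R * c * sqn w) + dotv v w).

Definition lnull k := forall m v,
  integ (lebn n) (fun w => k w * gexp m v w) /\ \int[lebn n]_w (k w * gexp m v w) = 0.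

Lemma gexp00 w : gexp 0 0 w = 1.
Proof. by rewrite /gexp !mul0r oppr0 dotv0l add0r expR0. Qed.

Lemma gexpD m1 m2 v1 v2 w : gexp (m1 + m2) (v1 + v2) w = gexp m1 v1 w * gexp m2 v2 w.
Proof. by rewrite /gexp -expRD natrD dotvDl; congr expR; ring. Qed.

Lemma gexpX r v w : gexp 1 v w ^+ r = gexp r (r%:R *: v) w.
Proof.
rewrite /gexp -expRM_natl dotvZl; congr expR; rewrite mul1r; ring.
Qed.

Lemma lnull_integ k : lnull k -> integ (lebn n) k.
Proof. by move=> /(_ 0%N 0) [+ _]; under eq_fun do rewrite gexp00 mulr1. Qed.

Lemma lnull_Rintegral k : lnull k -> \int[lebn n]_w k w = 0.
Proof. by move=> /(_ 0%N 0) [_ +]; under eq_Rintegral do rewrite gexp00 mulr1. Qed.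

Lemma lnullD k1 k2 : lnull k1 -> lnull k2 -> lnull (fun w => k1 w + k2 w).
Proof.
move=> h1 h2 m v; have [i1 e1] := h1 m v; have [i2 e2] := h2 m v.
split; first by under eq_fun do rewrite mulrDl; exact: integD.
by under eq_Rintegral do rewrite mulrDl; rewrite RintegralD// e1 e2 addr0.
Qed.

Lemma lnullZ a k : lnull k -> lnull (fun w => a * k w).
Proof.
move=> h m v; have [i1 e1] := h m v.
split; first by under eq_fun do rewrite -mulrA; exact: integZ.
by under eq_Rintegral do rewrite -mulrA; rewrite RintegralZl// e1 mulr0.
Qed.

Lemma lnull0 k : lnull k -> lnull (fun=> 0).
Proof. by move=> /(lnullZ 0); congr lnull; apply/funext => w; rewrite mul0r. Qed.

Lemma lnull_gexp m v k : lnull k -> lnull (fun w => k w * gexp m v w).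
Proof.
move=> h m' v'; have [i1 e1] := h (m + m')%N (v + v').
have E w : k w * gexp m v w * gexp m' v' w = k w * gexp (m + m') (v + v') w.
  by rewrite gexpD mulrA.
by split; [under eq_fun do rewrite E|under eq_Rintegral do rewrite E].
Qed.

(** Dominated convergence against each [gexp]; the majorant [k0], being [lnull], is integrable
    against all of them. *)
Lemma lnull_lim (kj : nat -> rvm R n -> R) k C k0 : (forall j, lnull (kj j)) -> lnull k0 ->
  (forall j w, `|kj j w| <= C * `|k0 w|) -> (forall w, kj j w @[j --> \oo] --> k w) ->
  lnull k.
Proof.
move=> hj h0 hC hk m v; have [i0 _] := h0 m v.
have g0 w : `|gexp m v w| = gexp m v w by rewrite ger0_norm// expR_ge0.
have dom j w : `|kj j w * gexp m v w| <= C * `|k0 w * gexp m v w|.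
  by rewrite !normrM g0 mulrA; apply: ler_wpM2r; [exact: expR_ge0|exact: hC].
have [i1 c1] := dct (lebn n) (fun j w => kj j w * gexp m v w) (fun w => k w * gexp m v w)
  (fun w => C * `|k0 w * gexp m v w|)
  (fun j => integ_meas _ _ (hj j m v).1) (integZ _ _ _ (integ_norm _ _ i0))
  dom (fun w => cvg_mulr _ _ _ (hk w)).
have c2 : (\int[lebn n]_w (kj j w * gexp m v w)) @[j --> \oo] --> (0 : R).
  by under eq_fun do rewrite (hj _ m v).2; exact: cvg_cst.
by split => //; exact: (cvg_unique _ c1 c2).
Qed.

(** Completing the square bounds [- c |w|^2 + a.w] above, hence [X]; the partial sums of the
    exponential series of [- X] are then bounded uniformly in their length, and each is a
    combination of [gexp r]. *)
Lemma lnull_double_exp a b k : lnull k ->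
  lnull (fun w => k w * expR (- expR (- (c * sqn w) + dotv a w + b))).
Proof.
move=> h; pose X w := expR b * gexp 1 a w.
have XE w : expR (- (c * sqn w) + dotv a w + b) = X w.
  by rewrite /X /gexp -expRD mul1r addrC.
have X0 w : 0 <= X w by rewrite mulr_ge0 ?expR_ge0.
have XB w : X w <= expR (b + sqn a / (4 * c)).
  rewrite /X /gexp -expRD ler_expR lerD2l mul1r.
  have : 0 <= sqn (a - (2 * c) *: w) / (4 * c) by rewrite divr_ge0 ?sqn_ge0// mulr_ge0// ltW.
  have -> : sqn (a - (2 * c) *: w) / (4 * c) = sqn a / (4 * c) - dotv a w + c * sqn w.
    by rewrite sqnB sqnZ dotvZr; field; rewrite gt_eqF.
  lra.
apply: (lnull_lim (fun N w => k w * exp_sum N (- X w)) _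
  (expR (expR (b + sqn a / (4 * c)))) k) => // [N|N w|w].
- suff E : (fun w => k w * exp_sum N (- X w)) =
      (fun w => \sum_(r < N) ((-1) ^+ r * expR b ^+ r / r`!%:R) * (k w * gexp r (r%:R *: a) w)).
    rewrite E; elim: N {E} => [|N IH].
      by under eq_fun do rewrite big_ord0; exact: lnull0 h.
    under eq_fun do rewrite big_ord_recr /=.
    by apply: lnullD => //; apply: lnullZ; exact: lnull_gexp.
  apply/funext => w; rewrite /exp_sum mulr_sumr; apply: eq_bigr => r _.
  by rewrite -[- X w]mulN1r /X !exprMn gexpX; ring.
- rewrite normrM mulrC ler_wpM2r// (le_trans (exp_sum_norm _ _))// normrN ger0_norm//.
  by rewrite ler_expR.
- by rewrite XE; apply: cvg_mull; exact: cvg_exp_sum.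
Qed.

(** With [y = w_i - t], the inner exponent in [cvg_double_exp] is [- c |w|^2] plus an affine
    function of [w], the shape handled by [lnull_double_exp]. *)
Lemma lnull_half_space i (t : R) k : lnull k ->
  lnull (fun w => k w * (t < w ord0 i)%R%:R).
Proof.
move=> h; apply: (lnull_lim (fun j w => k w * expR (- expR (- (c * sqn w) +
    dotv (- (j%:R ^+ 2) *: unitv i) w + (j%:R ^+ 2 * t + j%:R)))) _ 1 k) => // [j|j w|w].
- exact: lnull_double_exp.
- rewrite mul1r normrM ler_piMr// ger0_norm ?expR_ge0//.
apply: cvg_mull; rewrite -subr_gt0.
have E (j : nat) : - (c * sqn w) + dotv (- (j%:R ^+ 2) *: unitv i) w + (j%:R ^+ 2 * t + j%:R) =
    - (c * sqn w) - j%:R ^+ 2 * (w ord0 i - t) + j%:R.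
  by rewrite dotvZl dotv_unitl; ring.
under eq_fun do rewrite E.
exact: (cvg_double_exp (c * sqn w) _ (mulr_ge0 (ltW c0) (sqn_ge0 w))).
Qed.

(* These sets form a sigma-algebra, and half-spaces belong to it because their
   indicators are limits of [exp (- exp (- c |w|^2 + a.w + b))], which expand
   into series of [gexp]. *)
Definition null_restr (A : set (rvm R n)) := forall k, lnull k -> lnull (fun w => k w * \1_A w).

Lemma sigma_algebra_null_restr : sigma_algebra setT null_restr.
Proof.
have compl A : null_restr A -> null_restr (~` A).
  move=> hA k h; have := lnullD _ _ h (lnullZ (-1) _ (hA k h)).
  congr lnull; apply/funext => w; rewrite !indicE in_setC.
  by case: (w \in A); rewrite /= ?(mulr1, mulr0); ring.
split=> [k h|A hA|A hA].
- by under eq_fun do rewrite indic0 mulr0; exact: lnull0 h.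
- by rewrite setTD; exact: compl.
rewrite -[X in null_restr X]setCK; apply: (compl _ _) => k h.
(* The complement of the union has as indicator the limit of the finite products of the indicators
   of the complements. *)
pose p N w : R := \prod_(j < N) \1_(~` A j) w.
apply: (lnull_lim (fun N w => k w * p N w) _ 1 k) => // [N|N w|w].
- elim: N => [|N IH]; rewrite /p.
    by under eq_fun do rewrite big_ord0 mulr1.
  by under eq_fun do rewrite big_ord_recr /= mulrA; exact: compl (hA N) _ IH.
- rewrite mul1r normrM ler_piMr// ger0_norm ?prodr_ge0//.
  by apply: prodr_ile1 => j _; rewrite indicE; case: (_ \in _); rewrite /= ?lexx ler01.
apply: cvg_mull; rewrite indicE.
have [[j _ Aj]|nA] := pselect ((\bigcup_k A k) w).
  rewrite memNset /=; last by apply; exists j.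
  apply: cvg_near_cst; exists j.+1 => // N /= jN.
  rewrite /p (bigD1 (Ordinal jN))//= indicE memNset ?mul0r//=.
rewrite mem_set//=; apply: cvg_near_cst; apply: nearW => N.
rewrite /p big1// => j _; rewrite indicE mem_set//= => Aj; apply: nA; by exists j.
Qed.

Lemma measurable_null_restr (A : set (rvm R n)) : measurable A -> null_restr A.
Proof.
apply: smallest_sub; first exact: sigma_algebra_null_restr.
move=> _ [i [B [mB ->]]].
have := sigma_algebra_image (fun v : rvm R n => (v : 'rV[R]_n) ord0 i) sigma_algebra_null_restr.
move=> /smallest_sub H.
have : @RGenOInfty.G R `<=` image_set_system setT (fun v : rvm R n => (v : 'rV[R]_n) ord0 i) null_restr.
  move=> _ [t ->]; rewrite /image_set_system /= setTI => k h.
  have := lnull_half_space i t k h; congr lnull; apply/funext => w.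
  rewrite indicE; congr (_ * (nat_of_bool _)%:R).
  by apply/idP/idP; rewrite inE /= in_itv/= andbT.
move=> /H /(_ B); rewrite /image_set_system /= setTI; apply.
by have /seteqP[/(_ B mB)] := RGenOInfty.measurableE R.
Qed.

(** Restricted to the set where it is positive, [k] is still [lnull] and integrates to 0 because
    [gexp 0 0] is 1; the same holds for [- k]. *)
Lemma lnull_ae0 k : lnull k -> {ae lebn n, forall w, k w = 0}.
Proof.
move=> h; have ik := lnull_integ k h; have mk := integ_meas _ _ ik.
have pos (k' : rvm R n -> R) : lnull k' -> {ae lebn n, forall w, k' w <= 0}.
  move=> h'; have mk' := integ_meas _ _ (lnull_integ _ h').
  pose A := [set w | 0 < k' w].
  have mA : measurable A.
    have -> : A = setT `&` k' @^-1` `]0, +oo[%classic.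
      by apply/seteqP; split => w /=; rewrite in_itv/= andbT; [split|case].
    by apply: mk' => //; exact: measurable_itv.
  have h2 := measurable_null_restr A mA k' h'.
  have p0 w : 0 <= k' w * \1_A w.
    rewrite indicE; case: (boolP (w \in A)) => wA; rewrite /= ?mulr0// mulr1.
    by move: wA; rewrite inE /A /= => /ltW.
  have := Rintegral_eq0 _ _ (lnull_integ _ h2) p0 (lnull_Rintegral _ h2).
  apply: filterS => w; rewrite indicE.
  case: (boolP (w \in A)) => wA /=; first by rewrite mulr1 => ->.
  by move=> _; rewrite leNgt; apply/negP => kw; move: wA; rewrite notin_setE; exact.
have h1 := pos k h; have h2 := pos _ (lnullZ (-1) k h).
apply: (negligibleS _ (negligibleU h1 h2)) => w /= kw; apply: contrapT => /not_orP[].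
move=> /contrapT a /contrapT b; apply: kw; apply/eqP; rewrite eq_le a /=; lra.
Qed.

End LaplaceNull.

(** * From Laplace transforms to deconvolution *)

Section Deconvolution.
Context {R : realType} {n : nat}.
Implicit Types (k : rvm R n -> R) (v w : 'rV[R]_n).

Definition lap0 k := [/\ measurable_fun setT k,
  forall B, integ (lebn n) (fun w => `|k w| * expR (B * normv w)) &
  forall v, \int[lebn n]_w (k w * expR (dotv v w)) = 0].

Lemma lap_integ k v : measurable_fun setT k ->
  (forall B, integ (lebn n) (fun w => `|k w| * expR (B * normv w))) ->
  integ (lebn n) (fun w => k w * expR (dotv v w)).
Proof.
move=> mk ik; apply: (integ_le _ _ _ _ _ (ik (normv v))) => [|w].
  apply: measurable_funM => //; apply: mexpR; apply: mdotv; first exact: measurable_cst.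
  exact: measurable_id.
rewrite normrM (ger0_norm (expR_ge0 _)) ler_wpM2l// ler_expR.
exact: le_trans (ler_norm _) (cauchy_schwarz _ _).
Qed.

Lemma lap0_coord k i : lap0 k -> lap0 (fun w => k w * w ord0 i).
Proof.
move=> [mk ik ek]; have mc := @measurable_coord R n i.
have mk1 : measurable_fun setT (fun w : rvm R n => k w * (w : 'rV[R]_n) ord0 i).
  exact: measurable_funM.
have ik1 B : integ (lebn n) (fun w : rvm R n => `|k w * (w : 'rV[R]_n) ord0 i| * expR (B * normv w)).
  apply: (integ_le _ _ _ _ _ (ik (B + 1))) => [|w].
    apply: measurable_funM; first exact: mnorm.
    by apply: mexpR; apply: measurable_funM => //; apply: mnormv; exact: measurable_id.
  rewrite normrM normr_id (ger0_norm (expR_ge0 _)) normrM -mulrA ler_wpM2l//.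
  rewrite mulrDl mul1r addrC expRD ler_wpM2r ?expR_ge0// (le_trans (coord_le_normv _ _))//.
  by rewrite (le_trans _ (expR_ge1Dx _))// lerDr.
split => // v.
pose h (w : rvm R n) := k w * expR (dotv v w); pose Y (w : rvm R n) := (w : 'rV[R]_n) ord0 i.
have mh : measurable_fun setT h := integ_meas _ _ (lap_integ k v mk ik).
have hY b : integ (lebn n) (fun w => `|h w| * expR (b * `|Y w|)).
  apply: (integ_le _ _ _ _ _ (ik (normv v + `|b|))) => [|w].
    apply: measurable_funM; first exact: mnorm.
    by apply: mexpR; apply: measurable_funM => //; exact: mnorm.
  rewrite normrM normr_id (ger0_norm (expR_ge0 _)) /h normrM (ger0_norm (expR_ge0 _)) -mulrA.
  rewrite ler_wpM2l// -expRD ler_expR mulrDl lerD//.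
    exact: le_trans (ler_norm _) (cauchy_schwarz _ _).
  by rewrite (le_trans (ler_norm _))// normrM normr_id ler_wpM2l// coord_le_normv.
have := is_derive_laplace (lebn n) h Y mh mc hY 0 0.
have -> : (fun s => \int[lebn n]_x (h x * Y x ^+ 0 * expR (s * Y x))) = (fun=> 0).
  apply/funext => s; rewrite -(ek (v + s *: unitv i)); apply: eq_Rintegral => w _.
  by rewrite expr0 mulr1 /h -mulrA -expRD dotvDl dotvZl dotv_unitl.
move=> H; have := @derive_val _ _ _ _ _ _ _ H.
rewrite (@derive_val _ _ _ _ _ _ _ (is_derive_cst (0 : R) (0 : R) (1 : R))) => e.
rewrite [RHS]e; apply: eq_Rintegral => w _.
by rewrite /h /Y expr1 mul0r expR0; ring.
Qed.

Lemma lap0D k1 k2 : lap0 k1 -> lap0 k2 -> lap0 (fun w => k1 w + k2 w).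
Proof.
move=> [m1 i1 e1] [m2 i2 e2]; split; first exact: measurable_funD.
  move=> B; apply: (integ_le _ _ _ _ _ (integD _ _ _ (i1 B) (i2 B))) => [|w].
    apply: measurable_funM; first by apply: mnorm; exact: measurable_funD.
    by apply: mexpR; apply: measurable_funM => //; apply: mnormv; exact: measurable_id.
  by rewrite normrM normr_id (ger0_norm (expR_ge0 _)) -mulrDl ler_wpM2r ?expR_ge0// ler_normD.
move=> v; under eq_Rintegral do rewrite mulrDl.
by rewrite RintegralD// ?e1 ?e2 ?addr0//; exact: lap_integ.
Qed.

Lemma lap0_sqn k : lap0 k -> lap0 (fun w => k w * sqn w).
Proof.
move=> hk; have h0 : lap0 (fun=> 0).
  split=> [|B|v]; first exact: measurable_cst.
    by under eq_fun do rewrite normr0 mul0r; have [_ _ _] := hk; exact: integrable0.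
  by under eq_Rintegral do rewrite mul0r; rewrite /Rintegral integral0.
have : lap0 (fun w => \sum_(i < n) (k w * w ord0 i * w ord0 i)).
  elim: (index_enum _) => [|i s IH]; first by under eq_fun do rewrite big_nil.
  under eq_fun do rewrite big_cons; apply: lap0D => //.
  by apply: lap0_coord; exact: lap0_coord.
by congr lap0; apply/funext => w; rewrite /sqn /dotv mulr_sumr; apply: eq_bigr => i _; rewrite mulrA.
Qed.

Lemma lap0Z a k : lap0 k -> lap0 (fun w => a * k w).
Proof.
move=> [m1 i1 e1]; split; first exact: measurable_funM.
  by move=> B; under eq_fun do rewrite normrM -mulrA; exact: integZ.
move=> v; under eq_Rintegral do rewrite -mulrA.
by rewrite RintegralZl// ?e1 ?mulr0//; exact: lap_integ.
Qed.

(* Expand the Gaussian in powers of [|w|^2]; each power comes from differentiating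
   the Laplace transform in [v]. *)
Lemma lap0_gauss c k : 0 <= c ->
  (forall B, integ (lebn n) (fun w => `|k w| * expR (c * sqn w) * expR (B * normv w))) ->
  lap0 k -> lap0 (fun w => k w * expR (- (c * sqn w))).
Proof.
move=> c0 ic hk; have [mk ik ek] := hk.
have ms : measurable_fun setT (fun w : rvm R n => sqn (w : 'rV[R]_n)) := msqn _ (@measurable_id _ _ _).
have mkc : measurable_fun setT (fun w : rvm R n => k w * expR (- (c * sqn w))).
  apply: measurable_funM => //; apply: mexpR; apply: measurable_funN; exact: measurable_funM.
split => // [B|v].
  apply: (integ_le _ _ _ _ _ (ik B)) => [|w].
    apply: measurable_funM; first exact: mnorm.
    by apply: mexpR; apply: measurable_funM => //; apply: mnormv; exact: measurable_id.
  rewrite normrM normr_id (ger0_norm (expR_ge0 _)) ler_wpM2r ?expR_ge0// normrM ler_piMr//.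
  by rewrite ger0_norm ?expR_ge0// -[leRHS]expR0 ler_expR oppr_le0 mulr_ge0// sqn_ge0.
pose F N (w : rvm R n) := k w * exp_sum N (- (c * sqn w)) * expR (dotv v w).
have hF N : lap0 (fun w => k w * exp_sum N (- (c * sqn w))).
  have hp r : lap0 (fun w => k w * sqn w ^+ r).
    elim: r => [|r IH]; first by under eq_fun do rewrite expr0 mulr1.
    by under eq_fun do rewrite exprSr mulrA; exact: lap0_sqn.
  have E : (fun w => k w * exp_sum N (- (c * sqn w))) =
      (fun w => \sum_(r < N) ((- c) ^+ r / r`!%:R) * (k w * sqn w ^+ r)).
    apply/funext => w; rewrite /exp_sum mulr_sumr; apply: eq_bigr => r _.
    by rewrite -mulNr exprMn; ring.
  rewrite E; elim: N {E} => [|N IH].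
    have := lap0Z 0 _ hk; congr lap0; apply/funext => w.
    by rewrite big_ord0 mul0r.
  under eq_fun do rewrite big_ord_recr /=.
  by apply: lap0D => //; apply: lap0Z.
have iF N : integ (lebn n) (F N) by have [m1 i1 _] := hF N; exact: lap_integ.
have eF N : \int[lebn n]_w F N w = 0 by have [_ _ e1] := hF N; exact: e1.
have dom N w : `|F N w| <= `|k w| * expR (c * sqn w) * expR (normv v * normv w).
  rewrite /F !normrM (ger0_norm (expR_ge0 (dotv _ _))) ler_pM ?mulr_ge0 ?expR_ge0//.
    rewrite ler_wpM2l// (le_trans (exp_sum_norm _ _))// normrN ger0_norm//.
    by rewrite mulr_ge0// sqn_ge0.
  by rewrite ler_expR (le_trans (ler_norm _))// cauchy_schwarz.
have [_ c1] := dct (lebn n) F (fun w => k w * expR (- (c * sqn w)) * expR (dotv v w)) _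
  (fun N => integ_meas _ _ (iF N)) (ic (normv v)) dom
  (fun w => cvg_mulr _ _ _ (cvg_mull _ _ _ (cvg_exp_sum _))).
have c2 : (\int[lebn n]_w F N w) @[N --> \oo] --> (0 : R).
  by under eq_fun do rewrite eF; exact: cvg_cst.
exact: (cvg_unique _ c1 c2).
Qed.

(** The Gaussian damping is introduced one factor at a time: [ic] pays for a single expansion of
    strength [c], and it remains available after each step because the damped function is
    smaller. *)
Lemma lap0_lnull c k : 0 <= c ->
  (forall B, integ (lebn n) (fun w => `|k w| * expR (c * sqn w) * expR (B * normv w))) ->
  lap0 k -> lnull c k.
Proof.
move=> c0 ic hk m v.
suff : lap0 (fun w => k w * expR (- (m%:R * c * sqn w))).
  move=> [m1 i1 e1]; have E w : k w * gexp c m v w = k w * expR (- (m%:R * c * sqn w)) * expR (dotv v w).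
    by rewrite /gexp expRD mulrA.
  by split; [under eq_fun do rewrite E; exact: lap_integ|under eq_Rintegral do rewrite E].
elim: m => [|m IH].
  by have := hk; congr lap0; apply/funext => w; rewrite !mul0r oppr0 expR0 mulr1.
have mk : measurable_fun setT k by case: hk.
have : lap0 (fun w => k w * expR (- (m%:R * c * sqn w)) * expR (- (c * sqn w))).
  apply: lap0_gauss => // B; apply: (integ_le _ _ _ _ _ (ic B)) => [|w].
    have [mm _ _] := IH; apply: measurable_funM; last first.
      by apply: mexpR; apply: measurable_funM => //; apply: mnormv; exact: measurable_id.
    apply: measurable_funM; first exact: mnorm.
    by apply: mexpR; apply: measurable_funM => //; apply: msqn; exact: measurable_id.
  rewrite !normrM normr_id !(ger0_norm (expR_ge0 _)) ler_wpM2r ?expR_ge0//.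
  rewrite ler_wpM2r ?expR_ge0// ler_piMr//.
  by rewrite -[leRHS]expR0 ler_expR oppr_le0 !mulr_ge0// sqn_ge0.
congr lap0; apply/funext => w; rewrite -mulrA -expRD; congr (_ * expR _).
by rewrite -natr1; ring.
Qed.

(** Evaluated at [eps *: v], the convolution is a Laplace transform of [k * gk eps] up to a positive
    factor. With [c = 1 / (4 eps)], undoing half of the exponent leaves [gk (2 * eps)], which is the
    weight in the growth condition. *)
Lemma gauss_deconvolution (eps : R) k : 0 < eps -> measurable_fun setT k ->
  (forall B, integ (lebn n) (fun w => `|k w| * gk (2 * eps) w * expR (B * normv w))) ->
  (forall v, \int[lebn n]_w (k w * gk eps (v - w)) = 0) ->
  {ae lebn n, forall w, k w = 0}.
Proof.
move=> e0 mk ik ek; have c0 : 0 < (4 * eps)^-1 by rewrite invr_gt0 mulr_gt0.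
have gg w : gk eps w * expR ((4 * eps)^-1 * sqn w) = gk (2 * eps) w.
  by rewrite /gk -expRD; congr expR; field; rewrite gt_eqF.
have mg : measurable_fun setT (fun w : rvm R n => k w * gk eps w).
  by apply: measurable_funM => //; apply: measurable_gk; exact: measurable_id.
have ic B : integ (lebn n) (fun w => `|k w * gk eps w| * expR ((4 * eps)^-1 * sqn w) * expR (B * normv w)).
  have := ik B; congr (_.-integrable _ _); apply/funext => w /=.
  by rewrite normrM (ger0_norm (gk_ge0 n eps w)) -gg !mulrA.
suff h : lap0 (fun w => k w * gk eps w).
  have := lnull_ae0 _ c0 _ (lap0_lnull _ _ (ltW c0) ic h).
  apply: negligibleS => w /= kw; apply: contra_not kw => /eqP.
  by rewrite mulf_eq0 (gt_eqF (gk_gt0 n eps w)) orbF => /eqP.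
split => // [B|v].
  apply: (integ_le _ _ _ _ _ (ic B)) => [|w].
    apply: measurable_funM; first exact: mnorm.
    by apply: mexpR; apply: measurable_funM => //; apply: mnormv; exact: measurable_id.
  rewrite normrM normr_id (ger0_norm (expR_ge0 _)) ler_wpM2r ?expR_ge0// ler_peMr//.
  by rewrite -[leLHS]expR0 ler_expR mulr_ge0 ?sqn_ge0// ltW.
have := ek (eps *: v).
have E w : k w * gk eps (eps *: v - w) = expR (- (eps * sqn v) / 2) * (k w * gk eps w * expR (dotv v w)).
  rewrite /gk sqnB sqnZ dotvZl.
  have -> : - (eps ^+ 2 * sqn v - 2 * (eps * dotv v w) + sqn w) / (2 * eps) =
    - (eps * sqn v) / 2 + (- sqn w / (2 * eps) + dotv v w) by field; rewrite gt_eqF.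
  by rewrite !expRD; ring.
under eq_Rintegral do rewrite E.
rewrite (RintegralZl _ measurableT).
  by move=> /eqP; rewrite mulf_eq0 gt_eqF ?expR_gt0//= => /eqP.
apply: lap_integ => // B.
apply: (integ_le _ _ _ _ _ (ic B)) => [|w].
  apply: measurable_funM; first exact: mnorm.
  by apply: mexpR; apply: measurable_funM => //; apply: mnormv; exact: measurable_id.
rewrite normrM normr_id (ger0_norm (expR_ge0 _)) ler_wpM2r ?expR_ge0// ler_peMr//.
by rewrite -[leLHS]expR0 ler_expR mulr_ge0 ?sqn_ge0// ltW.
Qed.

End Deconvolution.

(** * Quadratic first variations *)

Section OpenBall.
Context {R : realType} {n : nat}.
Implicit Types v w : 'rV[R]_n.

Lemma gkC (s : R) v w : gk s (v - w) = gk s (w - v).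
Proof. by rewrite /gk -sqnN opprB. Qed.

Lemma measurable_ball v (e : R) : measurable ([set w | normv (v - w) < e] : set (rvm R n)).
Proof.
have mb : measurable_fun setT (fun w : rvm R n => normv (v - (w : 'rV[R]_n))).
  by apply: mnormv; apply: mrvB; [exact: measurable_cst|exact: measurable_id].
have -> : [set w | normv (v - w) < e] =
    setT `&` (fun w : rvm R n => normv (v - (w : 'rV[R]_n))) @^-1` `]-oo, e[%classic.
  by apply/seteqP; split => w /=; rewrite in_itv/=; [split|case].
by apply: mb => //; exact: measurable_itv.
Qed.

(* If the ball were null, a Gaussian of small variance centred at [v] would have all its
   mass where it is dominated by an exponentially small multiple of a Gaussian
   of twice the variance. *)
Lemma ball_gt0 v (e : R) : 0 < e -> (0 < lebn n [set w | (normv (v - w) < e)%R])%E.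
Proof.
move=> e0; rewrite lt_neqAle measure_ge0 andbT; apply/negP => /eqP z.
pose p : R := n%:R + 1; have p0 : 0 < p by rewrite ltr_wpDl.
pose s := e ^+ 2 / (4 * p); have s0 : 0 < s by rewrite divr_gt0 ?exprn_gt0 ?mulr_gt0.
have i2 := gauss_integ n (2 * s) v (mulr_gt0 (ltr0n _ 2) s0).
have i1 := gauss_integ n s v s0.
pose F (w : rvm R n) := expR (- p) * gk (2 * s) (v - (w : 'rV[R]_n)).
pose A := [set w : rvm R n | normv (v - (w : 'rV[R]_n)) < e].
have iF : integ (lebn n) F := integZ _ _ _ i2.
have out (w : rvm R n) : ~ A w -> gk s (v - (w : 'rV[R]_n)) <= F w.
  rewrite /A /= => /negP; rewrite -leNgt => ew; rewrite /F /gk -expRD ler_expR.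
  rewrite -normv_sqr; have : e ^+ 2 <= normv (v - w) ^+ 2.
    by rewrite lerXn2r ?nnegrE ?normv_ge0// ltW.
  move: (normv _) => x ex.
  have -> : - x ^+ 2 / (2 * s) = - x ^+ 2 / (4 * s) + - x ^+ 2 / (2 * (2 * s)).
    by field; rewrite gt_eqF.
  have s4 : 0 < 4 * s by rewrite mulr_gt0.
  rewrite lerD2r mulNr lerN2 (ler_pdivlMr _ _ s4).
  by rewrite (le_trans _ ex)// /s le_eqVlt; apply/orP; left; apply/eqP; field; rewrite gt_eqF.
clearbody s.
have mmin : measurable_fun setT (fun w : rvm R n => Num.min (gk s (v - (w : 'rV[R]_n))) (F w)).
  exact: (measurable_minr (integ_meas _ _ i1) (integ_meas _ _ iF)).
have : \int[lebn n]_w gk s (v - (w : 'rV[R]_n)) <= \int[lebn n]_w F w.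
  rewrite (ae_eq_Rintegral (lebn n) _ (fun w => Num.min (gk s (v - (w : 'rV[R]_n))) (F w))).
  - apply: le_Rintegral => //; last by move=> w _; rewrite ge_min lexx orbT.
    apply: (integ_le _ _ _ mmin _ i1) => w.
    by rewrite ger0_norm ?le_min ?gk_ge0 ?mulr_ge0 ?expR_ge0// ge_min lexx.
  - exact: integ_meas i1.
  - exact: mmin.
  exists A; split; [exact: measurable_ball|exact: esym z|].
  move=> w /= h; apply: contrapT => /out le; apply: h.
  by rewrite min_l.
rewrite RintegralZl// !gauss_Rintegral ?mulr_gt0//.
rewrite (_ : 2 * pi * (2 * s) = 2 * (2 * pi * s)); last by ring.
have q0 : 0 < 2 * pi * s :> R by rewrite !mulr_gt0// pi_gt0.
rewrite (_ : (2 * (2 * pi * s)) `^ _ = 2 `^ (n%:R / 2) * (2 * pi * s) `^ (n%:R / 2)); last first.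
  by apply: powRM => //; exact: ltW.
have qp : 0 < (2 * pi * s) `^ (n%:R / 2) by exact: powR_gt0.
rewrite mulrA ler_pMl// => h.
have h2 : (2 : R) `^ (n%:R / 2) <= expR (n%:R / 2).
  rewrite /powR pnatr_eq0 /= ler_expR ler_piMr ?divr_ge0//.
  have := @le_ln1Dx R 1; rewrite (_ : 1 + 1 = 2 :> R)//; apply; lra.
have := le_trans h (ler_wpM2l (expR_ge0 _) h2).
rewrite -expRD -[leLHS]expR0 ler_expR /p.
by have : (0 : R) <= n%:R by []; lra.
Qed.

(** If [k v] were nonzero, the Lipschitz bound would keep [k] away from 0 on a ball around [v], and
    balls have positive measure. The minimum with 1 in the radius bounds the norm on the ball. *)
Lemma ae0_eq0 (k : 'rV[R]_n -> R) K : 0 <= K ->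
  (forall v w, `|k v - k w| <= K * normv (v - w) * (1 + normv v + normv w)) ->
  {ae lebn n, forall w, k w = 0} -> forall v, k v = 0.
Proof.
move=> K0 kl [N [mN N0 kN]] v; apply: contrapT => /eqP kv.
have k0 : 0 < `|k v| by rewrite normr_gt0.
pose D := K * (2 + 2 * normv v) + 1; have D0 : 0 < D.
  by rewrite ltr_wpDl// mulr_ge0// addr_ge0// mulr_ge0// normv_ge0.
pose e := Num.min 1 (`|k v| / D); have e0 : 0 < e by rewrite lt_min ltr01 divr_gt0.
have := ball_gt0 v e e0; rewrite ltNge -N0 => /negP; apply.
apply: le_measure; rewrite ?inE//; first exact: measurable_ball.
move=> w /= we; apply: kN => /= kw.
have /andP[we1 we2] : (normv (v - w) < 1) && (normv (v - w) < `|k v| / D) by rewrite -lt_min.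
have nw : normv w <= normv v + normv (v - w).
  by rewrite -{1}[w](subKr v) (le_trans (ler_normvB _ _)).
have := kl v w; rewrite kw subr0 leNgt => /negP; apply.
rewrite ltr_pdivlMr// in we2.
have z0 := normv_ge0 (v - w); have v0 := normv_ge0 v.
apply: le_lt_trans we2; rewrite -mulrA mulrCA ler_wpM2l//.
apply: le_trans (_ : K * (2 + 2 * normv v) <= _); last by rewrite lerDl.
by rewrite ler_wpM2l//; lra.
Qed.

End OpenBall.

Section GaussianProduct.
Context {R : realType} {n : nat}.
Implicit Types (u v w : 'rV[R]_n).

(** Completing the square in [w]: [m] is the weighted mean of [u] and [v], and [s] the variance with
    [1 / s = 1 / T + 1 / e]. *)
Lemma convol_gk_gk (T e : R) u v : 0 < T -> 0 < e ->
  \int[lebn n]_w (gk T (u - (w : 'rV[R]_n)) * gk e (v - w)) =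
  (2 * pi * (T * e / (T + e))) `^ (n%:R / 2) * gk (T + e) (v - u).
Proof.
move=> T0 e0; have Te : 0 < T + e by rewrite addr_gt0.
pose s := T * e / (T + e); have s0 : 0 < s by rewrite divr_gt0 ?mulr_gt0.
pose m := (T + e)^-1 *: (e *: u + T *: v).
have E (w : rvm R n) : gk T (u - (w : 'rV[R]_n)) * gk e (v - w) =
    gk (T + e) (v - u) * gk s (m - (w : 'rV[R]_n)).
  rewrite /gk -!expRD; congr expR; rewrite /m !sqnB !sqnZ sqnD !sqnZ !dotvZl dotvDl !dotvZl.
  rewrite dotvZr (dotvC v u) /s; move: (sqn u) (sqn v) (sqn w) (dotv u v) (dotv u w) (dotv v w).
  move=> a b c x y z; field.
  by rewrite !gt_eqF.
under eq_Rintegral do rewrite E.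
by rewrite RintegralZl ?gauss_Rintegral 1?mulrC//; exact: gauss_integ.
Qed.

End GaussianProduct.

(** * From a quadratic first variation to a Maxwellian *)

Section QuadraticMaxwellian.
Context {R : realType} {n : nat}.
Variables (eps : R) (f : rvm R n -> R).
Hypothesis eps0 : 0 < eps.
Hypothesis f0 : forall v, 0 <= f v.
Hypothesis fi : integ (lebn n) f.
Hypothesis fi2 : integ (lebn n) (fun v => f v * sqn v).
Hypothesis mass : 0 < \int[lebn n]_w f w.
Variables (l0 l2 : R) (l1 : 'rV[R]_n).
Hypothesis dEq : forall v, dE eps f v = l0 + dotv l1 v + l2 / 2 * sqn v.

Let mf : measurable_fun setT f := integ_meas _ _ fi.
Let L := lnm eps f.
Let mL : measurable_fun setT L := measurable_lnm eps f eps0 f0 fi.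
(** The quadratic whose convolution with [psi eps] is [dE]: its constant is lowered by what
    [convol_psi_quadratic] adds. For [l2 < 0] this correction is the term with [eps * |l2| * d / 2]
    in [rho_of]. *)
Let q (v : 'rV[R]_n) : R := (l0 - l2 / 2 * (n%:R * eps)) + dotv l1 v + l2 / 2 * sqn v.

Let mq : measurable_fun setT (q : rvm R n -> R).
Proof.
apply: measurable_funD.
  apply: measurable_funD; first exact: measurable_cst.
  by apply: mdotv; [exact: measurable_cst|exact: measurable_id].
by apply: measurable_funM; [exact: measurable_cst|apply: msqn; exact: measurable_id].
Qed.

Let q_growth v : `|q v| <= (`|l0 - l2 / 2 * (n%:R * eps)| + normv l1 + `|l2|) * (1 + sqn v).
Proof.
rewrite /q (le_trans (ler_normD _ _))// (le_trans (lerD (ler_normD _ _) (lexx _)))//.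
have h1 := cauchy_schwarz l1 v; have h2 := normv_le1 v; have s0 := sqn_ge0 v.
have h3 : `|dotv l1 v| <= normv l1 * (1 + sqn v).
  by rewrite (le_trans h1)// ler_wpM2l// normv_ge0.
have h4 : `|l2 / 2 * sqn v| <= `|l2| * (1 + sqn v).
  rewrite !normrM (ger0_norm s0) normfV normr_nat -mulrA ler_wpM2l//; lra.
rewrite !mulrDl lerD// ?lerD//.
by rewrite ler_peMr// lerDl.
Qed.

Let gk_exp_integ (k : rvm R n -> R) D : measurable_fun setT k ->
  (forall w, `|k w| <= D * (1 + sqn w)) ->
  forall B, integ (lebn n) (fun w => `|k w| * gk (2 * eps) w * expR (B * normv w)).
Proof.
move=> mk kD B; have e2 : 0 < 2 * eps by rewrite mulr_gt0.
have [C C0 HC] := @poly_exp_gk R n (2 * eps) B e2.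
have ig : integ (lebn n) (fun w : rvm R n => `|D| * (C * gk (8 * (2 * eps)) w)).
  by apply: integZ; apply: integZ; apply: gk_integ; rewrite mulr_gt0.
apply: (integ_le _ _ _ _ _ ig) => [|w].
  apply: measurable_funM.
    apply: measurable_funM; first exact: mnorm.
    by apply: measurable_gk; exact: measurable_id.
  by apply: mexpR; apply: measurable_funM => //; apply: mnormv; exact: measurable_id.
rewrite !normrM normr_id (ger0_norm (expR_ge0 _)) (ger0_norm (gk_ge0 n (2 * eps) w)).
apply: le_trans (ler_wpM2l (normr_ge0 D) (HC w)); rewrite !mulrA.
rewrite ler_wpM2r ?expR_ge0// ler_wpM2r ?gk_ge0// (le_trans (kD w))// -mulrA.
have s0 := sqn_ge0 w; have s1 : 1 + sqn w <= (1 + sqn w) * (1 + sqn w) by nra.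
by apply: le_trans (ler_wpM2l (normr_ge0 D) s1); rewrite ler_wpM2r ?addr_ge0// ler_norm.
Qed.

(** Deconvolution gives equality almost everywhere; both sides obey the same kind of Lipschitz
    bound, so [ae0_eq0] extends it to every point. *)
Lemma lnm_quadratic v : L v = q v.
Proof.
have [D D0 LD] := lnm_growth eps f eps0 f0 fi fi2 mass.
have [M M0 LM] := lnm_lipschitz eps f eps0 f0 fi fi2 mass.
apply/eqP; rewrite -subr_eq0; apply/eqP; move: v.
apply: (ae0_eq0 (fun v => L v - q v) (M + normv l1 + `|l2|)).
- by rewrite !addr_ge0// normv_ge0.
- move=> v w; have -> : L v - q v - (L w - q w) = (L v - L w) - (q v - q w) by ring.
  rewrite (le_trans (ler_normB _ _))//.
  have qE : q v - q w = dotv l1 (v - w) + l2 / 2 * dotv (v - w) (v + w).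
    by rewrite /q dotvBr dotvBl !dotvDr -!/(sqn _) (dotvC w v) /sqn; ring.
  have h1 := cauchy_schwarz l1 (v - w).
  have h2 := cauchy_schwarz (v - w) (v + w); have h3 := ler_normvD v w.
  have z0 := normv_ge0 (v - w); have v0 := normv_ge0 v; have w0 := normv_ge0 w.
  have h4 : `|q v - q w| <= (normv l1 + `|l2|) * normv (v - w) * (1 + normv v + normv w).
    rewrite qE (le_trans (ler_normD _ _))// mulrDl mulrDl lerD//.
      rewrite (le_trans h1)// ler_peMr ?mulr_ge0 ?normv_ge0//; lra.
    rewrite normrM (normrM l2) normfV normr_nat -!mulrA ler_wpM2l//.
    have := le_trans h2 (ler_wpM2l z0 h3) => h5.
    have : 0 <= normv (v - w) * (normv v + normv w) by rewrite mulr_ge0 ?addr_ge0.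
    by move: h5; rewrite !mulrDr mulr1; lra.
  rewrite (le_trans (lerD (LM v w) h4))// -!mulrDl addrA.
  by [].
apply: (gauss_deconvolution eps) => //.
- exact: measurable_funB.
- apply: (gk_exp_integ _ (D + (`|l0 - l2 / 2 * (n%:R * eps)| + normv l1 + `|l2|))).
    exact: measurable_funB.
  by move=> w; rewrite (le_trans (ler_normB _ _))// mulrDl lerD.
move=> v; have qD w : `|q w| <= _ := q_growth w.
have iL := conv_integ eps D L eps0 mL LD (psi eps) v (gker_psi eps).
have iq := conv_integ eps _ (q : rvm R n -> R) eps0 mq qD (psi eps) v (gker_psi eps).
have c1 := dEq v; rewrite (dE_convol eps f eps0 f0 fi fi2 mass) in c1.
have c2 := convol_psi_quadratic eps eps0 (l0 - l2 / 2 * (n%:R * eps)) (l2 / 2) l1 v.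
have h : \int[lebn n]_w (psi eps (v - (w : 'rV[R]_n)) * L w - psi eps (v - (w : 'rV[R]_n)) * q w) = 0.
  rewrite RintegralB// -[X in X - _]/(convol (psi eps) L v) -[X in _ - X]/(convol (psi eps) q v).
  by rewrite c1 c2; ring.
have cp := cpsi_gt0 (n := n) eps eps0.
have E (w : rvm R n) : (L w - q w) * gk eps (v - w) =
    (cpsi n eps)^-1 * (psi eps (v - (w : 'rV[R]_n)) * L w - psi eps (v - (w : 'rV[R]_n)) * q w).
  by rewrite psiE; field; rewrite gt_eqF.
under eq_Rintegral do rewrite E.
by rewrite RintegralZl ?h ?mulr0//; exact: integB.
Qed.

Lemma gconv_quadratic v : cpsi n eps * gconv eps f v = expR (q v).
Proof.
have p0 : 0 < cpsi n eps * gconv eps f v.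
  by rewrite mulr_gt0 ?cpsi_gt0//; exact: gconv_gt0.
rewrite -(lnK p0) -(molliE eps f eps0 f0 fi); congr expR; exact: lnm_quadratic.
Qed.

Let cp0 : 0 < cpsi n eps := cpsi_gt0 eps eps0.

Lemma gconvE v : gconv eps f v = (cpsi n eps)^-1 * expR (q v).
Proof. by rewrite -gconv_quadratic mulKf// gt_eqF. Qed.

Lemma gconv_along_cvg0 (e : 'rV[R]_n) : sqn e = 1 ->
  (fun j : nat => gconv eps f (j%:R *: e)) @ \oo --> (0 : R).
Proof.
move=> e1; have dom (j : nat) (w : rvm R n) : `|f w * gk eps (j%:R *: e - w)| <= f w.
  by rewrite normrM (ger0_norm (f0 w)) (ger0_norm (gk_ge0 n eps _)) ler_piMr// gk_le1.
have pw (w : rvm R n) : (fun j : nat => f w * gk eps (j%:R *: e - w)) @ \oo --> (0 : R).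
  (* The constant comes from [|j e - w|^2 >= j^2 / 2 - |w|^2] and [j^2 / (4 eps) >= j - eps], which
     leave a decay [expR (- j)]. *)
  apply: (cvg_dist_harmonic _ _ (f w * expR (sqn w / (2 * eps) + eps))) => j.
  rewrite subr0 normrM (ger0_norm (f0 w)) (ger0_norm (gk_ge0 n eps _)) -mulrA ler_wpM2l//.
  have hj : expR (- j%:R) <= (1 + j%:R)^-1 :> R by exact: expRN_le_inv.
  apply: le_trans (ler_wpM2l (expR_ge0 _) hj); rewrite -expRD /gk ler_expR.
  have := sqnD_le (j%:R *: e - w) w; rewrite subrK sqnZ e1 mulr1.
  move: (sqn (j%:R *: e - (w : 'rV[R]_n))) (sqn w) (j%:R : R) => S W x h.
  have e20 : 0 < 2 * eps by rewrite mulr_gt0.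
  have -> : W / (2 * eps) + eps + - x = (W + 2 * eps ^+ 2 - 2 * eps * x) / (2 * eps).
    by field; rewrite gt_eqF.
  by rewrite ler_wpM2r ?invr_ge0 ?(ltW e20)//; have := sqr_ge0 (x - 2 * eps); nra.
have [_ c1] := dct (lebn n) (fun (j : nat) (w : rvm R n) => f w * gk eps (j%:R *: e - w))
  (fun=> 0) f (fun j => integ_meas _ _ (gconv_integ eps f eps0 f0 fi _)) fi dom pw.
have I0 : \int[lebn n]_w 0 = 0 :> R by rewrite /Rintegral integral0.
by rewrite I0 in c1.
Qed.

(* [gconv] vanishes at infinity, while [q w + q (- w)] is bounded below if [0 <= l2]. *)
Lemma quadratic_coefficient_lt0 : (0 < n)%N -> l2 < 0.
Proof.
move=> n0; rewrite ltNge; apply/negP => l20.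
pose e : 'rV[R]_n := unitv (Ordinal n0); have e1 : sqn e = 1 by exact: sqn_unitv.
have e1' : sqn (- e) = 1 by rewrite sqnN.
have c0 : (fun j : nat => gconv eps f (j%:R *: e) + gconv eps f (j%:R *: - e)) @ \oo --> (0 : R).
  by rewrite -[X in _ --> X](addr0 (0 : R)); apply: cvgD; exact: gconv_along_cvg0.
have b j : 2 * expR (q 0) / cpsi n eps <= gconv eps f (j%:R *: e) + gconv eps f (j%:R *: - e).
  rewrite !gconvE -mulrDr [leLHS]mulrC ler_wpM2l ?invr_ge0 ?(ltW cp0)//.
  set x := q (j%:R *: e); set y := q (j%:R *: - e).
  have xy : 2 * q 0 <= x + y.
    rewrite /x /y /q !dotvZr dotvNr !sqnZ e1 e1' dotv0r sqn0.
    have : 0 <= l2 / 2 * (j%:R ^+ 2 * 1) by rewrite !mulr_ge0 ?sqr_ge0// invr_ge0.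
    lra.
  have h1 := expR_ge1Dx (x - q 0); have h2 := expR_ge1Dx (y - q 0).
  have -> : expR x = expR (q 0) * expR (x - q 0) by rewrite -expRD addrC subrK.
  have -> : expR y = expR (q 0) * expR (y - q 0) by rewrite -expRD addrC subrK.
  rewrite -mulrDr [leLHS]mulrC ler_wpM2l ?expR_ge0//; lra.
have p0 : 0 < 2 * expR (q 0) / cpsi n eps by rewrite divr_gt0// mulr_gt0// expR_gt0.
have /cvgrPdist_lt /(_ _ p0) [N _ /(_ N (leqnn N))] := c0.
rewrite /= sub0r normrN ltNge => /negP; apply.
by rewrite (le_trans (b N))// ler_norm.
Qed.

Lemma measurable_coord_hyperplane (i : 'I_n) (a : R) :
  measurable ([set w | w ord0 i = a] : set (rvm R n)).
Proof.
rewrite -[X in measurable X]setTI.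
exact: (measurable_coord n i measurableT [set a] (measurable_set1 _)).
Qed.

(** A hyperplane of positive measure would, by the identity theorem for the entire function
    [v_i - a], be the whole space. *)
Lemma hyperplane_null (i : 'I_n) (a : R) : lebn n [set w | w ord0 i = a] = 0%E.
Proof.
apply: contrapT => /eqP h; have z : (0 < lebn n [set w | w ord0 i = a])%E.
  by rewrite lt_neqAle measure_ge0 andbT eq_sym.
have H : forall v : 'rV[R]_n, v ord0 i - a = 0.
  apply: (lentire_identity n (fun v => v ord0 i - a)).
  - by apply: measurable_funB => //; exact: measurable_coord.
  - move=> v k; have := entireD _ _ (entire_cst (v ord0 i - a))
      (entire_mulx _ (entire_cst (unitv k ord0 i : R))).
    by congr entire; apply/funext => s; rewrite !mxE; ring.
  apply: lt_le_trans z _; rewrite le_eqVlt; apply/orP; left; apply/eqP; congr (lebn n _).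
  by apply/seteqP; split => v /= hv; [rewrite hv subrr|exact: subr0_eq].
have := H (a *: unitv i + unitv i).
by rewrite !mxE eqxx mulr1 addrAC subrr add0r => /eqP; rewrite oner_eq0.
Qed.

Lemma cosh2E (x : R) : expR x + expR (- x) - 2 = (expR (x / 2) - expR (- (x / 2))) ^+ 2.
Proof.
have e1 : expR (x / 2) * expR (- (x / 2)) = 1 by rewrite -expRD subrr expR0.
have e2 : expR x = expR (x / 2) ^+ 2 by rewrite -expRM_natl; congr expR; field.
have e3 : expR (- x) = expR (- (x / 2)) ^+ 2 by rewrite -expRM_natl; congr expR; field.
by rewrite e2 e3 sqrrB e1; ring.
Qed.

Let qE s (i : 'I_n) : s ^+ 2 = 1 -> q (s *: unitv i) = q 0 + s * l1 ord0 i + l2 / 2.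
Proof.
move=> s1; rewrite /q dotvZr dotv_unitr sqnZ s1 sqn_unitv dotv0r sqn0; ring.
Qed.

(* Tilting [f] by the Gaussian turns the assumption into a moment identity in
   which [cosh - 1] has a nonpositive mean unless [eps * `|l2| < 1]. *)
Lemma quadratic_coefficient_bound : (0 < n)%N -> eps * `|l2| < 1.
Proof.
move=> n0; have l20 := quadratic_coefficient_lt0 n0.
rewrite ltr0_norm// ltNge; apply/negP => hl.
pose i := Ordinal n0; pose e : 'rV[R]_n := unitv i.
pose a := eps * l1 ord0 i.
pose k (w : rvm R n) := f w * gk eps w.
pose X (w : rvm R n) := ((w : 'rV[R]_n) ord0 i - a) / eps.
pose D (w : rvm R n) := k w * (expR (X w) + expR (- X w) - 2).
pose G (v : 'rV[R]_n) (w : rvm R n) := f w * gk eps (v - w).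
(* Chosen so that [C s * G (s *: e)] is [k * expR (s * X)] for [s = 1] and [s = -1]. The integral of
   [D] thus combines three values of [gconv], and the shift by [a] in [X] cancels the linear part of
   [q]. *)
pose C (s : R) := expR ((2 * eps)^-1 - s * l1 ord0 i).
have iG v : integ (lebn n) (G v) := gconv_integ eps f eps0 f0 fi v.
have T s (w : rvm R n) : s ^+ 2 = 1 -> C s * G (s *: e) w = k w * expR (s * X w).
  move=> s1; rewrite /C /G /k /gk [LHS]mulrCA -mulrA -!expRD; congr (_ * expR _).
  rewrite sqnB sqnZ s1 sqn_unitv dotvZl dotv_unitl /X /a.
  by move: (sqn w) ((w : 'rV[R]_n) ord0 i) (l1 ord0 i) => x y z; field; rewrite gt_eqF.
have s1 : (1 : R) ^+ 2 = 1 by rewrite expr1n.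
have sN1 : (-1 : R) ^+ 2 = 1 by rewrite sqrrN expr1n.
have DE (w : rvm R n) : D w = C 1 * G (1 *: e) w + C (-1) * G (-1 *: e) w - 2 * G 0 w.
  have g0 : G 0 w = k w by rewrite /G /k -(gkC eps w 0) subr0.
  rewrite (T _ _ s1) (T _ _ sN1) g0 mul1r mulN1r /D; ring.
have iD : integ (lebn n) D.
  rewrite (funext DE : D = _).
  by apply: integB; [apply: integD; exact: integZ|exact: integZ].
have D0 w : 0 <= D w.
  by rewrite /D cosh2E mulr_ge0 ?sqr_ge0//; apply: mulr_ge0 => //; exact: gk_ge0.
have ID : \int[lebn n]_w D w <= 0.
  rewrite (funext DE : D = _).
  rewrite RintegralB//; [|by apply: integD; exact: integZ|exact: integZ].
  rewrite RintegralD//; [|exact: integZ|exact: integZ].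
  rewrite !(RintegralZl _ measurableT (iG _)).
  have gE v : \int[lebn n]_w G v w = (cpsi n eps)^-1 * expR (q v) := gconvE v.
  rewrite !gE !qE//; rewrite /C.
  have -> : expR ((2 * eps)^-1 - 1 * l1 ord0 i) * ((cpsi n eps)^-1 * expR (q 0 + 1 * l1 ord0 i + l2 / 2)) =
      (cpsi n eps)^-1 * expR (q 0) * expR ((2 * eps)^-1 + l2 / 2).
    by rewrite mulrCA -expRD -mulrA -expRD; congr (_ * expR _); ring.
  have -> : expR ((2 * eps)^-1 - -1 * l1 ord0 i) * ((cpsi n eps)^-1 * expR (q 0 + -1 * l1 ord0 i + l2 / 2)) =
      (cpsi n eps)^-1 * expR (q 0) * expR ((2 * eps)^-1 + l2 / 2).
    by rewrite mulrCA -expRD -mulrA -expRD; congr (_ * expR _); ring.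
  (* The assumption to be refuted, [eps * |l2| >= 1], says that this exponent is nonpositive. *)
  have h : expR ((2 * eps)^-1 + l2 / 2) <= 1.
    rewrite -[leRHS]expR0 ler_expR invfM.
    have : eps^-1 <= - l2 by rewrite -[leLHS]mul1r ler_pdivrMr// mulrC.
    lra.
  have c0 : 0 <= (cpsi n eps)^-1 * expR (q 0) by rewrite mulr_ge0 ?expR_ge0// invr_ge0 ltW.
  move: h c0; move: (expR (_ + _)) (_ * expR (q 0)) => y c h c0; nra.
have I0 : \int[lebn n]_w D w = 0.
  by apply/eqP; rewrite eq_le ID /=; apply: Rintegral_ge0.
have ae0 := Rintegral_eq0 _ _ iD D0 I0.
suff e0 : \int[lebn n]_w f w = \int[lebn n]_w 0.
  by move: mass; rewrite e0 /Rintegral integral0 ltxx.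
apply: ae_eq_Rintegral => //.
(* [D = 0] forces [f = 0] or [X = 0], and the latter is a hyperplane; so [f] would vanish almost
   everywhere, against its positive mass. *)
have nh : (lebn n).-negligible [set w : rvm R n | (w : 'rV[R]_n) ord0 i = a].
  exists [set w : rvm R n | (w : 'rV[R]_n) ord0 i = a].
  by split => //; [exact: measurable_coord_hyperplane|exact: hyperplane_null].
apply: negligibleS (negligibleU ae0 nh) => w /= fw.
have [wa|wa] := eqVneq ((w : 'rV[R]_n) ord0 i) a; [by right|left => Dw; apply: fw].
move: Dw; rewrite /D cosh2E => /eqP; rewrite mulf_eq0 sqrf_eq0 => /orP[|/eqP].
  by rewrite /k mulf_eq0 (gt_eqF (gk_gt0 n eps w)) orbF => /eqP.
move/subr0_eq/expR_inj => h; exfalso.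
have X0 : X w = 0 by move: (X w) h => x; lra.
move/eqP: X0; rewrite /X mulf_eq0 invr_eq0 (gt_eqF eps0) orbF subr_eq0.
by rewrite (negbTE wa).
Qed.

Let rho := rho_of n eps l0 l1 l2.
Let u := u_of l1 l2.
Let T := T_of eps l2.

Lemma T_of_gt0 : (0 < n)%N -> 0 < T_of eps l2.
Proof.
move=> n0; rewrite /T_of subr_gt0; have l20 := quadratic_coefficient_lt0 n0.
have a0 : 0 < `|l2| by rewrite normr_gt0 lt_eqF.
by rewrite -[X in _ < X]mul1r ltr_pdivlMr//; exact: quadratic_coefficient_bound.
Qed.

Lemma maxwellianE (r t : R) (c v : 'rV[R]_n) :
  maxwellian r c t v = r * (2 * pi * t) `^ (- (n%:R / 2)) * gk t (c - v).
Proof. by rewrite gkC. Qed.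

Lemma maxwellian_integ (r t : R) (c : 'rV[R]_n) : 0 < t ->
  integ (lebn n) (maxwellian r c t : rvm R n -> R).
Proof.
move=> t0; have := integZ _ (r * (2 * pi * t) `^ (- (n%:R / 2))) _ (gauss_integ n t c t0).
by congr (_.-integrable _ _); apply/funext => v /=; rewrite maxwellianE.
Qed.

Lemma powR_gauss_ratio (p x y z t : R) : 0 < x -> 0 < y -> 0 < z -> 0 < t ->
  x * y = z * t -> x `^ p * y `^ p * z `^ (- p) * t `^ (- p) = 1.
Proof.
move=> x0 y0 z0 t0 e; rewrite -(powRM _ (ltW x0) (ltW y0)) e (powRM _ (ltW z0) (ltW t0)) !powRN.
by field; rewrite !gt_eqF// powR_gt0.
Qed.

(** Variances add up to [T + eps = 1 / |l2|], and the exponent in [rho_of] is the constant left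
    after completing the square in [q] around [u]. *)
Lemma convol_maxwellian v : (0 < n)%N ->
  \int[lebn n]_w (maxwellian rho u T w * gk eps (v - w)) = (cpsi n eps)^-1 * expR (q v).
Proof.
move=> n0; have T0 : 0 < T by exact: T_of_gt0.
have l20 := quadratic_coefficient_lt0 n0.
pose a := `|l2|; have a0 : 0 < a by rewrite normr_gt0 lt_eqF.
have l2a : l2 = - a by rewrite /a ltr0_norm// opprK.
have Ta : T + eps = a^-1 by rewrite /T /T_of subrK.
have b0 : 0 < 1 - eps * a by rewrite subr_gt0; exact: quadratic_coefficient_bound.
have E (w : rvm R n) : maxwellian rho u T w * gk eps (v - (w : 'rV[R]_n)) =
    rho * (2 * pi * T) `^ (- (n%:R / 2)) * (gk T (u - (w : 'rV[R]_n)) * gk eps (v - w)).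
  by rewrite maxwellianE mulrA.
under eq_Rintegral do rewrite E.
rewrite RintegralZl//; last first.
  apply: (integ_le _ _ _ _ _ (gauss_integ n T u T0)) => [|w].
    apply: measurable_funM; apply: measurable_gk; apply: mrvB;
      by [exact: measurable_cst|exact: measurable_id].
  rewrite normrM (ger0_norm (gk_ge0 n T _)) (ger0_norm (gk_ge0 n eps _)).
  by rewrite ler_piMr ?gk_ge0// gk_le1.
rewrite convol_gk_gk// Ta.
have p0 := pi_gt0 R.
(* The prefactors of [rho], of the product of Gaussians, of the Maxwellian and of [psi] cancel,
   since [2 pi / a] times [2 pi T eps a] equals [2 pi T] times [2 pi eps]. *)
have H := powR_gauss_ratio (n%:R / 2) (2 * pi / a) (2 * pi * (T * eps / a^-1)) (2 * pi * T) (2 * pi * eps).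
have {}H := H (ltac:(by rewrite divr_gt0// mulr_gt0)) (ltac:(by rewrite !mulr_gt0// invr_gt0 invr_gt0))
  (ltac:(by rewrite !mulr_gt0)) (ltac:(by rewrite !mulr_gt0)) (ltac:(by field; rewrite gt_eqF)).
have Q : expR (l0 + eps * a * n%:R / 2 - eps * sqn l1 / (2 * (1 - eps * a)) +
    sqn l1 / (2 * a * (1 - eps * a))) * gk a^-1 (v - u) = expR (q v).
  rewrite /gk -expRD; congr expR; rewrite /u /u_of -/a /q l2a sqnB dotvZr sqnZ (dotvC v).
  move: (sqn v) (sqn l1) (dotv l1 v) => x y z; field.
  by rewrite !gt_eqF.
have c1 : (2 * pi * eps) `^ (- (n%:R / 2)) = cpsi n eps by [].
rewrite c1 in H; rewrite -Q.
apply: (mulfI (lt0r_neq0 cp0)); rewrite mulrA mulVKf ?gt_eqF//.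
rewrite /rho /rho_of -/a; move: H.
move: (expR (_ + _)) (gk _ _) ((2 * pi / a) `^ _) ((2 * pi * (T * eps / a^-1)) `^ _).
move: ((2 * pi * T) `^ _) (cpsi n eps) => Z c X g A S H.
by rewrite -[RHS]mul1r; transitivity (A * S * Z * c * (X * g)); [ring|rewrite H].
Qed.

(** [f] and the Maxwellian have the same convolution with [gk eps]. Both are integrable, and
    [gk (2 * eps) w * expR (B * normv w)] is bounded, so their difference meets the growth condition
    of the deconvolution. *)
Lemma quadratic_maxwellian : (0 < n)%N ->
  [/\ l2 != 0, eps * `|l2| < 1 &
   iint n (fun v => (`|f v - maxwellian rho u T v|)%:E) = 0%E].
Proof.
move=> n0; have T0 : 0 < T by exact: T_of_gt0.
split; [by rewrite lt_eqF// quadratic_coefficient_lt0|exact: quadratic_coefficient_bound|].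
have iM := maxwellian_integ rho T u T0.
have ik := integB _ _ _ fi iM.
pose k (w : rvm R n) := f w - maxwellian rho u T w.
have mk : measurable_fun setT k := integ_meas _ _ ik.
have e2 : 0 < 2 * eps by rewrite mulr_gt0.
have ae0 : {ae lebn n, forall w, k w = 0}.
  apply: (gauss_deconvolution eps) => // [B|v].
    have [C C0 HC] := @poly_exp_gk R n (2 * eps) B e2.
    apply: (integ_le _ _ _ _ _ (integZ _ C _ (integ_norm _ _ ik))) => [|w].
      apply: measurable_funM.
        apply: measurable_funM; first exact: mnorm.
        by apply: measurable_gk; exact: measurable_id.
      by apply: mexpR; apply: measurable_funM => //; apply: mnormv; exact: measurable_id.
    rewrite !normrM normr_id (ger0_norm (expR_ge0 _)) (ger0_norm (gk_ge0 n (2 * eps) w)).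
    rewrite -mulrA mulrC ler_wpM2r//.
    have g1 : gk (8 * (2 * eps)) w <= 1 by apply: gk_le1; rewrite mulr_gt0.
    apply: le_trans (_ : C * gk (8 * (2 * eps)) w <= _); last by rewrite ler_piMr.
    apply: le_trans (HC w); rewrite ler_wpM2r ?expR_ge0// ler_peMl ?gk_ge0//.
    by rewrite exprn_ege1// lerDl sqn_ge0.
  have E (w : rvm R n) : k w * gk eps (v - (w : 'rV[R]_n)) =
      f w * gk eps (v - w) - maxwellian rho u T w * gk eps (v - w) by rewrite /k mulrBl.
  under eq_Rintegral do rewrite E.
  rewrite RintegralB//; first last.
  - apply: (integ_le _ _ _ _ _ (integ_norm _ _ iM)) => [|w].
      apply: measurable_funM; first exact: integ_meas iM.
      by apply: measurable_gk; apply: mrvB; [exact: measurable_cst|exact: measurable_id].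
    by rewrite normrM (ger0_norm (gk_ge0 n eps _)) ler_piMr// gk_le1.
  - exact: gconv_integ.
  by rewrite convol_maxwellian// -gconvE subrr.
rewrite (ge0_iintE n (fun v => (`|k v|)%:E)).
- have mE : measurable_fun setT (EFin \o k) by exact/measurable_EFinP.
  apply: (ae_eq_integral_abs (lebn n) measurableT mE).2.
  by apply: negligibleS ae0 => w /= h H; apply: h => _; rewrite H.
- by apply/measurable_EFinP; exact: mnorm.
- by move=> v; rewrite lee_fin.
Qed.

End QuadraticMaxwellian.

(** * Stationary states *)

Section Weighted.
Context {R : realType} {n : nat}.
Implicit Types (g : rvm R n -> R).

Lemma iint0 k (F : rvm R k -> \bar R) : (forall v, F v = 0%E) -> iint k F = 0%E.
Proof.
move=> F0; rewrite (funext F0 : F = cst 0%E) ge0_iintE//; exact: integral0.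
Qed.

Lemma rv_measurableE g : rv_measurable g -> measurable_fun setT g.
Proof. by move=> mg _ B mB; rewrite setTI; exact: mg. Qed.

Lemma weight_ge1 (k : R) (v : 'rV[R]_n) : 1 <= 1 + normv v `^ k.
Proof. by rewrite lerDl powR_ge0. Qed.

Lemma sqn_le_weight (k : R) (v : 'rV[R]_n) : 2 <= k -> sqn v <= 1 + normv v `^ k.
Proof.
move=> k2; rewrite -normv_sqr; have := normv_ge0 v; move: (normv v) => x x0.
have [x1|x1] := leP x 1.
  apply: le_trans (_ : 1 <= _); last by rewrite lerDl powR_ge0.
  by rewrite expr_le1.
apply: le_trans (_ : x `^ k <= _); last by rewrite lerDr.
by rewrite -powR_mulrn// ler_powR// ltW.
Qed.

Lemma measurable_weight (k : R) :
  measurable_fun setT (fun v : rvm R n => 1 + normv v `^ k : R).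
Proof.
apply: measurable_funD; first exact: measurable_cst.
apply: (measurableT_comp (measurable_powR k)).
by apply: mnormv; exact: measurable_id.
Qed.

Lemma weighted_iintE k g : measurable_fun setT g ->
  iint n (fun v => ((1 + normv v `^ k) * `|g v|)%:E) =
  (\int[lebn n]_v ((1 + normv v `^ k) * `|g v|)%:E)%E.
Proof.
move=> mg; apply: ge0_iintE => [|v]; last by rewrite lee_fin mulr_ge0// (le_trans _ (weight_ge1 _ _)).
apply/measurable_EFinP; apply: measurable_funM; [exact: measurable_weight|exact: mnorm].
Qed.

Lemma weighted_integ k g : measurable_fun setT g ->
  (iint n (fun v => ((1 + normv v `^ k) * `|g v|)%:E) < +oo)%E ->
  integ (lebn n) (fun v => (1 + normv v `^ k) * `|g v|).
Proof.
move=> mg; rewrite weighted_iintE// => fin; apply/integrableP; split.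
  by apply/measurable_EFinP; apply: measurable_funM; [exact: measurable_weight|exact: mnorm].
move: fin; congr (_ < _)%E; apply: eq_integral => v _ /=.
congr EFin; rewrite [RHS]ger0_norm// mulr_ge0//; exact: le_trans (weight_ge1 _ _).
Qed.

End Weighted.

Section Stationary.
Context {R : realType} {n : nat}.
Variables (gamma eps Tf : R) (f : R -> 'rV[R]_n -> R).
Hypothesis hgamma : -4 <= gamma <= 0.
Hypothesis eps0 : 0 < eps.
Hypothesis Tf0 : 0 < Tf.
Hypothesis hf : dissipative_sol gamma eps Tf f.

Let f0 t v : 0 <= t <= Tf -> 0 <= f t v.
Proof. by have [[h _] _] := hf => tT; exact: h. Qed.

Let mf t : 0 <= t <= Tf -> measurable_fun setT (f t : rvm R n -> R).
Proof. by have [[_ [[h _] _]] _] := hf => tT; apply: rv_measurableE; exact: (h t tT).1. Qed.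

Let fk t : 0 <= t <= Tf -> integ (lebn n) (fun v => (1 + normv v `^ kappa gamma) * f t v).
Proof.
move=> tT; have [[_ [[h _] _]] _] := hf.
have := weighted_integ _ _ (mf t tT) (h t tT).2.
by congr (_.-integrable _ _); apply/funext => v /=; rewrite ger0_norm// f0.
Qed.

Let fi t : 0 <= t <= Tf -> integ (lebn n) (f t : rvm R n -> R).
Proof.
move=> tT; apply: (integ_le _ _ _ (mf t tT) _ (fk t tT)) => v.
by rewrite ger0_norm ?f0// ler_peMl ?f0// weight_ge1.
Qed.

Let fi2 t : 0 <= t <= Tf -> integ (lebn n) (fun v => f t v * sqn v).
Proof.
move=> tT; apply: (integ_le _ _ _ _ _ (fk t tT)) => [|v].
  by apply: measurable_funM; [exact: mf|apply: msqn; exact: measurable_id].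
rewrite ger0_norm ?mulr_ge0 ?f0 ?sqn_ge0// mulrC ler_wpM2r ?f0//.
by apply: sqn_le_weight; exact: kappa_ge2.
Qed.

(** The time derivative of moments is given on the open interval only; continuity on the closed one,
    from the weighted norm whose weight is at least 1, carries constancy to the endpoints. *)
Lemma moment_continuous (phi : 'rV[R]_n -> R) K :
  measurable_fun setT (phi : rvm R n -> R) -> (forall v, `|phi v| <= K) ->
  {within `[0, Tf], continuous (fun s => rint (fun v => phi v * f s v))}.
Proof.
move=> mphi phiK; have K0 : 0 <= K by apply: le_trans (phiK 0).
have ip s : 0 <= s <= Tf -> integ (lebn n) (fun v : rvm R n => phi v * f s v).
  move=> sT; apply: (integ_le _ _ _ _ _ (integZ _ K _ (fi s sT))) => [|v].
    by apply: measurable_funM => //; exact: mf.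
  by rewrite normrM (ger0_norm (f0 s v sT)) ler_wpM2r ?f0.
apply/subspace_continuousP => t; rewrite /= in_itv /= => tT.
apply/cvgrPdist_lt => e e0.
have [[_ [[_ h] _]] _] := hf.
have e1 : 0 < e / (K + 1) by rewrite divr_gt0// ltr_wpDl.
have [del del0 hdel] := h t tT _ e1.
apply/nbhs_ballP; exists del => //= s ts; rewrite /= in_itv /= => sT.
have st : `|s - t| < del by rewrite distrC.
have mB : measurable_fun setT (fun v : rvm R n => f s v - f t v).
  by apply: measurable_funB; exact: mf.
have := hdel s sT st; rewrite weighted_iintE// => lt1.
have iw : integ (lebn n) (fun v : rvm R n => (1 + normv v `^ kappa gamma) * `|f s v - f t v|).
  by apply: weighted_integ => //; rewrite weighted_iintE// (lt_le_trans lt1)// leey.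
rewrite -EFin_Rintegral// lte_fin in lt1.
rewrite /from_subspace (rintE _ (ip s sT)) (rintE _ (ip t tT)).
rewrite distrC -RintegralB//; [|exact: ip|exact: ip].
apply: le_lt_trans (_ : \int[lebn n]_v (K * ((1 + normv v `^ kappa gamma) * `|f s v - f t v|)) < _).
  apply: norm_Rintegral_le; [|exact: integZ|move=> v].
    by apply: integ_meas; apply: (integB (lebn n) _ _ (ip s sT) (ip t tT)).
  rewrite -mulrBr normrM ler_pM// ler_peMl//; exact: weight_ge1.
rewrite RintegralZl//.
apply: le_lt_trans (_ : K * (e / (K + 1)) < _); first by rewrite ler_wpM2l// ltW.
rewrite mulrA ltr_pdivrMr ?ltr_wpDl//; have := e0; nra.
Qed.

Lemma moment_constant (phi : 'rV[R]_n -> R) K : test_fun phi ->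
  measurable_fun setT (phi : rvm R n -> R) -> (forall v, `|phi v| <= K) ->
  (forall t, 0 <= t <= Tf -> coll gamma eps (f t) phi = 0%E) ->
  forall t, 0 <= t <= Tf -> rint (fun v => phi v * f t v) = rint (fun v => phi v * f 0 v).
Proof.
move=> tphi mphi phiK c0 t /andP[t0 tT].
have [->//|tn0] := eqVneq t 0.
have {}t0 : 0 < t by rewrite lt_neqAle eq_sym tn0.
have [_ [hder _]] := hf.
have der (s : R) : s \in `]0, t[%R ->
    is_derive s (1 : R) (fun s => rint (fun v => phi v * f s v)) 0.
  rewrite in_itv /= => /andP[s0 st]; have sT : s < Tf by exact: lt_le_trans tT.
  have sT' : 0 < s < Tf by rewrite s0.
  have [D [hD]] := hder phi tphi s sT'.
  rewrite c0 ?(ltW s0) ?(ltW sT)// mule0 => -[D0].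
  by rewrite -D0.
have cont : {within `[0, t], continuous (fun s => rint (fun v => phi v * f s v))}.
  apply: (continuous_subspaceW _ (moment_continuous phi K mphi phiK)) => s /=.
  by rewrite !in_itv /= => /andP[-> st] /=; exact: le_trans tT.
have [c _] := MVT t0 der cont.
by rewrite mul0r => /eqP; rewrite subr_eq0 => /eqP.
Qed.

(** Positivity of the mass is assumed at time 0 and used at every time. The constant 1 is not a test
    function, so the moments of the cutoffs are shown to be constant and [c] tends to 0. *)
Lemma mass_constant :
  (forall phi : 'rV[R]_n -> R, test_fun phi ->
    forall t, 0 <= t <= Tf -> coll gamma eps (f t) phi = 0%E) ->
  forall t, 0 <= t <= Tf -> \int[lebn n]_v f t v = \int[lebn n]_v f 0 v.
Proof.
move=> c0 t tT; have z0 : (0 : R) <= 0 <= Tf by rewrite lexx ltW.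
have h1 (w : rvm R n) : `|1 : R| <= 1 * (1 + sqn w) by rewrite normr1 mul1r lerDl sqn_ge0.
have tch j : test_fun (@cutoff R n (cseq j)).
  have p : (0 : R) < cseq j by rewrite invr_gt0 ltr0n.
  (* The cutoff itself is a truncated convolution, that of [psi eps] with 1. *)
  have := test_fun_cutoff_convol eps (cseq j) 1 (fun=> 1) eps0 p
    (measurable_cst _) h1 (psi eps) (gker_psi eps).
  by congr test_fun; apply/funext => v; rewrite conv_psi1// mulr1.
have mch j : measurable_fun setT (@cutoff R n (cseq j) : rvm R n -> R).
  by apply: measurable_funM; [exact: measurable_cst|exact: measurable_bump].
have bch j v : `|@cutoff R n (cseq j) v| <= expR 1.
  by rewrite ger0_norm ?cutoff_ge0// cutoff_le.
have lim s : 0 <= s <= Tf ->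
    (fun j => rint (fun v => cutoff (cseq j) v * f s v)) @ \oo --> \int[lebn n]_v f s v.
  move=> sT.
  have mj j : measurable_fun setT (fun v : rvm R n => cutoff (cseq j) v * f s v).
    by apply: measurable_funM => //; exact: mf.
  have dj j (v : rvm R n) : `|cutoff (cseq j) v * f s v| <= expR 1 * f s v.
    by rewrite normrM (ger0_norm (f0 s v sT)) ler_wpM2r ?f0.
  have [_ cl] := dct (lebn n) (fun j (v : rvm R n) => cutoff (cseq j) v * f s v)
    (fun v => 1 * f s v) _ mj (integZ _ _ _ (fi s sT)) dj
    (fun v => cvg_mulr _ _ _ (cvg_cutoff v)).
  have rE j : rint (fun v => cutoff (cseq j) v * f s v) =
      \int[lebn n]_v (cutoff (cseq j) v * f s v).
    by apply: rintE; exact: (integ_le _ _ _ (mj _) (dj _) (integZ _ _ _ (fi s sT))).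
  rewrite (funext rE : (fun j => rint (fun v => cutoff (cseq j) v * f s v)) = _).
  have one : \int[lebn n]_v (1 * f s v) = \int[lebn n]_v f s v.
    by apply: eq_Rintegral => v _; rewrite mul1r.
  by rewrite one in cl.
have e j : rint (fun v => cutoff (cseq j) v * f t v) = rint (fun v => cutoff (cseq j) v * f 0 v).
  exact: (moment_constant _ _ (tch j) (mch j) (bch j) (c0 _ (tch j)) t tT).
have l1 := lim t tT; have l2 := lim 0 z0.
have l3 : (fun j => rint (fun v => cutoff (cseq j) v * f t v)) @ \oo --> \int[lebn n]_v f 0 v.
  by under eq_fun do rewrite e.
exact: (cvg_unique _ l1 l3).
Qed.

Lemma stationary_maxwellian : (2 <= n)%N -> (0 < iint n (fun v => (f 0 v)%:E))%E ->
  (forall phi : 'rV[R]_n -> R, test_fun phi ->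
    forall t, 0 <= t <= Tf -> coll gamma eps (f t) phi = 0%E) ->
  forall t, 0 <= t <= Tf -> exists (l0 : R) (l1 : 'rV[R]_n) (l2 : R),
    l2 != 0 /\ eps * `|l2| < 1 /\
    (forall v, dE eps (f t) v = l0 + dotv l1 v + l2 / 2 * sqn v) /\
    iint n (fun v => (`|f t v -
      maxwellian (rho_of n eps l0 l1 l2) (u_of l1 l2) (T_of eps l2) v|)%:E) = 0%E.
Proof.
move=> n2 hmass c0 t tT; have z0 : (0 : R) <= 0 <= Tf by rewrite lexx ltW.
have mass : 0 < \int[lebn n]_v f t v.
  rewrite mass_constant// -lte_fin EFin_Rintegral ?fi//.
  rewrite -ge0_iintE//; first by apply/measurable_EFinP; exact: mf.
  by move=> v; rewrite lee_fin f0.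
have c0t phi : test_fun phi -> coll gamma eps (f t) phi = 0%E by move=> tp; exact: c0.
have [l0 [l1 [l2 dEq]]] := coll_null_quadratic gamma eps (f t) hgamma eps0
  (fun v => f0 t v tT) (fi t tT) (fi2 t tT) (fk t tT) mass n2 c0t.
have [h1 h2 h3] := quadratic_maxwellian eps (f t) eps0 (fun v => f0 t v tT) (fi t tT)
  (fi2 t tT) mass l0 l2 l1 dEq (ltnW n2).
by exists l0, l1, l2.
Qed.

(** The Maxwellian form supplies the positive mass at time [t] under which [graddE] is the gradient
    of [dE]. The integrand then vanishes for every pair, so [phi] may be arbitrary. *)
Lemma maxwellian_stationary (l0 l2 : R) (l1 : 'rV[R]_n) t phi : 0 <= t <= Tf ->
  l2 != 0 -> eps * `|l2| < 1 ->
  (forall v, dE eps (f t) v = l0 + dotv l1 v + l2 / 2 * sqn v) ->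
  iint n (fun v => (`|f t v -
    maxwellian (rho_of n eps l0 l1 l2) (u_of l1 l2) (T_of eps l2) v|)%:E) = 0%E ->
  coll gamma eps (f t) phi = 0%E.
Proof.
move=> tT l20 hl dEq fM.
have a0 : 0 < `|l2| by rewrite normr_gt0.
have T0 : 0 < T_of eps l2.
  by rewrite /T_of subr_gt0 -[X in _ < X]mul1r ltr_pdivlMr.
set rho := rho_of _ _ _ _ _ in fM; set u := u_of _ _ in fM; set T := T_of _ _ in fM T0.
have rho0 : 0 < rho by rewrite mulr_gt0 ?expR_gt0// powR_gt0// divr_gt0// mulr_gt0// pi_gt0.
have iM := maxwellian_integ rho T u T0.
have mk : measurable_fun setT (fun v : rvm R n => f t v - maxwellian rho u T v).
  exact: integ_meas (integB _ _ _ (fi t tT) iM).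
have mass : 0 < \int[lebn n]_v f t v.
  have -> : \int[lebn n]_v f t v = \int[lebn n]_v maxwellian rho u T v.
    apply: ae_eq_Rintegral; [exact: mf|exact: integ_meas iM|].
    move: fM; rewrite ge0_iintE; [|by apply/measurable_EFinP; exact: mnorm|by move=> v; rewrite lee_fin].
    have mE : measurable_fun setT (EFin \o (fun v : rvm R n => f t v - maxwellian rho u T v)).
      exact/measurable_EFinP.
    move/(ae_eq_integral_abs (lebn n) measurableT mE).1.
    apply: negligibleS => v /= h H; apply: h.
    by have [/eqP] := H I; rewrite subr_eq0 => /eqP.
  have E (v : rvm R n) : maxwellian rho u T v =
      rho * (2 * pi * T) `^ (- (n%:R / 2)) * gk T (u - (v : 'rV[R]_n)) by rewrite maxwellianE.
  rewrite (funext E : maxwellian rho u T = _) RintegralZl//; last exact: gauss_integ.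
  have p0 : 0 < 2 * pi * T by rewrite !mulr_gt0// pi_gt0.
  rewrite gauss_Rintegral//; apply: mulr_gt0; last exact: powR_gt0.
  by apply: mulr_gt0 => //; exact: powR_gt0.
have G v : graddE eps (f t) v = l1 + l2 *: v.
  rewrite -(hasgradE _ _ (hasgrad_dE eps (f t) eps0 (fun v => f0 t v tT) (fi t tT) (fi2 t tT) mass)).
  by rewrite (funext dEq : dE eps (f t) = _) (hasgradE _ _ (hasgrad_quadratic l0 l2 l1)).
rewrite /coll; apply: iint0 => v; apply: iint0 => w.
rewrite /Beps !G opprD addrACA subrr add0r -scalerBr AformE dotvZr dotvZr.
rewrite -/(sqn (v - w)) /sqn.
by congr (_%:E); ring.
Qed.

End Stationary.

(** Agreement with the Maxwellian is understood up to null sets, as an L1 distance equal to 0, and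
    the coefficients are found at each time. The positive initial mass excludes [f = 0]: there [ln]
    takes its default value 0, [dE] and the collision integral vanish, and the zero solution would
    be stationary although no [l2 != 0] fits. *)
Theorem theorem8 (R : realType) (d : nat) (gamma eps Tf : R)
  (f : R -> 'rV[R]_d -> R)
  (hd : (2 <= d)%N) (hgamma : -4 <= gamma <= 0) (heps : 0 < eps) (hTf : 0 < Tf)
  (hf : dissipative_sol gamma eps Tf f)
  (hmass : (0 < iint d (fun v => (f 0 v)%:E))%E) :
  stationary_state gamma eps Tf f <->
  (forall t, 0 <= t <= Tf ->
     exists (l0 : R) (l1 : 'rV[R]_d) (l2 : R),
       l2 != 0 /\ eps * `|l2| < 1 /\
       (forall v, dE eps (f t) v = l0 + dotv l1 v + l2 / 2 * sqn v) /\
       iint d (fun v =>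
         (`|f t v - maxwellian (rho_of d eps l0 l1 l2) (u_of l1 l2) (T_of eps l2) v|)%:E)
       = 0%E).
Proof.
split=> [[_ c0]|h].
  exact: (stationary_maxwellian gamma eps Tf f hgamma heps hTf hf hd hmass c0).
split=> // phi _ t tT; have [l0 [l1 [l2 [h1 [h2 [h3 h4]]]]]] := h t tT.
exact: (maxwellian_stationary gamma eps Tf f hgamma heps hf l0 l2 l1 t phi tT h1 h2 h3 h4).
Qed.
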